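(* Let $\mathcal{T}$ be a regular partition of $\Omega$ in squares. Then $$X_1^{\mathrm{rect}}(\mathcal{T})=\nabla_{\mathrm{NC}}V^{\mathrm{rot}}_{\mathrm{NC}}(\mathcal{T})\oplus\operatorname{Curl}V_{Q,1}(\mathcal{T})$$ and the decomposition is $L^2$ orthogonal.
   Context: $\Omega\subseteq\mathbb{R}^2$ is a simply connected, bounded, polygonal Lipschitz domain. A regular partition of $\Omega$ in quadrilaterals (in particular squares) is a finite set $\mathcal{T}$ of closed quadrilaterals (squares) with $\overline\Omega=\bigcup\mathcal{T}$ such that any two distinct elements are either disjoint or share exactly one common edge or one vertex. For scalar $\beta$, $\operatorname{Curl}\beta:=(\partial\beta/\partial x_2,-\partial\beta/\partial x_1)$; $\nabla_{\mathrm{NC}}$ is the piecewise gradient with respect to $\mathcal{T}$. $Y:=H^1(\Omega)\cap L^2_0(\Omega)$, where $L^2_0(\Omega)$ is the set of $L^2(\Omega)$ functions with vanishing integral mean. Let $\widehat T=[0,1]^2$ be the reference rectangle with coordinates $(\widehat x,\widehat y)$ and, for $T\in\mathcal{T}$, let $\psi_T:\widehat T\to T$ be the bilinear transformation from $\widehat T$ onto $T$ (affine for squares), with $D(\psi_T^{-1})$ the Jacobian matrix of $\psi_T^{-1}$. Let $Q_1(\widehat T):=\operatorname{span}\{1,\widehat x,\widehat y,\widehat x\widehat y\}$ (the span of products $f(\widehat x)g(\widehat y)$ with $f,g$ polynomials of degree $\le1$), and $$V_{Q,1}(\mathcal{T}):=\{\beta_h\in Y\mid\forall T\in\mathcal{T}:\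 \beta_h\circ\psi_T\in Q_1(\widehat T)\}.$$ Let $X_1^{\mathrm{rect}}(\widehat T)$ be the set of all fields $\rho(\widehat x,\widehat y)=a\begin{pmatrix}-\widehat x\\ \widehat y\end{pmatrix}+d$ with $a\in\mathbb{R}$, $d\in\mathbb{R}^2$, and let $X_1^{\mathrm{rect}}(\mathcal{T})$ be the set of all $\tau_h\in L^2(\Omega;\mathbb{R}^2)$ such that for every $T\in\mathcal{T}$ there is $\rho_T\in X_1^{\mathrm{rect}}(\widehat T)$ with $$\tau_h\circ\psi_T=\begin{pmatrix}0&1\\-1&0\end{pmatrix}\big(D(\psi_T^{-1})^\top\circ\psi_T\big)\begin{pmatrix}0&-1\\1&0\end{pmatrix}\rho_T\quad\text{on }\widehat T.$$ Let $Q^{\mathrm{rot}}(\widehat T):=\operatorname{span}\{1,\widehat x,\widehat y,\widehat x^2-\widehat y^2\}$ and let $V^{\mathrm{rot}}_{\mathrm{NC}}(\mathcal{T})$ be the set of all $v_h\in L^2(\Omega)$ such that $v_h\circ\psi_T\in Q^{\mathrm{rot}}(\widehat T)$ for all $T\in\mathcal{T}$, and $\int_E v_h\,ds$ is continuous for all interior edges $E$ (i.e. the integrals over $E$ of the traces of $v_h$ from the two adjacent elements coincide) and vanishes for all boundary edges $E$. *)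

(* Defs.v *)
From mathcomp Require Import all_boot all_order all_algebra.
From mathcomp Require Import all_classical all_reals all_analysis.

Set Implicit Arguments.
Unset Strict Implicit.
Unset Printing Implicit Defensive.

Import Order.TTheory GRing.Theory Num.Theory.
Import numFieldNormedType.Exports.

Local Open Scope classical_set_scope.
Local Open Scope ring_scope.

(** Points of the plane are elements of [R * R], which
    carries the product topology and the product sigma-algebra; vector fields
    take values in column vectors ['cV[R]_2].  The canonical norm on [R * R] is
    the maximum norm, hence the separate Euclidean [enorm].

    Elements of Lebesgue and Sobolev spaces are represented by functions, and
    identities between them hold almost everywhere. *)

Section Plane.
Context {R : realType}.
Implicit Types (A B p q : R * R) (f : R * R -> R).

Definition leb2 :
    {measure set (measurableTypeR R * measurableTypeR R) -> \bar R} :=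
  (@lebesgue_measure R \x @lebesgue_measure R)%E.

Definition evec (i : 'I_2) : R * R := if i == 0 then (1, 0) else (0, 1).
Definition coord2 (i : 'I_2) p : R := if i == 0 then p.1 else p.2.
Definition dot p q : R := p.1 * q.1 + p.2 * q.2.
Definition enorm p : R := Num.sqrt (dot p p).
Definition perp p : R * R := (- p.2, p.1).

Definition col2 (a b : R) : 'cV[R]_2 := \col_i (if i == 0 then a else b).
Definition mx2 (a b c d : R) : 'M[R]_2 :=
  \matrix_(i, j) (if i == 0 then (if j == 0 then a else b)
                  else (if j == 0 then c else d)).

Definition segment A B : set (R * R) :=
  [set A + t *: (B - A) | t in `[0, 1]].

(** For a map of the plane into itself, with the usual convention
    (row = component, column = variable). *)
Definition Jac (phi : R * R -> R * R) p : 'M[R]_2 :=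
  \matrix_(i, j) 'D_(evec j) (coord2 i \o phi) p.

(** ** Domains *)

Definition bdry (Omega : set (R * R)) : set (R * R) :=
  closure Omega `\` interior Omega.

(** Every loop is homotopic in [Omega], with fixed base point, to a constant. *)
Definition simply_connected (Omega : set (R * R)) : Prop :=
  connected Omega /\
  forall gamma : R -> R * R,
    {within `[0, 1], continuous gamma} ->
    (forall t : R, t \in `[0, 1] -> Omega (gamma t)) ->
    gamma 0 = gamma 1 ->
    exists H : R * R -> R * R,
      [/\ {within `[0, 1] `*` `[0, 1], continuous H},
          forall s t : R, s \in `[0, 1] -> t \in `[0, 1] -> Omega (H (s, t)),
          forall t : R, t \in `[0, 1] -> H (0, t) = gamma t,
          forall t : R, t \in `[0, 1] -> H (1, t) = gamma 0 &
          forall s : R, s \in `[0, 1] -> H (s, 0) = gamma 0 /\ H (s, 1) = gamma 0].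

(** Near each boundary point, in some orthonormal coordinates, [Omega] is the
    strict epigraph of a Lipschitz function. *)
Definition lipschitz_boundary (Omega : set (R * R)) : Prop :=
  forall x, bdry Omega x ->
  exists (e : R * R) (r : R) (g : R -> R) (k : R),
    [/\ enorm e = 1, 0 < r, k.-lipschitz g &
        forall y, enorm (y - x) < r ->
          (Omega y <-> g (dot y e) < dot y (perp e))].

Definition polygonal (Omega : set (R * R)) : Prop :=
  exists s : seq ((R * R) * (R * R)),
    bdry Omega = [set p | exists2 AB, AB \in s & segment AB.1 AB.2 p].

Definition admissible_domain (Omega : set (R * R)) : Prop :=
  [/\ open Omega, Omega !=set0, bounded_set Omega & simply_connected Omega] /\
  (polygonal Omega /\ lipschitz_boundary Omega).

(** ** Regular partitions in squares *)

Definition That : set (R * R) := `[0, 1] `*` `[0, 1].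

(** The closed square with side [A B] that lies to the left of [A -> B]. *)
Definition square_on A B : set (R * R) :=
  [set A + z.1 *: (B - A) + z.2 *: perp (B - A) | z in That].

Definition is_square (T : set (R * R)) : Prop :=
  exists A B, A <> B /\ T = square_on A B.

(** [A] and [B] are the endpoints, in either order, of an edge of [T]. *)
Definition is_edge (T : set (R * R)) A B : Prop :=
  A <> B /\ (T = square_on A B \/ T = square_on B A).

Definition is_vertex (T : set (R * R)) A : Prop := exists B, is_edge T A B.

Definition regular_square_partition
    (Omega : set (R * R)) (TT : set (set (R * R))) : Prop :=
  [/\ finite_set TT,
      forall T, TT T -> is_square T,
      closure Omega = \bigcup_(T in TT) T &
      forall T1 T2, TT T1 -> TT T2 -> T1 <> T2 ->
        [\/ T1 `&` T2 = set0,
            exists A B, [/\ is_edge T1 A B, is_edge T2 A B &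
                            T1 `&` T2 = segment A B] |
            exists A, [/\ is_vertex T1 A, is_vertex T2 A &
                          T1 `&` T2 = [set A]]]].

(** Only the values of [psi] on the reference square matter. *)
Definition bilinear_transformation
    (psi : R * R -> R * R) (T : set (R * R)) : Prop :=
  (exists a b c d : R * R, forall z, That z ->
     psi z = a + z.1 *: b + z.2 *: c + (z.1 * z.2) *: d) /\
  set_bij That T psi.

(** ** Function spaces *)

Definition L2 (Omega : set (R * R)) f : Prop :=
  f \_ Omega \in Lfun leb2 2%:E.

Definition L2field (Omega : set (R * R)) (tau : R * R -> 'cV[R]_2) : Prop :=
  forall i, L2 Omega (fun p => tau p i 0).

Definition iter_partial (ds : seq 'I_2) f : R * R -> R :=
  foldr (fun i (g : R * R -> R) => 'D_(evec i) g) f ds.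

(** [C_c^oo(Omega)] *)
Definition test_function (Omega : set (R * R)) f : Prop :=
  (forall ds p, differentiable (iter_partial ds f) p) /\
  (let supp := closure [set p | f p != 0] in
   compact supp /\ supp `<=` Omega).

Definition weak_partial (Omega : set (R * R)) (i : 'I_2)
    (f g : R * R -> R) : Prop :=
  forall phi, test_function Omega phi ->
    \int[leb2]_(p in Omega) (f p * 'D_(evec i) phi p) =
    - \int[leb2]_(p in Omega) (g p * phi p).

Definition H1 (Omega : set (R * R)) f : Prop :=
  L2 Omega f /\
  forall i, exists2 g, L2 Omega g & weak_partial Omega i f g.

Definition Yspace (Omega : set (R * R)) f : Prop :=
  H1 Omega f /\ \int[leb2]_(p in Omega) f p = 0.

(** [tau] is the field [Curl f = (d f / d x_2, - d f / d x_1)]. *)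
Definition is_Curl (Omega : set (R * R)) f (tau : R * R -> 'cV[R]_2) : Prop :=
  [/\ L2field Omega tau,
      weak_partial Omega 1 f (fun p => tau p 0 0) &
      weak_partial Omega 0 f (fun p => - tau p 1 0)].

(** [tau] is the piecewise gradient of [f]: on each [T], [f] agrees almost
    everywhere with a function differentiable in the interior of [T] whose
    gradient is [tau]. *)
Definition is_gradNC (Omega : set (R * R)) (TT : set (set (R * R)))
    f (tau : R * R -> 'cV[R]_2) : Prop :=
  L2field Omega tau /\
  forall T, TT T -> exists w : R * R -> R,
    [/\ f = w %[ae leb2 in T],
        forall p, interior T p -> differentiable w p &
        tau = (fun p => \col_i 'D_(evec i) w p) %[ae leb2 in interior T]].

(** ** Discrete spaces *)

Definition Q1 (q : R * R -> R) : Prop :=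
  exists a b c d : R, forall z,
    q z = a + b * z.1 + c * z.2 + d * (z.1 * z.2).

Definition Qrot (q : R * R -> R) : Prop :=
  exists a b c d : R, forall z,
    q z = a + b * z.1 + c * z.2 + d * (z.1 ^+ 2 - z.2 ^+ 2).

Definition X1rect_hat (rho : R * R -> 'cV[R]_2) : Prop :=
  exists (a : R) (d : 'cV[R]_2), forall z, rho z = a *: col2 (- z.1) z.2 + d.

(** In the following, [psi T] is the bilinear transformation onto [T]. *)

Definition VQ1 (Omega : set (R * R)) (TT : set (set (R * R)))
    (psi : set (R * R) -> R * R -> R * R) (beta : R * R -> R) : Prop :=
  Yspace Omega beta /\
  forall T, TT T ->
    exists2 q, Q1 q & beta \o psi T = q %[ae leb2 in That].

(** [pinv That (psi T)] is the inverse of [psi T : That -> T], extended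
    arbitrarily outside [T]; its Jacobian matrix is meaningful in the interior
    of [T], that is, at [psi T z] for almost every [z] in [That]. *)
Definition X1rect (Omega : set (R * R)) (TT : set (set (R * R)))
    (psi : set (R * R) -> R * R -> R * R) (tau : R * R -> 'cV[R]_2) : Prop :=
  L2field Omega tau /\
  forall T, TT T ->
    exists2 rho, X1rect_hat rho &
      tau \o psi T =
      (fun z => mx2 0 1 (-1) 0 *m (Jac (pinv That (psi T)) (psi T z))^T
                *m mx2 0 (-1) 1 0 *m rho z)
      %[ae leb2 in That].

(** [w] is the continuous representative of [f] on the closed set [T], which
    gives the traces of [f] from [T] on the edges of [T]. *)
Definition trace_rep (T : set (R * R)) f (w : R * R -> R) : Prop :=
  {within T, continuous w} /\ f = w %[ae leb2 in T].

Definition edge_integral A B f : R :=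
  enorm (B - A) *
  \int[@lebesgue_measure R]_(t in `[0, 1]) f (A + t *: (B - A)).

Definition VrotNC (Omega : set (R * R)) (TT : set (set (R * R)))
    (psi : set (R * R) -> R * R -> R * R) (v : R * R -> R) : Prop :=
  [/\ L2 Omega v,
      forall T, TT T ->
        exists2 q, Qrot q & v \o psi T = q %[ae leb2 in That] &
      exists w : set (R * R) -> R * R -> R,
        [/\ forall T, TT T -> trace_rep T v (w T),
            forall T1 T2 A B, TT T1 -> TT T2 -> T1 <> T2 ->
              is_edge T1 A B -> is_edge T2 A B ->
              edge_integral A B (w T1) = edge_integral A B (w T2) &
            forall T A B, TT T -> is_edge T A B ->
              segment A B `<=` bdry Omega -> edge_integral A B (w T) = 0]].

Definition gradNC_VrotNC (Omega : set (R * R)) (TT : set (set (R * R)))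
    (psi : set (R * R) -> R * R -> R * R) (tau : R * R -> 'cV[R]_2) : Prop :=
  exists2 v, VrotNC Omega TT psi v & is_gradNC Omega TT v tau.

Definition Curl_VQ1 (Omega : set (R * R)) (TT : set (set (R * R)))
    (psi : set (R * R) -> R * R -> R * R) (tau : R * R -> 'cV[R]_2) : Prop :=
  exists2 beta, VQ1 Omega TT psi beta & is_Curl Omega beta tau.

(** ** Decompositions in [L^2(Omega; R^2)] *)

Definition L2_direct_sum (Omega : set (R * R))
    (X V W : (R * R -> 'cV[R]_2) -> Prop) : Prop :=
  (forall tau, L2field Omega tau ->
     (X tau <-> exists s1 s2, [/\ V s1, W s2 &
                  tau = (fun p => s1 p + s2 p) %[ae leb2 in Omega]])) /\
  (forall s, V s -> W s -> s = (fun=> 0) %[ae leb2 in Omega]).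

Definition L2_orthogonal (Omega : set (R * R))
    (V W : (R * R -> 'cV[R]_2) -> Prop) : Prop :=
  forall s1 s2, V s1 -> W s2 ->
    \int[leb2]_(p in Omega) (\sum_(i < 2) s1 p i 0 * s2 p i 0) = 0.

End Plane.

(* Main.v *)
(** The map [psi T] is a similarity: being injective and onto [T], it must send
    corners to corners in cyclic order.  Up to this similarity all three spaces
    consist, on every square, of the fields [(p + s (x - 1/2), q - s (y - 1/2))].
    A rotated bilinear function is determined by its edge means [m k] and a
    bilinear one by its corner values [u k]; the gradient of the former pairs
    with a field by [\sum_k flux k * m k], while the flux of the curl of the
    latter through the edge [k] is [u (k + 1) - u k].  Summing over the mesh,
    interior edges cancel and boundary edges carry [m = 0], which gives
    orthogonality.  Conversely, if a field is orthogonal to all gradients, its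
    fluxes through the two sides of every interior edge cancel; as they add up to
    zero on each square, they are increments of corner values on each square, and
    since [Omega] is simply connected the additive constants can be chosen so
    that these values agree at common vertices (monodromy).

    Testing against bumps supported in a square, resp. near an edge, shows that
    a piecewise bilinear function has a square integrable weak gradient iff it
    has no jumps; Green's formula on each square gives the other direction. *)

From HB Require Import structures.
Require Import Defs.
From mathcomp Require Import all_boot all_order all_algebra.
From mathcomp Require Import all_classical all_reals all_analysis.
From mathcomp Require Import measurable_realfun.
From mathcomp Require Import ring lra zify.

Set Implicit Arguments.
Unset Strict Implicit.
Unset Printing Implicit Defensive.

Import Order.TTheory GRing.Theory Num.Theory.
Import numFieldNormedType.Exports.

Local Open Scope classical_set_scope.
Local Open Scope ring_scope.

(** Each space becomes a condition on the coefficients [c i] of a field on the squares ([has_coef]):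
    none for [X1rect], [grad_match] for the gradients, [edge_match] for the curls. What remains is
    finite-dimensional. No dimension count, hence no Euler formula, enters: the projection onto the
    gradients exists, and monodromy turns the remainder into a curl. Two obstacles shape the
    geometry. A partition covers only the closure, so a slit of the boundary might run along an edge
    common to two squares; the Lipschitz condition excludes this through
    [interior (closure Omega) = Omega], which puts the relative interior of every common edge inside
    [Omega]. Moreover, vertices may lie on the boundary, where loops are not allowed; the monodromy
    paths therefore join centres of squares and cross edges at their midpoints. Accordingly
    [edge_match] compares corner values across common edges only, and not at an isolated common
    vertex; weak derivatives do not see more. *)

Section LinearChange.

(** * Affine change of variables in the plane *)

Context {R : realType}.
Notation mu := (@lebesgue_measure R).
Notation P := (measurableTypeR R * measurableTypeR R)%type.
Notation leb2 := (@leb2 R).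

Lemma scaleRE (x y : R) : x *: y = x * y.
Proof. by []. Qed.

Lemma fineZl (k : R) (x : \bar R) : x \is a fin_num -> fine (k%:E * x)%E = k * fine x.
Proof. by case: x. Qed.

Lemma measurable_affine1 (c e : R) :
  measurable_fun setT ((fun x => c * x + e) : measurableTypeR R -> measurableTypeR R).
Proof. by apply: measurable_funD => //; apply: measurable_funM. Qed.

(** Lebesgue measure is determined by its values on half-open intervals, and the rescaled image
    measure has the same ones. *)
Lemma lebesgue_affine1 (c e : R) (X : set (measurableTypeR R)) : c != 0 ->
  measurable X -> mu ((fun x : measurableTypeR R => c * x + e) @^-1` X) = (`|c|^-1%:E * mu X)%E.
Proof.
move=> c0 mX.
pose phi : measurableTypeR R -> measurableTypeR R := fun x => c * x + e.
have mphi : measurable_fun setT phi by exact: measurable_affine1.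
have ac : 0 < `|c| by rewrite normr_gt0.
pose k : {nonneg R} := NngNum (ltW ac).
pose m : {measure set (measurableTypeR R) -> \bar R} :=
  mscale k (pushforward mu phi).
have H : forall A, measurable A -> mu A = m mphi A.
  apply: lebesgue_measure_unique => _ [[a b]] _ <-.
  rewrite /m /= /mscale /= /pushforward /=.
  (* A negative factor moves the closed end to the left; the length is not affected. *)
  have -> : phi @^-1` `]a, b]%classic =
    (if 0 < c then `](a - e) / c, (b - e) / c] else `[(b - e) / c, (a - e) / c[)%classic.
    apply/seteqP; split=> x; rewrite /phi /=.
      case: ltgtP c0 => // c0 _; rewrite /= !in_itv/= => /andP[h1 h2].
        by rewrite ltr_pdivrMr// ler_pdivlMr//; apply/andP; split; lra.
      by rewrite ler_ndivrMr// ltr_ndivlMr//; apply/andP; split; lra.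
    case: ltgtP c0 => // c0 _; rewrite /= !in_itv/=.
      rewrite ltr_pdivrMr// ler_pdivlMr// => /andP[h1 h2].
      by apply/andP; split; lra.
    rewrite ler_ndivrMr// ltr_ndivlMr// => /andP[h1 h2].
    by apply/andP; split; lra.
  rewrite lebesgue_measure_itv/= lte_fin.
  case: (ltgtP 0 c) c0 => // c0 _.
  - rewrite lebesgue_measure_itv/= lte_fin ltr_pM2r ?invr_gt0// ltrD2r.
    case: ifPn => _; last by rewrite mule0.
    by rewrite -!EFinD -EFinM gtr0_norm//; congr EFin; field; rewrite gt_eqF.
  - rewrite lebesgue_measure_itv/= lte_fin ltr_nM2r ?invr_lt0// ltrD2r.
    case: ifPn => _; last by rewrite mule0.
    by rewrite -!EFinD -EFinM ltr0_norm//; congr EFin; field; rewrite lt_eqF.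
rewrite (H _ mX) /m /= /mscale /= /pushforward /=.
by rewrite muleA -EFinM mulVf ?mul1e// gt_eqF.
Qed.

(** Gives the area as the integral of the lengths of the horizontal sections, on each of which the
    map of [leb2_shear1] is affine in one variable. *)
Lemma leb2E' (X : set P) : measurable X -> leb2 X = (mu \x^ mu)%E X.
Proof.
move=> mX; apply: product_measure_unique => // A B mA mB.
exact: product_measure2E.
Qed.

Lemma leb2X (A B : set (measurableTypeR R)) : measurable A -> measurable B ->
  leb2 (A `*` B) = (mu A * mu B)%E.
Proof. exact: product_measure1E. Qed.

Lemma leb2_shear1 (c k e : R) (X : set P) : c != 0 -> measurable X ->
  leb2 ((fun z : P => (c * z.1 + (k * z.2 + e), z.2) : P) @^-1` X) =
    (`|c|^-1%:E * leb2 X)%E.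
Proof.
move=> c0 mX; set S : P -> P := fun z => _.
have mS : measurable_fun setT S.
  apply/measurable_fun_pairP; split; rewrite /S/= /comp/=.
    apply: measurable_funD; first exact: measurable_funM.
    by apply: measurable_funD => //; exact: measurable_funM.
  exact: measurable_snd.
have mSX : measurable (S @^-1` X) by rewrite -[X in measurable X]setTI; exact: mS.
rewrite !leb2E'// /product_measure2.
rewrite -ge0_integralZl//; last exact: measurable_fun_ysection.
apply: eq_integral => y _ /=.
rewrite -(lebesgue_affine1 (k * y + e) c0); last exact: measurable_ysection.
congr (mu _); apply/seteqP; split=> x; rewrite /= /ysection /= ?inE//.
Qed.

Lemma leb2_swap (X : set P) : measurable X ->
  leb2 ((fun z : P => (z.2, z.1) : P) @^-1` X) = leb2 X.
Proof.
move=> mX.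
have mS : measurable_fun setT (fun z : P => (z.2, z.1) : P).
  by apply/measurable_fun_pairP; split => /=; [exact: measurable_snd|exact: measurable_fst].
pose m : {measure set P -> \bar R} := pushforward leb2 (fun z : P => (z.2, z.1) : P).
symmetry; apply: (@product_measure_unique _ _ _ _ _ mu mu (m mS)) => // A B mA mB.
rewrite /m /= /pushforward /=.
rewrite (_ : _ @^-1` _ = B `*` A).
  by rewrite leb2X// muleC.
by apply/seteqP; split => -[x y] /= [].
Qed.


Definition aff (a b c z : R * R) : R * R := a + z.1 *: b + z.2 *: c.
Definition det2 (b c : R * R) : R := b.1 * c.2 - b.2 * c.1.
Definition invaff (a b c p : R * R) : R * R :=
  (det2 (p - a) c / det2 b c, det2 b (p - a) / det2 b c).

Lemma affK (a b c : R * R) : det2 b c != 0 -> cancel (aff a b c) (invaff a b c).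
Proof.
move: a b c => [a1 a2] [b1 b2] [c1 c2]; rewrite /det2/= => D0 [x y].
by apply: injective_projections; rewrite /invaff /aff /det2 /= ?scaleRE; field.
Qed.

Lemma invaffK (a b c : R * R) : det2 b c != 0 -> cancel (invaff a b c) (aff a b c).
Proof.
move: a b c => [a1 a2] [b1 b2] [c1 c2]; rewrite /det2/= => D0 [x y].
by apply: injective_projections; rewrite /invaff /aff /det2 /= ?scaleRE; field.
Qed.

Lemma measurable_aff (a b c : R * R) :
  measurable_fun setT (aff a b c : P -> P).
Proof.
apply/measurable_fun_pairP; split; rewrite /aff/= /comp/=;
  (apply: measurable_funD; first apply: measurable_funD) => //;
  by apply: measurable_funM => //; exact: measurable_cst.
Qed.

Lemma measurable_affV (a b c : R * R) (X : set P) : measurable X ->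
  measurable (aff a b c @^-1` X : set P).
Proof.
by move=> mX; rewrite -[X in measurable X]setTI; exact: measurable_aff.
Qed.

(** Lets every result about [aff] be applied to the inverse map as well. *)
Lemma invaffE (a b c : R * R) : det2 b c != 0 -> exists a' b' c',
  det2 b' c' != 0 /\ invaff a b c = aff a' b' c'.
Proof.
move: a b c => [a1 a2] [b1 b2] [c1 c2]; rewrite /det2/= => D0.
exists (det2 (- a1, - a2) (c1, c2) / det2 (b1, b2) (c1, c2),
        det2 (b1, b2) (- a1, - a2) / det2 (b1, b2) (c1, c2)).
exists (c2 / det2 (b1, b2) (c1, c2), - b2 / det2 (b1, b2) (c1, c2)).
exists (- c1 / det2 (b1, b2) (c1, c2), b1 / det2 (b1, b2) (c1, c2)).
rewrite /det2 /=; split.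
  rewrite (_ : _ - _ = (b1 * c2 - b2 * c1)^-1) ?invr_eq0//; by field.
apply/funext => -[x y]; 
by apply: injective_projections; rewrite /invaff /aff /det2 /= ?scaleRE; field.
Qed.

Lemma leb2_aff (a b c : R * R) (X : set P) : det2 b c != 0 -> measurable X ->
  leb2 (aff a b c @^-1` X) = (`|det2 b c|^-1%:E * leb2 X)%E.
Proof.
(* The first pivot must not vanish; otherwise the two columns are exchanged. *)
wlog b0 : b c X / b.1 != 0 => [hw|].
  move=> D0 mX; have [b0|b0] := eqVneq b.1 0; last exact: hw.
  have c0 : c.1 != 0.
    by apply: contra_neq D0 => c0; rewrite /det2 b0 c0 mul0r mulr0 subrr.
  have D0' : det2 c b != 0.
    by rewrite (_ : det2 c b = - det2 b c) ?oppr_eq0// /det2; ring.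
  rewrite (_ : det2 b c = - det2 c b) ?normrN; last by rewrite /det2; ring.
  rewrite -(hw c b X c0 D0' mX) -(leb2_swap (measurable_affV a c b mX)).
  by congr (leb2 _); apply/seteqP; split => z; rewrite /= /aff /= addrAC.
move: a b c b0 => [a1 a2] [b1 b2] [c1 c2] /= b0; rewrite /det2/= => D0 mX.
set D := b1 * c2 - b2 * c1 in D0 *.
(* Gaussian elimination: [S1] sets the first coordinate with pivot [b1], and [S2], conjugated by the
   exchange of coordinates, the second one with pivot [D / b1]. *)
pose S2 := fun z : P => ((D / b1) * z.1 + ((b2 / b1) * z.2 + (a2 - b2 * a1 / b1)), z.2) : P.
pose sw := fun z : P => (z.2, z.1) : P.
pose S1 := fun z : P => (b1 * z.1 + (c1 * z.2 + a1), z.2) : P.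
have -> : aff (a1, a2) (b1, b2) (c1, c2) = (fun z => sw (S2 (sw (S1 z)))).
  apply/funext => -[x y].
  apply: injective_projections; rewrite /= ?scaleRE; first by ring.
  by rewrite /D; field.
rewrite -[_ @^-1` X]/(S1 @^-1` (sw @^-1` (S2 @^-1` (sw @^-1` X)))).
have msw Y : measurable Y -> measurable (sw @^-1` Y).
  move=> mY; rewrite -[X in measurable X]setTI.
  by apply: (measurable_fun_pair (@measurable_snd _ _ _ _) (@measurable_fst _ _ _ _)).
have mS2 Y : measurable Y -> measurable (S2 @^-1` Y).
  move=> mY; rewrite -[X in measurable X]setTI.
  have -> : S2 = aff (a2 - b2 * a1 / b1, 0) (D / b1, 0) (b2 / b1, 1).
    by apply/funext => -[x y]; apply: injective_projections; rewrite /= ?scaleRE; ring.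
  exact: measurable_aff.
have D1 : D / b1 != 0 by rewrite mulf_neq0// invr_eq0.
rewrite /S1 leb2_shear1 //; last by apply: (msw); apply: mS2; exact: msw.
rewrite /sw leb2_swap; last by apply: mS2; exact: msw.
rewrite /S2 leb2_shear1//; last exact: msw.
rewrite leb2_swap// muleA -EFinM normf_div invf_div; congr (_%:E * _)%E.
by rewrite mulrA mulVf ?mul1r // normr_eq0.
Qed.

Lemma negligible_aff (a b c : R * R) (N : set P) : det2 b c != 0 ->
  leb2.-negligible N -> leb2.-negligible (aff a b c @^-1` N).
Proof.
move=> D0 [M [mM M0 NM]]; exists (aff a b c @^-1` M); split.
- exact: measurable_affV.
- by rewrite leb2_aff// M0 mule0.
- by move=> x /NM.
Qed.

Lemma negligible_affE (a b c : R * R) (N : set P) : det2 b c != 0 ->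
  leb2.-negligible (aff a b c @^-1` N) -> leb2.-negligible N.
Proof.
move=> D0; have [a' [b' [c' [D' E]]]] := invaffE a D0.
move=> /(negligible_aff a' D'); rewrite -E.
by apply: negligibleS => x Nx; rewrite /= invaffK.
Qed.

Lemma ge0_integral_aff (a b c : R * R) (D : set P) (f : P -> \bar R) :
  det2 b c != 0 -> measurable D -> measurable_fun D f ->
  (forall x, D x -> (0 <= f x)%E) ->
  (\int[leb2]_(x in D) f x =
   `|det2 b c|%:E * \int[leb2]_(z in aff a b c @^-1` D) f (aff a b c z))%E.
Proof.
move=> D0 mD mf f0.
have ma := measurable_aff a b c.
have ac : 0 < `|det2 b c| by rewrite normr_gt0.
pose k : {nonneg R} := NngNum (ltW ac).
rewrite -(@ge0_integral_pushforward _ _ _ _ _ _ ma leb2 D f mD mf); last first.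
  by move=> x /[!inE]; exact: f0.
pose m : {measure set P -> \bar R} := pushforward leb2 (aff a b c : P -> P).
rewrite -[X in (_ * X)%E]/(\int[m ma]_(x in D) f x)%E.
rewrite -[X in (X * _)%E]/(k%:num%:E) -ge0_integral_mscale//.
apply: eq_measure_integral => A mA AD.
rewrite /= /mscale /= /pushforward.
have -> := leb2_aff a D0 mA.
by rewrite muleA -EFinM divff ?mul1e// normr_eq0.
Qed.

Lemma integrable_aff (a b c : R * R) (D : set P) (f : P -> R) :
  det2 b c != 0 -> measurable D -> leb2.-integrable D (EFin \o f) ->
  leb2.-integrable (aff a b c @^-1` D) (EFin \o (f \o aff a b c)).
Proof.
move=> D0 mD /integrableP[mf fi]; apply/integrableP; split.
  apply/measurable_EFinP.
  apply: (@measurable_comp _ _ _ _ _ _ D) => //.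
  - by move=> _ [x Hx <-].
  - exact/measurable_EFinP.
  - by apply: measurable_funTS; exact: measurable_aff.
move: fi; rewrite (ge0_integral_aff a D0 mD) //; last first.
  by apply: measurableT_comp.
(* An infinite integral over the preimage would remain infinite after multiplication by the positive
   factor. *)
rewrite !ltey; apply: contra_neq => H.
by rewrite -[X in (_ * X)%E]/(integral _ _ _) [X in (_ * X)%E]H gt0_muley// lte_fin normr_gt0.
Qed.

Lemma Rintegral_aff (a b c : R * R) (D : set P) (f : P -> R) :
  det2 b c != 0 -> measurable D -> leb2.-integrable D (EFin \o f) ->
  \int[leb2]_(x in D) f x =
   `|det2 b c| * \int[leb2]_(z in aff a b c @^-1` D) f (aff a b c z).
Proof.
move=> D0 mD fi; have fi' := integrable_aff a D0 mD fi.
have mf : measurable_fun D (EFin \o f) by case/integrableP : fi.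
have ma := measurable_affV a b c mD.
rewrite /Rintegral integralE [in RHS]integralE.
have E1 := integrable_pos_fin_num mD fi.
have E2 := integrable_neg_fin_num mD fi.
have E3 := integrable_pos_fin_num ma fi'.
have E4 := integrable_neg_fin_num ma fi'.
rewrite (fineB E1 E2). rewrite (fineB E3 E4) mulrBr; congr (_ - _).
  rewrite (ge0_integral_aff a D0 mD)//; last exact: measurable_funepos.
  by rewrite -(fineZl _ E3); congr (fine (_ * _)); apply: eq_integral => z _; rewrite !funeposE.
rewrite (ge0_integral_aff a D0 mD)//; last exact: measurable_funeneg.
by rewrite -(fineZl _ E4); congr (fine (_ * _)); apply: eq_integral => z _; rewrite !funenegE.
Qed.

End LinearChange.

(** * Smooth bump functions *)

Section SmoothBumps.
Context {R : realType}.

(* The derivative of [flat P] is again of this form, hence smoothness. *)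
Definition flat (P : {poly R}) (x : R) : R :=
  if 0 < x then P.[x^-1] * expR (- x^-1) else 0.

(** Each monomial satisfies [t ^+ i <= i! * expR t], which explains the constant. *)
Lemma horner_le_expR (P : {poly R}) :
  exists2 C, 0 <= C & forall t : R, 0 <= t -> `|P.[t]| <= C * expR t.
Proof.
exists (\sum_(i < size P) `|P`_i| * i`!%:R).
  by apply: sumr_ge0 => i _; rewrite mulr_ge0.
move=> t t0; rewrite horner_coef mulr_suml.
apply: le_trans (ler_norm_sum _ _ _) _; apply: ler_sum => i _.
rewrite normrM -mulrA ler_wpM2l// ger0_norm ?exprn_ge0//.
case: i => -[|n] /= _; first by rewrite expr0 fact0 mul1r -expR0 ler_expR.
have := expR_ge1Dxn n t0; have f0 : 0 < (n.+1)`!%:R :> R by rewrite ltr0n fact_gt0.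
rewrite -ler_pdivrMl// => h; rewrite mulrC; apply: le_trans h.
by rewrite lerDr.
Qed.

(** The previous bound for [P * 'X^2] at [x^-1]. Quadratic decay makes the derivative at [0]
    vanish. *)
Lemma flat_le (P : {poly R}) :
  exists2 C, 0 <= C & forall x : R, `|flat P x| <= C * x ^+ 2.
Proof.
have [C C0 H] := horner_le_expR (P * 'X^2); exists C => // x.
rewrite /flat; case: ifPn => x0; last by rewrite normr0 mulr_ge0// sqr_ge0.
have xV0 : 0 < x^-1 by rewrite invr_gt0.
have := H _ (ltW xV0); rewrite hornerM hornerXn normrM normrM => h.
rewrite normrM (ger0_norm (expR_ge0 (- x^-1))) expRN.
rewrite ler_pdivrMr ?expR_gt0// mulrAC -ler_pdivrMr ?exprn_gt0// -exprVn.
by rewrite expr2; move: h; rewrite (gtr0_norm xV0).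
Qed.

Lemma is_derive_sq0 (f : R -> R) (C : R) : f 0 = 0 ->
  (forall x, `|f x| <= C * x ^+ 2) -> is_derive (0 : R) (1 : R) f 0.
Proof.
move=> f0 fC.
have H : (fun h : R => h^-1 *: ((f \o shift 0) (h *: 1) - f 0)) @ 0^' --> (0 : R).
  apply/cvgr0Pnorm_lt => e e0.
  (* The added [1] keeps the divisor positive when [C] is zero. *)
  have C1 : 0 < `|C| + 1 by rewrite ltr_wpDl.
  have d0 : 0 < e / (`|C| + 1) by rewrite divr_gt0.
  near=> h.
  have h0 : h != 0 by near: h; exact: nbhs_dnbhs_neq.
  rewrite /= addr0 f0 subr0 scaleRE [h *: _]mulr1 normrM normfV.
  rewrite ltr_pdivrMl ?normr_gt0//.
  apply: le_lt_trans (fC h) _.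
  have hd : `|h| < e / (`|C| + 1).
    near: h; apply: dnbhs0_lt => //.
  rewrite ltr_pdivlMr// in hd.
  have -> : h ^+ 2 = `|h| * `|h| by rewrite -normrM -expr2 ger0_norm ?sqr_ge0.
  apply: (@le_lt_trans _ _ (`|C| * (`|h| * `|h|))).
    by rewrite ler_wpM2r ?mulr_ge0// ler_norm.
  rewrite mulrCA ltr_pM2l ?normr_gt0//.
  apply: le_lt_trans hd; rewrite mulrC ler_wpM2l//; lra.
split; first by apply/cvg_ex; exists 0.
exact: cvg_lim H.
Unshelve. all: by end_near. Qed.

(** Differentiating [P(1/x) exp(-1/x)] produces the factor [x ^- 2] and the polynomial [P - P'],
    both evaluated through [1/x]; at the origin the quadratic bound takes over. *)
Lemma is_derive_flat (P : {poly R}) (x : R) :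
  is_derive x 1 (flat P) (flat ('X^2 * (P - P^`())) x).
Proof.
case: (ltgtP 0 x) => x0.
- rewrite {2}/flat x0.
  have nx : x != 0 by rewrite gt_eqF.
  apply: (@near_eq_is_derive _ _ _
    ((horner P \o (fun y : R => y^-1)) * (expR \o (fun y : R => - y^-1)))).
    near=> y; have y0 : 0 < y by near: y; exact: lt_nbhsr.
    by rewrite /flat y0.
  have dV : is_derive x 1 (fun y : R => y^-1) (- x ^- 2).
    have := @is_deriveV _ (fun y : R => y) x 1 1 nx (is_derive_id _ _).
    by rewrite scaleRE mulr1.
  have dNV : is_derive x 1 (fun y : R => - y^-1) (x ^- 2).
    by rewrite -[x ^- 2]opprK; apply: is_deriveN.
  have d1 := is_derive1_comp (is_derive_poly P x^-1) dV.
  have d2 := @is_derive1_comp _ expR (fun y : R => - y^-1) _ _ _ (is_derive_expR (- x^-1)) dNV.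
  have := is_deriveM d1 d2; congr (is_derive _ _ _ _).
  by rewrite /= !scaleRE hornerM hornerD hornerN hornerXn exprVn; ring.
- rewrite {2}/flat ltNge (ltW x0)/=.
  apply: (@near_eq_is_derive _ _ _ (cst (0 : R))).
  near=> y; have y0 : y < 0 by near: y; exact: lt_nbhsl.
  by rewrite /flat ltNge (ltW y0).
- rewrite -x0 {2}/flat ltxx; have [C _ H] := flat_le P.
  by apply: (is_derive_sq0 _ H); rewrite /flat ltxx.
Unshelve. all: by end_near. Qed.

Definition linf (a b c : R) (p : R * R) : R := a * p.1 + b * p.2 + c.

Lemma is_diff_linf (a b c : R) (p : R * R) :
  is_diff p (linf a b c) (fun v => a * v.1 + b * v.2).
Proof.
pose f := fun p : R * R => a * p.1 + b * p.2.
have lf : linear f.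
  by move=> k [x1 x2] [y1 y2]; rewrite /f/= !scaleRE; ring.
have cf : continuous f.
  move=> q; apply: cvgD; apply: cvgM; try exact: cvg_cst; [exact: cvg_fst|exact: cvg_snd].
pose fM := GRing.isLinear.Build _ _ _ _ _ lf.
pose fL : {linear _ -> _} := HB.pack f fM.
have H1 : is_diff p f f.
  split; first exact: (@linear_differentiable _ _ _ fL p cf).
  exact: (@diff_lin _ _ _ fL p cf).
have := is_diffD H1 (is_diff_cst c p).
by rewrite addr0.
Qed.

Lemma derive_linf_comp (g : R -> R) (a b c dg : R) (p v : R * R) :
  is_derive (linf a b c p) 1 g dg ->
  differentiable (g \o linf a b c) p /\
  'D_v (g \o linf a b c) p = (a * v.1 + b * v.2) * dg.
Proof.
move=> [dg1 dgE].
have d1 : differentiable g (linf a b c p) by apply/derivable1_diffP.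
have dl := is_diff_linf a b c p.
have d2 : differentiable (g \o linf a b c) p.
  by apply: differentiable_comp => //; case: dl.
split=> //; rewrite deriveE// diff_comp//.
have E : 'd (linf a b c) p = (fun v => a * v.1 + b * v.2) :> (_ -> _) by case: dl.
rewrite /= E.
by rewrite -[X in 'd _ _ X]mulr1 -[_ * 1]/(_ *: (1 : R)) linearZ/= -deriveE// dgE.
Qed.

(** A class closed under directional derivatives by construction, so that all iterated partial
    derivatives of a member are differentiable, as [test_function] demands. *)
Inductive smooth : (R * R -> R) -> Prop :=
| smooth_flat P a b c : smooth (flat P \o linf a b c)
| smoothD f g : smooth f -> smooth g -> smooth (f + g)
| smoothM f g : smooth f -> smooth g -> smooth (f * g)
| smoothZ (k : R) f : smooth f -> smooth (k \*: f).

Lemma smooth_derive f : smooth f ->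
  (forall p, differentiable f p) /\ (forall v, smooth ('D_v f)).
Proof.
elim=> {f} [P a b c|f g _ [df sf] _ [dg sg]|f g sf' [df sf] sg' [dg sg]|k f _ [df sf]].
- have H p v := derive_linf_comp v (is_derive_flat P (linf a b c p)).
  split=> [p|v]; first by have [] := H p 0.
  rewrite (_ : 'D_v _ = (a * v.1 + b * v.2) \*: (flat ('X^2 * (P - P^`())) \o linf a b c)).
    by apply: smoothZ; exact: smooth_flat.
  by apply/funext => p; have [_ ->] := H p v.
- split=> [p|v]; first exact: differentiableD.
  rewrite (_ : 'D_v _ = 'D_v f + 'D_v g); first exact: smoothD.
  by apply/funext => p; rewrite deriveD//; exact: diff_derivable.
- split=> [p|v]; first exact: differentiableM.
  rewrite (_ : 'D_v _ = f * 'D_v g + g * 'D_v f).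
    by apply: smoothD; exact: smoothM.
  by apply/funext => p; rewrite deriveM//; exact: diff_derivable.
- split=> [p|v]; first exact: differentiableZ.
  rewrite (_ : 'D_v _ = k \*: 'D_v f); first exact: smoothZ.
  by apply/funext => p; rewrite deriveZ//; exact: diff_derivable.
Qed.

Lemma smooth_iter_partial f ds p : smooth f ->
  differentiable (iter_partial ds f) p.
Proof.
move=> sf; suff /smooth_derive[] : smooth (iter_partial ds f) by [].
by elim: ds => //= i ds /smooth_derive[].
Qed.

Definition bump (a b x : R) : R := flat 1 (x - a) * flat 1 (b - x).

Lemma flat1_gt0 (x : R) : (0 < flat 1 x) = (0 < x).
Proof. by rewrite /flat; case: ifPn => //; rewrite ?ltxx// hornerC mul1r expR_gt0. Qed.

Lemma flat1_ge0 (x : R) : 0 <= flat 1 x.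
Proof. by rewrite /flat; case: ifPn => // _; rewrite hornerC mul1r expR_ge0. Qed.

Lemma flat1_eq0 (x : R) : x <= 0 -> flat 1 x = 0.
Proof. by rewrite /flat ltNge => ->. Qed.

Lemma bump_ge0 (a b x : R) : 0 <= bump a b x.
Proof. by rewrite mulr_ge0// flat1_ge0. Qed.

Lemma bump_gt0 (a b x : R) : a < x < b -> 0 < bump a b x.
Proof. by move=> /andP[ax xb]; rewrite mulr_gt0// flat1_gt0 subr_gt0. Qed.

Lemma bump_eq0 (a b x : R) : ~~ (a < x < b) -> bump a b x = 0.
Proof.
rewrite /bump negb_and -!leNgt => /orP[h|h].
  by rewrite flat1_eq0 ?mul0r// subr_le0.
by rewrite [X in _ * X]flat1_eq0 ?mulr0// subr_le0.
Qed.

Lemma is_derive_bump (a b x : R) :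
  is_derive x 1 (bump a b)
    (flat 1 (x - a) * - flat 'X^2 (b - x) + flat 1 (b - x) * flat 'X^2 (x - a)).
Proof.
have E : 'X^2 * (1 - (1 : {poly R})^`()) = 'X^2 by rewrite derivC subr0 mulr1.
have d1 : is_derive x 1 (fun x => x - a) (1 : R).
  by rewrite -[X in is_derive _ _ _ X]subr0; apply: is_deriveB.
have d2 : is_derive x 1 (fun x => b - x) (-1 : R).
  by rewrite -[X in is_derive _ _ _ X]add0r; apply: is_deriveB.
have := is_deriveM (@is_derive1_comp _ _ (fun x => x - a) _ _ _ (is_derive_flat 1 (x - a)) d1)
                   (@is_derive1_comp _ _ (fun x => b - x) _ _ _ (is_derive_flat 1 (b - x)) d2).
by rewrite /= !scaleRE E mulr1 mulrN1.
Qed.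

Lemma continuous_bump (a b : R) : continuous (bump a b).
Proof.
move=> x; apply: differentiable_continuous; apply/derivable1_diffP.
by have [] := is_derive_bump a b x.
Qed.

Lemma smooth_bump (a b u v w : R) : smooth (bump a b \o linf u v w).
Proof.
rewrite (_ : _ \o _ = (flat 1 \o linf u v (w - a)) * (flat 1 \o linf (- u) (- v) (b - w))).
  by apply: smoothM; exact: smooth_flat.
apply/funext => p; rewrite /bump/=; congr (flat _ _ * flat _ _); rewrite /linf; ring.
Qed.

End SmoothBumps.

(** * Paths, homotopies and monodromy *)

Section Monodromy.
Context {R : realType}.
Implicit Types (Omega : set (R * R)) (p q x y z : R * R).

(** The retraction of the line onto [0,1]; absolute values make its continuity immediate. *)
Definition clamp (t : R) : R := (1 + `|t| - `|t - 1|) / 2.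

Lemma clamp_id (t : R) : 0 <= t <= 1 -> clamp t = t.
Proof.
move=> /andP[t0 t1]; rewrite /clamp ger0_norm// ler0_norm ?subr_le0//; lra.
Qed.

Lemma clamp_le0 (t : R) : t <= 0 -> clamp t = 0.
Proof.
by move=> t0; rewrite /clamp ler0_norm// ler0_norm ?subr_le0 ?(le_trans t0)//; lra.
Qed.

Lemma clamp_ge1 (t : R) : 1 <= t -> clamp t = 1.
Proof.
by move=> t1; rewrite /clamp ger0_norm ?(le_trans _ t1)// ger0_norm ?subr_ge0//; lra.
Qed.

Lemma continuous_clamp : continuous clamp.
Proof.
move=> t; apply: cvgM; last exact: cvg_cst.
apply: cvgB; first by apply: cvgD; [exact: cvg_cst|exact: norm_continuous].
by apply: cvg_norm; apply: cvgB; [exact: cvg_id|exact: cvg_cst].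
Qed.

(** Continuity is required on the whole line, so that paths can be reparametrised and added without
    subspace topologies. *)
Definition path_in Omega x y (g : R -> R * R) : Prop :=
  [/\ continuous g, forall t : R, 0 <= t <= 1 -> Omega (g t), g 0 = x & g 1 = y].

Definition joined Omega x y : Prop := exists g, path_in Omega x y g.

Lemma joined_sym Omega x y : joined Omega x y -> joined Omega y x.
Proof.
move=> [g [cg Og g0 g1]]; exists (fun t => g (1 - t)); split.
- suff : continuous (g \o (fun t : R => 1 - t)) by [].
  move=> t; apply: continuous_comp; last exact: cg.
  by apply: cvgB; [exact: cvg_cst|exact: cvg_id].
- by move=> t t01; apply: Og; lra.
- by rewrite subr0.
- by rewrite subrr.
Qed.

Lemma continuous_clamp_comp (g : R -> R * R) (a b : R) : continuous g ->
  continuous (fun t => g (clamp (a * t + b))).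
Proof.
move=> cg; suff : continuous (g \o (clamp \o (fun t : R => a * t + b))) by [].
move=> t; apply: continuous_comp; last exact: cg.
apply: continuous_comp; last exact: continuous_clamp.
by apply: cvgD; [apply: cvgM; [exact: cvg_cst|exact: cvg_id]|exact: cvg_cst].
Qed.

(* Adding up clamped paths, rather than defining the concatenation by cases,
   makes continuity immediate. *)
Definition cat3 (g1 g2 g3 : R -> R * R) (t : R) : R * R :=
  g1 (clamp (3 * t + 0)) + (g2 (clamp (3 * t + -1)) - g2 0) + (g3 (clamp (3 * t + -2)) - g3 0).

Section Cat3.
Context (g1 g2 g3 : R -> R * R).
Context (g12 : g1 1 = g2 0) (g23 : g2 1 = g3 0).

Lemma cat3_1 (t : R) : 0 <= t <= 1 -> cat3 g1 g2 g3 (t / 3) = g1 t.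
Proof.
move=> t01; rewrite /cat3.
have -> : clamp (3 * (t / 3) + 0) = t by rewrite clamp_id; lra.
have -> : clamp (3 * (t / 3) + -1) = 0 by rewrite clamp_le0; lra.
have -> : clamp (3 * (t / 3) + -2) = 0 by rewrite clamp_le0; lra.
by rewrite !subrr !addr0.
Qed.

Lemma cat3_2 (t : R) : 0 <= t <= 1 -> cat3 g1 g2 g3 ((1 + t) / 3) = g2 t.
Proof.
move=> t01; rewrite /cat3.
have -> : clamp (3 * ((1 + t) / 3) + 0) = 1 by rewrite clamp_ge1; lra.
have -> : clamp (3 * ((1 + t) / 3) + -1) = t by rewrite clamp_id; lra.
have -> : clamp (3 * ((1 + t) / 3) + -2) = 0 by rewrite clamp_le0; lra.
by rewrite subrr addr0 g12 addrC subrK.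
Qed.

Lemma cat3_3 (t : R) : 0 <= t <= 1 -> cat3 g1 g2 g3 ((2 + t) / 3) = g3 t.
Proof.
move=> t01; rewrite /cat3.
have -> : clamp (3 * ((2 + t) / 3) + 0) = 1 by rewrite clamp_ge1; lra.
have -> : clamp (3 * ((2 + t) / 3) + -1) = 1 by rewrite clamp_ge1; lra.
have -> : clamp (3 * ((2 + t) / 3) + -2) = t by rewrite clamp_id; lra.
by rewrite g12 [g2 0 + _]addrC subrK g23 addrC subrK.
Qed.

Lemma cat3_path Omega x1 x2 x3 x4 : path_in Omega x1 x2 g1 ->
  path_in Omega x2 x3 g2 -> path_in Omega x3 x4 g3 -> path_in Omega x1 x4 (cat3 g1 g2 g3).
Proof.
move=> [c1 O1 g10 g11] [c2 O2 _ _] [c3 O3 _ g31]; split.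
- move=> t; apply: cvgD; first apply: cvgD.
  + exact: continuous_clamp_comp.
  + by apply: cvgB; [exact: continuous_clamp_comp|exact: cvg_cst].
  + by apply: cvgB; [exact: continuous_clamp_comp|exact: cvg_cst].
- move=> t t01; have [h|h] := leP (3 * t) 1.
    by rewrite (_ : t = (3 * t) / 3) ?cat3_1; [apply: O1|..]; lra.
  have [h'|h'] := leP (3 * t) 2.
    by rewrite (_ : t = (1 + (3 * t - 1)) / 3) ?cat3_2; [apply: O2|..]; lra.
  by rewrite (_ : t = (2 + (3 * t - 2)) / 3) ?cat3_3; [apply: O3|..]; lra.
- by rewrite (_ : 0 = 0 / 3) ?cat3_1//; lra.
- by rewrite (_ : 1 = (2 + 1) / 3) ?cat3_3//; lra.
Qed.

End Cat3.

Lemma joined_trans Omega x y z : joined Omega x y -> joined Omega y z -> joined Omega x z.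
Proof.
(* A constant third path reduces the claim to [cat3]. *)
move=> [g1 h1] [g2 h2]; have h3 : path_in Omega z z (cst z).
  split => //; first by move=> t; exact: cvg_cst.
  by move=> t _; case: h2 => _ + _ <-; apply; rewrite ler01 lexx.
exists (cat3 g1 g2 (cst z)); apply: (cat3_path _ _ h1 h2 h3).
  by case: h1 h2 => _ _ _ -> [].
by case: h2.
Qed.

(** A Lebesgue number argument. Near [z0] the map [H] meets only those closed sets that contain
    [H z0], so [H z0] is a point common to all of them; compactness makes the mesh width uniform. *)
Lemma near_grid (n : nat) (T : 'I_n -> set (R * R)) (H : R * R -> R * R) :
  (forall i, closed (T i)) -> {within `[0, 1] `*` `[0, 1], continuous H} ->
  exists N0, forall N, (N0 <= N)%N -> forall z, (`[0, 1] `*` `[0, 1]) z ->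
    exists y, forall z', (`[0, 1] `*` `[0, 1]) z' ->
      `|z.1 - z'.1| <= N%:R^-1 -> `|z.2 - z'.2| <= N%:R^-1 ->
      forall i, T i (H z') -> T i y.
Proof.
move=> cT cH; set K := `[0, 1] `*` `[0, 1].
have cK : compact K by apply: compact_setX; exact: segment_compact.
pose P (N : nat) (z : R * R) := exists y, forall z', K z' ->
      `|z.1 - z'.1| <= N%:R^-1 -> `|z.2 - z'.2| <= N%:R^-1 ->
      forall i, T i (H z') -> T i y.
have : \forall N \near \oo, K `<=` P N.
  move/compact_near_coveringP : cK; apply => z0 Kz0.
  have /subspace_continuousP/(_ _ Kz0) cHz := cH.
  have : \forall z' \near within K (nbhs z0), forall i, T i (H z') -> T i (H z0).
    apply: filter_forall => i.
    have [Ti|nTi] := pselect (T i (H z0)); first by near=> z'.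
    have : nbhs (H z0) (~` T i) by apply: open_nbhs_nbhs; split => //; exact: closed_openC.
    move=> /cHz h; suff : nbhs z0 (fun x => K x -> T i (H x) -> T i (H z0)) by [].
    by apply: (@filterS _ (nbhs z0) _ _ _ _ h) => x hx Kx Tx; case: (hx Kx).
  rewrite /within/= => /nbhs_ballP[e /= e0 He].
  near=> z' N; exists (H z0) => z'' Kz'' h1 h2 i.
  apply: He => //.
  have he : N%:R^-1 < e / 2 :> R.
    have e2 : 0 < e / 2 by rewrite divr_gt0.
    have hN : (e / 2)^-1 < N%:R by near: N; exact: nbhs_infty_gtr.
    by rewrite -[e / 2]invrK ltf_pV2// posrE ?invr_gt0// (lt_trans _ hN)// invr_gt0.
  (* Half of [e] is spent between [z0] and [z'], half between [z'] and [z'']. *)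
  have [b1 b2] : ball z0 (e / 2) z'.
    by near: z'; apply: nbhsx_ballx; rewrite divr_gt0.
  split; rewrite /ball/=.
    rewrite (_ : _ - _ = (z0.1 - z'.1) + (z'.1 - z''.1)); last by ring.
    rewrite (splitr e); apply: le_lt_trans (ler_normD _ _) _.
    by apply: ltrD => //; exact: le_lt_trans he.
  rewrite (_ : _ - _ = (z0.2 - z'.2) + (z'.2 - z''.2)); last by ring.
  rewrite (splitr e); apply: le_lt_trans (ler_normD _ _) _.
  by apply: ltrD => //; exact: le_lt_trans he.
case=> N0 _ HN; exists N0 => N NN z Kz; exact: HN.
Unshelve. all: by end_near. Qed.


Section Holonomy.
Context (n : nat) (T : 'I_n -> set (R * R)) (u : 'I_n -> R * R -> R).
Context (Omega : set (R * R)) (kappa : R * R -> 'I_n) (zeta : 'I_n -> 'I_n -> R * R).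
Context (cT : forall i, closed (T i)).
Context (kappaP : forall p, Omega p -> T (kappa p) p).
Context (zetaP : forall i j y, T i y -> T j y -> T i (zeta i j) /\ T j (zeta i j)).
Context (uT : forall i j z z', T i z -> T j z -> T i z' -> T j z' ->
  u i z - u i z' = u j z - u j z').

(* The increment from [p] to a nearby [q] of the multivalued potential whose
   branches on [T i] are [u i] up to constants. *)
Definition incr p q : R :=
  let y := zeta (kappa p) (kappa q) in
  u (kappa p) y - u (kappa p) p + (u (kappa q) q - u (kappa q) y).

(** Two branches differ by a constant on the common part of their sets, so any common point may
    replace the chosen [zeta]. *)
Lemma incrE p q y : Omega p -> Omega q -> T (kappa p) y -> T (kappa q) y ->
  incr p q = (u (kappa p) y - u (kappa p) p) + (u (kappa q) q - u (kappa q) y).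
Proof.
move=> Op Oq py qy; rewrite /incr; have [zp zq] := zetaP py qy.
have := uT zp zq py qy; lra.
Qed.

Definition hol (N : nat) (g : R -> R * R) : R :=
  \sum_(0 <= k < N) incr (g (k%:R / N%:R)) (g (k.+1%:R / N%:R)).

Lemma grid_itv (N k : nat) : (k <= N)%N -> 0 <= (k%:R / N%:R : R) <= 1.
Proof.
case: N => [|N] kN; first by rewrite invr0 mulr0 lexx ler01.
by rewrite divr_ge0//= ler_pdivrMr ?ltr0n// mul1r ler_nat.
Qed.

Lemma grid_step (N k : nat) : `|k%:R / N%:R - k.+1%:R / N%:R : R| <= N%:R^-1.
Proof.
rewrite -mulrBl normrM -natr1 opprD addNKr normrN normr1 mul1r.
by rewrite ger0_norm// invr_ge0.
Qed.

(* The sum of the increments along a fine subdivision does not change between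
   consecutive loops of the homotopy, since all branches on a small cell of the
   grid share a point; for the constant loop it vanishes. *)
Lemma hol_loop (g : R -> R * R) : {within `[0, 1], continuous g} ->
  (forall loop : R -> R * R,
    {within `[0, 1], continuous loop} ->
    (forall t : R, t \in `[0, 1] -> Omega (loop t)) ->
    loop 0 = loop 1 ->
    exists H : R * R -> R * R,
      [/\ {within `[0, 1] `*` `[0, 1], continuous H},
          forall s t : R, s \in `[0, 1] -> t \in `[0, 1] -> Omega (H (s, t)),
          forall t : R, t \in `[0, 1] -> H (0, t) = loop t,
          forall t : R, t \in `[0, 1] -> H (1, t) = loop 0 &
          forall s : R, s \in `[0, 1] -> H (s, 0) = loop 0 /\ H (s, 1) = loop 0]) ->
  (forall t : R, 0 <= t <= 1 -> Omega (g t)) -> g 0 = g 1 ->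
  exists N0, forall N, (N0 < N)%N -> hol N g = 0 /\
    forall k, (k < N)%N -> exists y, forall i,
      T i (g (k%:R / N%:R)) \/ T i (g (k.+1%:R / N%:R)) -> T i y.
Proof.
move=> cg sc Og g01; have [H [cH OH H0 H1 Hs]] := sc g cg Og g01.
have [N0 HN0] := near_grid cT cH; exists N0 => N N0N.
have {HN0} HN := HN0 _ (ltnW N0N).
have N_gt0 : (0 < N)%N by exact: leq_ltn_trans N0N.
have gi k : (k <= N)%N -> (k%:R / N%:R : R) \in `[0, 1].
  by move=> kN; rewrite in_itv/=; exact: grid_itv.
have in01 (s t : R) : s \in `[0, 1] -> t \in `[0, 1] -> (`[0, 1] `*` `[0, 1]) (s, t).
  by [].
have i0 : (0 : R) \in `[0, 1] by rewrite in_itv/= lexx ler01.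
have i1 : (1 : R) \in `[0, 1] by rewrite in_itv/= lexx ler01.
split; last first.
  (* The row [s = 0] of the homotopy is the loop itself. *)
  move=> k kN; have [y Hy] := HN (0, k%:R / N%:R) (in01 _ _ i0 (gi _ (ltnW kN))).
  exists y => i [Ti|Ti].
    apply: (Hy (0, k%:R / N%:R)); rewrite ?subrr ?normr0 ?invr_ge0//.
    - exact: in01 (gi _ (ltnW kN)).
    - by rewrite H0//; exact: gi (ltnW kN).
  apply: (Hy (0, k.+1%:R / N%:R)); rewrite ?subrr ?normr0 ?invr_ge0 ?grid_step//.
  - exact: in01 (gi _ kN).
  - by rewrite H0//; exact: gi.
pose pt k l := H (k%:R / N%:R, l%:R / N%:R).
have Opt k l : (k <= N)%N -> (l <= N)%N -> Omega (pt k l).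
  by move=> kN lN; apply: OH; exact: gi.
(* The increments around a cell add up to zero: its four branches share the point [y]. *)
have cell k l : (k < N)%N -> (l < N)%N ->
  incr (pt k l) (pt k l.+1) - incr (pt k.+1 l) (pt k.+1 l.+1) =
  incr (pt k l) (pt k.+1 l) - incr (pt k l.+1) (pt k.+1 l.+1).
  move=> kN lN.
  have [y Hy] := HN (k%:R / N%:R, l%:R / N%:R) (in01 _ _ (gi _ (ltnW kN)) (gi _ (ltnW lN))).
  have n0 : 0 <= N%:R^-1 :> R by rewrite invr_ge0.
  have y1 : T (kappa (pt k l)) y.
    by apply: (Hy (k%:R / N%:R, l%:R / N%:R)); rewrite ?subrr ?normr0//;
      [apply: in01; apply: gi; exact: ltnW|apply: kappaP; apply: Opt; exact: ltnW].
  have y2 : T (kappa (pt k.+1 l)) y.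
    by apply: (Hy (k.+1%:R / N%:R, l%:R / N%:R)); rewrite ?subrr ?normr0 ?grid_step//;
      [apply: in01; apply: gi; rewrite // ltnW|apply: kappaP; apply: Opt; rewrite // ltnW].
  have y3 : T (kappa (pt k l.+1)) y.
    by apply: (Hy (k%:R / N%:R, l.+1%:R / N%:R)); rewrite ?subrr ?normr0 ?grid_step//;
      [apply: in01; apply: gi; rewrite // ltnW|apply: kappaP; apply: Opt; rewrite // ltnW].
  have y4 : T (kappa (pt k.+1 l.+1)) y.
    by apply: (Hy (k.+1%:R / N%:R, l.+1%:R / N%:R)); rewrite ?grid_step//;
      [apply: in01; apply: gi|apply: kappaP; apply: Opt].
  have O1 := Opt _ _ (ltnW kN) (ltnW lN).
  have O2 := Opt _ _ kN (ltnW lN).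
  have O3 := Opt _ _ (ltnW kN) lN.
  have O4 := Opt _ _ kN lN.
  rewrite (incrE O1 O3 y1 y3) (incrE O2 O4 y2 y4) (incrE O1 O2 y1 y2) (incrE O3 O4 y3 y4).
  lra.
pose A k := \sum_(0 <= l < N) incr (pt k l) (pt k l.+1).
have ptN k : (k <= N)%N -> pt k 0%N = pt k N.
  move=> kN; rewrite /pt mul0r divff ?pnatr_eq0 -?lt0n//.
  by have [-> ->] := Hs _ (gi _ kN).
have A0 k : (k < N)%N -> A k = A k.+1.
  (* Consecutive rows differ by a telescoping sum of transversal increments, whose two end terms
     agree because the homotopy fixes the end points. *)
  move=> kN; apply/eqP; rewrite -subr_eq0 /A -sumrB.
  rewrite (eq_big_nat _ _ (F2 := fun l => (- incr (pt k l.+1) (pt k.+1 l.+1)) -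
     (- incr (pt k l) (pt k.+1 l)))); last first.
    by move=> l /andP[_ lN]; rewrite cell// opprK addrC.
  rewrite telescope_sumr//.
  by rewrite -!ptN ?subrr// ltnW.
have AN k : (k <= N)%N -> A 0%N = A k.
  by elim: k => // k IH kN; rewrite IH 1?ltnW// A0.
have -> : hol N g = A 0%N.
  by apply: eq_big_nat => l /andP[_ lN]; rewrite /pt mul0r !H0//; apply: gi; rewrite // ltnW.
rewrite (AN _ (leqnn N)) /A big_nat big1// => l /andP[_ lN].
have O1 := Opt _ _ (leqnn N) (ltnW lN).
have E m : (m <= N)%N -> pt N m = g 0.
  by move=> mN; rewrite /pt divff ?pnatr_eq0 -?lt0n// H1//; exact: gi.
rewrite (E _ lN) (E _ (ltnW lN)); have Og0 : Omega (g 0) by apply: Og; rewrite lexx ler01.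
by rewrite (incrE Og0 Og0 (kappaP Og0) (kappaP Og0)); lra.
Qed.

End Holonomy.

(* The constant of [T i] is the holonomy along a path from a base point of its
   component to [c i]. *)
Lemma exists_potential (n : nat) (T : 'I_n -> set (R * R)) (u : 'I_n -> R * R -> R)
    (Omega : set (R * R)) (c : 'I_n -> R * R) (link : 'I_n -> 'I_n -> Prop) :
  (forall i, closed (T i)) -> Omega `<=` \bigcup_i T i -> simply_connected Omega ->
  (forall i j z z', T i z -> T j z -> T i z' -> T j z' -> u i z - u i z' = u j z - u j z') ->
  (forall i, T i (c i) /\ Omega (c i)) ->
  (forall i j, link i j -> forall t : R, 0 <= t <= 1 ->
     Omega (c i + t *: (c j - c i)) /\
     (T i (c i + t *: (c j - c i)) \/ T j (c i + t *: (c j - c i)))) ->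
  exists k : 'I_n -> R, forall i j, link i j ->
    forall z, T i z -> T j z -> u i z + k i = u j z + k j.
Proof.
move=> cT OT [_ sc] uT cP lP.
case: (posnP n) => [n0|n_gt0].
  by exists (fun=> 0) => i; exfalso; have := leq_ltn_trans (leq0n i) (ltn_ord i); rewrite n0.
pose i0 : 'I_n := Ordinal n_gt0.
have /choice[kappa kappaP] : forall p, exists i, Omega p -> T i p.
  move=> p.
  have [Op|nOp] := pselect (Omega p); last by exists i0.
  by have [i _ Ti] := OT _ Op; exists i.
have /choice[zeta zetaP] : forall ij : 'I_n * 'I_n, exists z : R * R,
    forall y, T ij.1 y -> T ij.2 y -> T ij.1 z /\ T ij.2 z.
  move=> ij.
  have [[y [h1 h2]]|h] := pselect (exists y, T ij.1 y /\ T ij.2 y); first by exists y.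
  by exists 0 => y h1 h2; case: h; exists y.
(* The choice depends only on the set, so centres in the same path component receive the same base
   point. *)
pose rep i := get [set y | joined Omega y (c i)].
have repP i : joined Omega (rep i) (c i).
  apply: (@getPex _ [set y | joined Omega y (c i)]); exists (c i).
  exists (cst (c i)); split => //; first by move=> t; exact: cvg_cst.
  by move=> t _; have [] := cP i.
have segP i j : link i j -> path_in Omega (c i) (c j) (fun t => c i + t *: (c j - c i)).
  move=> lij; split.
  - move=> t; apply: cvgD; first exact: cvg_cst.
    by apply: cvgZr_tmp; exact: cvg_id.
  - by move=> t t01; have [] := lP _ _ lij t t01.
  - by rewrite scale0r addr0.
  - by rewrite scale1r addrC subrK.
have repE i j : link i j -> rep i = rep j.
  move=> lij; have cij : joined Omega (c i) (c j) by exists (fun t => c i + t *: (c j - c i)); exact: segP.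
  congr get; apply/seteqP; split => y /= h; apply: (joined_trans h) => //.
  exact: joined_sym.
have [gam gamP] := choice repP.
have gamr i : path_in Omega (c i) (rep i) (fun t => gam i (1 - t)).
  have [cg Og g0 g1] := gamP i; split.
  - suff : continuous (gam i \o (fun t : R => 1 - t)) by [].
    move=> t; apply: continuous_comp; last exact: cg.
    by apply: cvgB; [exact: cvg_cst|exact: cvg_id].
  - by move=> t t01; apply: Og; lra.
  - by rewrite subr0.
  - by rewrite subrr.
(* From the base point to [c i], straight to [c j], and back. *)
pose loop i j := cat3 (gam i) (fun t => c i + t *: (c j - c i)) (fun t => gam j (1 - t)).
pose HOL := hol u kappa (fun i j => zeta (i, j)).
have zP i j y : T i y -> T j y -> T i (zeta (i, j)) /\ T j (zeta (i, j)).
  exact: (zetaP (i, j)).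
have /choice[N0 N0P] : forall ij : 'I_n * 'I_n, exists N0, link ij.1 ij.2 ->
  forall N, (N0 < N)%N -> HOL N (loop ij.1 ij.2) = 0 /\
    forall k, (k < N)%N -> exists y, forall a,
      T a (loop ij.1 ij.2 (k%:R / N%:R)) \/ T a (loop ij.1 ij.2 (k.+1%:R / N%:R)) -> T a y.
  move=> [i j] /=; have [lij|?] := pselect (link i j); last by exists 0%N.
  have P1 := gamP i; have P2 := segP _ _ lij; have P3 := gamr j.
  have e12 : gam i 1 = c i + 0 *: (c j - c i).
    by case: P1 P2 => _ _ _ -> [].
  have e23 : c i + 1 *: (c j - c i) = gam j (1 - 0).
    by case: P2 P3 => _ _ _ -> [].
  have [cl Ol l0 l1] := cat3_path e12 e23 P1 P2 P3.
  have cl' : {within `[0, 1], continuous (loop i j)} by exact: continuous_subspaceT.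
  have e : loop i j 0 = loop i j 1 by rewrite /loop l0 l1; exact: repE.
  have [N0 HN0] := hol_loop cT kappaP zP uT cl' sc Ol e.
  by exists N0.
(* With [3 * M] steps each of the three pieces gets exactly [M], and one [M] is fine enough for all
   pairs. *)
pose M := ((\sum_ij N0 ij)%N).+1.
have M_gt ij : (N0 ij < 3 * M)%N.
  have : (N0 ij <= (\sum_ij N0 ij)%N)%N by rewrite (bigD1 ij)//= leq_addr.
  by rewrite /M; set s := (\sum_ij N0 ij)%N; lia.
exists (fun i => HOL M (gam i) - u i (c i)) => i j lij m Tim Tjm.
have [hl hy] := N0P (i, j) lij (3 * M)%N (M_gt (i, j)).
rewrite /= in hl hy.
have P1 := gamP i; have P2 := segP _ _ lij; have P3 := gamr j.
have e12 : gam i 1 = c i + 0 *: (c j - c i) by case: P1 P2 => _ _ _ -> [].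
have e23 : c i + 1 *: (c j - c i) = gam j (1 - 0) by case: P2 P3 => _ _ _ -> [].
have M0 : (M%:R : R) != 0 by rewrite pnatr_eq0.
have M3 : (3 * M)%N%:R = 3 * M%:R :> R by rewrite natrM.
have L1 k : (k <= M)%N -> loop i j (k%:R / (3 * M)%N%:R) = gam i (k%:R / M%:R).
  move=> kM; rewrite (_ : _ / _ = (k%:R / M%:R) / 3); last by rewrite M3; field.
  by rewrite /loop cat3_1// grid_itv.
have L2 k : (k <= M)%N -> loop i j ((M + k)%N%:R / (3 * M)%N%:R) = c i + (k%:R / M%:R) *: (c j - c i).
  move=> kM; rewrite (_ : _ / _ = (1 + k%:R / M%:R) / 3); last by rewrite M3 natrD; field.
  by rewrite /loop (cat3_2 _ e12)// grid_itv.
have L3 k : (k <= M)%N -> loop i j ((M + M + k)%N%:R / (3 * M)%N%:R) = gam j (1 - k%:R / M%:R).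
  move=> kM; rewrite (_ : _ / _ = (2 + k%:R / M%:R) / 3); last by rewrite M3 !natrD; field.
  by rewrite /loop (cat3_3 e12 e23)// grid_itv.
pose f k := incr u kappa (fun i j => zeta (i, j)) (loop i j (k%:R / (3 * M)%N%:R)) (loop i j (k.+1%:R / (3 * M)%N%:R)).
have : \sum_(0 <= k < M) f k + \sum_(0 <= k < M) f (M + k)%N + \sum_(0 <= k < M) f (M + M + k)%N = 0.
  transitivity (\sum_(0 <= k < M + M + M) f k); last first.
    rewrite -[RHS]hl (_ : (M + M + M = 3 * M)%N)//; lia.
  rewrite [RHS](@big_cat_nat _ _ _ (M + M)%N 0%N)//=; last by lia.
  rewrite [X in _ = X + _](@big_cat_nat _ _ _ M 0%N (M + M)%N)//=; last by lia.
  have E a : \sum_(a <= k < a + M) f k = \sum_(0 <= k < M) f (a + k)%N.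
    rewrite -{1}[a]add0n big_addn addKn.
    by apply: eq_bigr => k _; rewrite addnC.
  by rewrite !E.
have S1 : \sum_(0 <= k < M) f k = HOL M (gam i).
  by apply: eq_big_nat => k /andP[_ kM]; rewrite /f !L1// ltnW.
(* Along the reversed path the increments occur in the opposite order and with the opposite sign;
   the sign is checked at a point [y] common to the two branches. *)
have S3 : \sum_(0 <= k < M) f (M + M + k)%N = - HOL M (gam j).
  rewrite -sumrN big_nat_rev /= add0n; apply: eq_big_nat => k /andP[_ kM].
  have kM' : (M - k.+1 < M)%N by lia.
  rewrite /f -addnS !L3//; last by lia.
  have [|y Hy] := hy (M + M + (M - k.+1))%N; first by lia.
  rewrite -addnS !L3// in Hy; last by lia.
  have E1 : 1 - (M - k.+1)%N%:R / M%:R = k.+1%:R / M%:R :> R.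
    by rewrite natrB//; field.
  have E2 : 1 - (M - k.+1).+1%:R / M%:R = k%:R / M%:R :> R.
    by rewrite -subSn// subSS natrB ?(ltnW kM)//; field.
  rewrite E1 E2 in Hy *.
  have [_ Og _ _] := P1; have [_ Ogj _ _] := gamP j.
  have O1 : Omega (gam j (k.+1%:R / M%:R)) by apply: Ogj; exact: grid_itv.
  have O2 : Omega (gam j (k%:R / M%:R)) by apply: Ogj; apply: grid_itv; exact: ltnW.
  have y1 : T (kappa (gam j (k.+1%:R / M%:R))) y by apply: Hy; left; exact: kappaP.
  have y2 : T (kappa (gam j (k%:R / M%:R))) y by apply: Hy; right; exact: kappaP.
  rewrite (@incrE n T u Omega kappa _ zP uT _ _ y)//.
  rewrite (@incrE n T u Omega kappa _ zP uT _ _ y)//.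
  lra.
(* A single-valued potential on [T i] and [T j] together, normalised at the common point [m]; the
   straight piece of the loop stays there, so its increments telescope. *)
pose w x := if `[< T i x >] then u i x - u i m else u j x - u j m.
have wi x : T i x -> w x = u i x - u i m by rewrite /w; case: asboolP.
have wj x : T j x -> w x = u j x - u j m.
  by rewrite /w; case: asboolP => // Tix Tjx; exact: uT.
have S2 : \sum_(0 <= k < M) f (M + k)%N = w (c j) - w (c i).
  have sp k : (k <= M)%N -> Omega (c i + (k%:R / M%:R) *: (c j - c i)) /\
     (T i (c i + (k%:R / M%:R) *: (c j - c i)) \/ T j (c i + (k%:R / M%:R) *: (c j - c i))).
    by move=> kM; apply: lP => //; exact: grid_itv.
  have E : forall k, (0 <= k < M)%N -> f (M + k)%N =
      w (c i + (k.+1%:R / M%:R) *: (c j - c i)) - w (c i + (k%:R / M%:R) *: (c j - c i)).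
    move=> k /andP[_ kM].
    have [|y Hy] := hy (M + k)%N; first by lia.
    rewrite -addnS (L2 _ kM) (L2 _ (ltnW kM)) in Hy.
    rewrite /f -addnS (L2 _ kM) (L2 _ (ltnW kM)).
    have [op tp] := sp _ (ltnW kM); have [oq tq] := sp _ kM.
    set p := c i + (k%:R / M%:R) *: (c j - c i) in op tp Hy *.
    set q := c i + (k.+1%:R / M%:R) *: (c j - c i) in oq tq Hy *.
    have y1 : T (kappa p) y by apply: Hy; left; exact: kappaP.
    have y2 : T (kappa q) y by apply: Hy; right; exact: kappaP.
    rewrite (@incrE n T u Omega kappa _ zP uT _ _ y)//.
    have -> : u (kappa p) y - u (kappa p) p = w y - w p.
      case: tp => tp.
        have Ty : T i y by apply: Hy; left.
        by rewrite (uT _ i _ _ y1 Ty (kappaP _ op) tp) !wi//; lra.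
      have Ty : T j y by apply: Hy; left.
      by rewrite (uT _ j _ _ y1 Ty (kappaP _ op) tp) !wj//; lra.
    have -> : u (kappa q) q - u (kappa q) y = w q - w y.
      case: tq => tq.
        have Ty : T i y by apply: Hy; right.
        by rewrite (uT _ i _ _ (kappaP _ oq) tq y2 Ty) !wi//; lra.
      have Ty : T j y by apply: Hy; right.
      by rewrite (uT _ j _ _ (kappaP _ oq) tq y2 Ty) !wj//; lra.
    lra.
  rewrite (eq_big_nat _ _ E) (telescope_sumr (fun k => w (c i + (k%:R / M%:R) *: (c j - c i))))//.
  by rewrite divff// scale1r mul0r scale0r addr0 [c i + _]addrC subrK.
have [Tci _] := cP i; have [Tcj _] := cP j.
rewrite S1 S2 S3 (wi _ Tci) (wj _ Tcj); lra.
Qed.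

End Monodromy.

(** * Squares in local coordinates *)

Section SquareGeometry.
Context {R : realType}.
Implicit Types (A B p q z v : R * R).

(** The direct similarity from [That] onto [square_on A B]; [loc] is its inverse, and [sqn] its
    determinant, the area of the square. *)
Definition th A B : R * R -> R * R := aff A (B - A) (perp (B - A)).
Definition loc A B : R * R -> R * R := invaff A (B - A) (perp (B - A)).
Definition sqn A B : R := (B.1 - A.1) ^+ 2 + (B.2 - A.2) ^+ 2.

Lemma pairP p q : p.1 = q.1 -> p.2 = q.2 -> p = q.
Proof. exact: injective_projections. Qed.

Lemma thE A B z : th A B z =
  (A.1 + z.1 * (B.1 - A.1) - z.2 * (B.2 - A.2), A.2 + z.1 * (B.2 - A.2) + z.2 * (B.1 - A.1)).
Proof. by apply: pairP => /=; rewrite ?scaleRE//; ring. Qed.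

Lemma det2_perp A B : det2 (B - A) (perp (B - A)) = sqn A B.
Proof. by rewrite /det2 /perp /sqn/=; ring. Qed.

Lemma sqn_eq0 A B : (sqn A B == 0) = (A == B).
Proof.
rewrite /sqn paddr_eq0 ?sqr_ge0// !sqrf_eq0 !subr_eq0.
by apply/andP/eqP => [[/eqP h1 /eqP h2]|->]; [exact: pairP|].
Qed.

Lemma sqn_neq0 A B : A <> B -> sqn A B != 0.
Proof. by move=> AB; rewrite sqn_eq0; apply/eqP. Qed.

Lemma sqn_gt0 A B : A <> B -> 0 < sqn A B.
Proof. by move=> AB; rewrite lt_def sqn_neq0//= /sqn addr_ge0// sqr_ge0. Qed.

Lemma det2_perp_neq0 A B : A <> B -> det2 (B - A) (perp (B - A)) != 0.
Proof. by move=> AB; rewrite det2_perp sqn_neq0. Qed.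

Lemma thK A B : A <> B -> cancel (th A B) (loc A B).
Proof. by move=> AB; exact/affK/det2_perp_neq0. Qed.

Lemma locK A B : A <> B -> cancel (loc A B) (th A B).
Proof. by move=> AB; exact/invaffK/det2_perp_neq0. Qed.

Lemma th_inj A B : A <> B -> injective (th A B).
Proof. by move=> AB; exact: can_inj (thK AB). Qed.

Lemma locE A B p : loc A B p =
  (((p.1 - A.1) * (B.1 - A.1) + (p.2 - A.2) * (B.2 - A.2)) / sqn A B,
   ((p.2 - A.2) * (B.1 - A.1) - (p.1 - A.1) * (B.2 - A.2)) / sqn A B).
Proof.
rewrite /loc /invaff det2_perp; apply: pairP => /=; congr (_ / _);
  by rewrite /det2 /perp /=; ring.
Qed.

Lemma ThatP z : That z <-> (0 <= z.1 <= 1) /\ (0 <= z.2 <= 1).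
Proof. by rewrite /That /setX/= !in_itv/=. Qed.

Lemma square_onP A B p : A <> B -> square_on A B p <-> That (loc A B p).
Proof.
move=> AB; split; first by move=> [z Tz <-]; rewrite thK.
by move=> h; exists (loc A B p) => //; exact: locK.
Qed.

Lemma square_on_th A B z : A <> B -> square_on A B (th A B z) <-> That z.
Proof. by move=> AB; rewrite square_onP// thK. Qed.

Lemma continuous_aff (a b c : R * R) : continuous (aff a b c).
Proof.
move=> z; apply: cvgD; first apply: cvgD; first exact: cvg_cst.
  by apply: cvgZr_tmp; exact: cvg_fst.
by apply: cvgZr_tmp; exact: cvg_snd.
Qed.

Lemma continuous_th A B : continuous (th A B).
Proof. exact: continuous_aff. Qed.

Lemma continuous_loc A B : A <> B -> continuous (loc A B).
Proof.
move=> AB; rewrite /loc; have [a [b [c [_ ->]]]] := invaffE A (det2_perp_neq0 AB).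
exact: continuous_aff.
Qed.

Lemma compact_That : compact (@That R).
Proof. by apply: compact_setX; exact: segment_compact. Qed.

Lemma closed_That : closed (@That R).
Proof. exact: (compact_closed (@norm_hausdorff _ (R * R)%type) compact_That). Qed.

Lemma square_on_preimage A B : A <> B -> square_on A B = loc A B @^-1` That.
Proof. by move=> AB; apply/seteqP; split => p /(square_onP _ AB). Qed.

Lemma closed_square_on A B : A <> B -> closed (square_on A B).
Proof.
move=> AB; rewrite square_on_preimage//.
by apply: closed_comp; [move=> p _; exact: continuous_loc|exact: closed_That].
Qed.

Definition Tho : set (R * R) := `]0, 1[ `*` `]0, 1[.

Lemma ThoP z : Tho z <-> (0 < z.1 < 1) /\ (0 < z.2 < 1).
Proof. by rewrite /Tho /setX/= !in_itv/=. Qed.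

Lemma Tho_That z : Tho z -> That z.
Proof. by rewrite ThoP ThatP; lra. Qed.

Lemma open_Tho : open Tho.
Proof.
rewrite (_ : Tho = (fst @^-1` `]0, 1[) `&` (snd @^-1` `]0, 1[))//.
by apply: openI; apply: open_comp => [p _|]; rewrite ?itv_open//; [exact: cvg_fst|exact: cvg_snd].
Qed.

(** Turns a neighbourhood into one small step in a chosen direction, which linear arithmetic can
    handle. *)
Lemma near_th_line A B z v (X : set (R * R)) : nbhs (th A B z) X ->
  exists2 e : R, 0 < e < 1 & X (th A B (z + e *: v)).
Proof.
move=> nX.
have : (fun e : R => th A B (z + e *: v)) @ 0^'+ --> th A B z.
  rewrite -[X in _ --> th A B X]addr0 -(scale0r v).
  apply: cvg_at_right_filter.
  apply: (@cvg_comp _ _ _ (fun e : R => z + e *: v) (th A B)); last exact: continuous_th.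
  by apply: cvgD; [exact: cvg_cst|apply: cvgZr_tmp; exact: cvg_id].
move=> /(_ _ nX) h.
have [e [e0 Xe]] : exists e : R, 0 < e < 1 /\ X (th A B (z + e *: v)).
  have : \forall e \near 0^'+, 0 < e < 1 /\ X (th A B (z + e *: v)).
    near=> e; split; [apply/andP; split; near: e|near: e; exact: h].
      exact: nbhs_right_gt.
    exact: nbhs_right_lt.
  by move=> /filter_ex.
by exists e.
Unshelve. all: by end_near. Qed.

Lemma interior_square_on A B p : A <> B ->
  interior (square_on A B) p <-> Tho (loc A B p).
Proof.
move=> AB; split; last first.
  move=> h; have : nbhs p (loc A B @^-1` Tho).
    by apply: continuous_loc => //; apply: open_nbhs_nbhs; split => //; exact: open_Tho.
  by apply: filterS => q /Tho_That /(square_onP _ AB).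
rewrite /interior/= -{1}(locK AB p); move: (loc A B p) => z nz.
have H v : exists2 e : R, 0 < e < 1 & That (z + e *: v).
  have [e e0 h] := near_th_line v nz; exists e => //.
  exact/(square_on_th _ AB).
have [e1 e10 /ThatP[/= h1 _]] := H (1, 0).
have [e2 e20 /ThatP[/= h2 _]] := H (- 1, 0).
have [e3 e30 /ThatP[/= _ h3]] := H (0, 1).
have [e4 e40 /ThatP[/= _ h4]] := H (0, - 1).
rewrite !scaleRE in h1 h2 h3 h4.
by apply/ThoP; lra.
Qed.

Lemma interior_square_on_th A B z : A <> B ->
  interior (square_on A B) (th A B z) <-> Tho z.
Proof. by move=> AB; rewrite interior_square_on// thK. Qed.

(** * Corners and edges *)

(** Counterclockwise, so that edge [k] runs from corner [k] to corner [ordS k] with the square on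
    its left. *)
Definition cz (k : 'I_4) : R * R := nth (0, 0) [:: (0, 0); (1, 0); (1, 1); (0, 1)] k.
Definition vtx A B (k : 'I_4) : R * R := th A B (cz k).

Lemma I4_ind (P : 'I_4 -> Prop) :
  P ord0 -> P (ordS ord0) -> P (ordS (ordS ord0)) -> P (ordS (ordS (ordS ord0))) -> forall k, P k.
Proof.
move=> h0 h1 h2 h3 [[|[|[|[|//]]]] i].
- by rewrite (_ : Ordinal i = ord0)//; exact: val_inj.
- by rewrite (_ : Ordinal i = ordS ord0)//; exact: val_inj.
- by rewrite (_ : Ordinal i = ordS (ordS ord0))//; exact: val_inj.
- by rewrite (_ : Ordinal i = ordS (ordS (ordS ord0)))//; exact: val_inj.
Qed.

Lemma ordS4 (k : 'I_4) : ordS (ordS (ordS (ordS k))) = k.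
Proof. by elim/I4_ind: k; exact: val_inj. Qed.

Lemma sum4 (F : 'I_4 -> R) : \sum_k F k =
  F ord0 + F (ordS ord0) + F (ordS (ordS ord0)) + F (ordS (ordS (ordS ord0))).
Proof.
rewrite !big_ord_recr big_ord0/= add0r.
by congr (F _ + F _ + F _ + F _); exact: val_inj.
Qed.

Lemma cz_inj : injective cz.
Proof.
move=> k l; elim/I4_ind: k; elim/I4_ind: l => //= -[];
  by move=> /eqP; rewrite /cz/= ?(eq_sym 0) ?oner_eq0 // => _ /eqP; rewrite ?(eq_sym 0) ?oner_eq0.
Qed.

Lemma vtx_inj A B : A <> B -> injective (vtx A B).
Proof. by move=> AB k l /(th_inj AB)/cz_inj. Qed.

Lemma vtx0 A B : vtx A B ord0 = A.
Proof. by rewrite /vtx thE; apply: pairP => /=; ring. Qed.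

Lemma vtx1 A B : vtx A B (ordS ord0) = B.
Proof. by rewrite /vtx thE; apply: pairP => /=; ring. Qed.

Lemma That_cz k : That (cz k).
Proof. by apply/ThatP; elim/I4_ind: k; rewrite /cz/= !lexx ler01. Qed.

(* Rotation of the reference square taking the edge [0] to the edge [k]. *)
Definition rotz (k : 'I_4) z : R * R :=
  nth z [:: z; (1 - z.2, z.1); (1 - z.1, 1 - z.2); (z.2, 1 - z.1)] k.

Lemma th_rotz A B k z : th (vtx A B k) (vtx A B (ordS k)) z = th A B (rotz k z).
Proof.
by rewrite /vtx; elim/I4_ind: k; rewrite /rotz /= !thE; apply: pairP => /=; ring.
Qed.

Lemma That_rotz k z : That (rotz k z) <-> That z.
Proof. by rewrite !ThatP; elim/I4_ind: k; rewrite /rotz /=; lra. Qed.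

Lemma vtx_neq A B k : A <> B -> vtx A B k <> vtx A B (ordS k).
Proof. by move=> AB /(vtx_inj AB) /(congr1 val); elim/I4_ind: k. Qed.

Lemma square_on_vtx A B k : A <> B ->
  square_on (vtx A B k) (vtx A B (ordS k)) = square_on A B.
Proof.
move=> AB; have kAB := vtx_neq (k := k) AB.
apply/seteqP; split => p.
  by move=> /(square_onP _ kAB) h; rewrite -(locK kAB p) th_rotz square_on_th// That_rotz.
rewrite -(locK kAB p); set z := loc _ _ p; rewrite {1}th_rotz square_on_th// That_rotz.
by rewrite square_on_th.
Qed.

Lemma th_vtx A B k l : th (vtx A B k) (vtx A B (ordS k)) (cz l) =
  vtx A B (iter k (@ordS 4) l).
Proof.
rewrite th_rotz /vtx; congr th.
by elim/I4_ind: k; elim/I4_ind: l; apply: pairP; rewrite /rotz /cz /=; ring.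
Qed.

(** Extreme points, in a form that refers to the set alone: this makes the corners independent of
    the representation of a square. *)
Definition extremal (X : set (R * R)) p : Prop :=
  X p /\ forall v, X (p + v) -> X (p - v) -> v = 0.

Lemma th_shift A B z e v : th A B (z + e *: v) =
  th A B z + e *: (th A B v - A).
Proof. by rewrite !thE; apply: pairP => /=; rewrite !scaleRE; ring. Qed.

Lemma extremal_square A B p : A <> B ->
  extremal (square_on A B) p <-> exists k, p = vtx A B k.
Proof.
move=> AB; split; last first.
  move=> [k ->]; split; first by apply/(square_on_th _ AB); exact: That_cz.
  move=> v; rewrite /vtx.
  have -> : v = th A B (loc A B (A + v)) - A by rewrite locK// addrC addKr.
  set w := loc A B (A + v).
  have E1 : th A B (cz k) + (th A B w - A) = th A B (cz k + w).
    by rewrite -[w in RHS]scale1r th_shift scale1r.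
  have E2 : th A B (cz k) - (th A B w - A) = th A B (cz k - w).
    by rewrite -[in RHS]scaleN1r th_shift scaleN1r.
  rewrite E1 E2 !square_on_th// => /ThatP[h1 h2] /ThatP[h3 h4].
  suff -> : w = 0 by rewrite thE; apply: pairP => /=; ring.
  move: h1 h2 h3 h4; clear E1 E2; move: w => w; elim/I4_ind: k; rewrite /cz /= => h1 h2 h3 h4; apply: pairP => /=; lra.
move=> [/(square_onP _ AB)]; rewrite -{2 3}(locK AB p).
have := locK AB p; move: (loc A B p) => z zp.
rewrite ThatP => -[z1 z2] H.
have {}H w : That (z + w) -> That (z - w) -> w = 0.
  move=> h1 h2; have := H (th A B w - A).
  rewrite -[th A B z + _]/(th A B z + (th A B w - A)).
  have -> : th A B z + (th A B w - A) = th A B (z + w).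
    by rewrite -[w in RHS]scale1r th_shift scale1r.
  have -> : th A B z - (th A B w - A) = th A B (z - w).
    by rewrite -[in RHS]scaleN1r th_shift scaleN1r.
  rewrite !square_on_th// => /(_ h1 h2) /eqP; rewrite subr_eq0 => /eqP h.
  by apply: (th_inj AB); rewrite h thE; apply: pairP => /=; ring.
have Z1 : z.1 = 0 \/ z.1 = 1.
  apply: contrapT => /not_orP[n0 n1].
  (* The largest horizontal displacement that stays in the square in both directions. *)
  have E : (Num.min z.1 (1 - z.1), 0) = 0 :> R * R.
    apply: H; apply/ThatP => /=; rewrite ?addr0 ?subr0;
      by case: (leP z.1 (1 - z.1)) => ?; split=> //; lra.
  have := congr1 fst E => /=.
  case: (leP z.1 (1 - z.1)) => _ h; first by [].
  by apply: n1; clear -h; lra.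
have Z2 : z.2 = 0 \/ z.2 = 1.
  apply: contrapT => /not_orP[n0 n1].
  have E : (0, Num.min z.2 (1 - z.2)) = 0 :> R * R.
    apply: H; apply/ThatP => /=; rewrite ?addr0 ?subr0;
      by case: (leP z.2 (1 - z.2)) => ?; split=> //; lra.
  have := congr1 snd E => /=.
  case: (leP z.2 (1 - z.2)) => _ h; first by [].
  by apply: n1; clear -h; lra.
suff [k zk] : exists k, z = cz k by exists k; rewrite /vtx -zk zp.
case: Z1 Z2 => h1 [] h2.
- by exists ord0; exact: pairP.
- by exists (ordS (ordS (ordS ord0))); exact: pairP.
- by exists (ordS ord0); exact: pairP.
- by exists (ordS (ordS ord0)); exact: pairP.
Qed.

(** Both points are corners because corners are extreme points. In the frame of the side starting at
    [A'], a [B'] that is not the next corner would coincide with [A'] or push another corner out of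
    the square. *)
Lemma square_on_eq A B A' B' : A <> B -> A' <> B' ->
  square_on A' B' = square_on A B -> exists k, A' = vtx A B k /\ B' = vtx A B (ordS k).
Proof.
move=> AB AB' E.
have [k Ek] : exists k, A' = vtx A B k.
  by apply/(extremal_square _ AB); rewrite -E; apply/(extremal_square _ AB'); exists ord0; rewrite vtx0.
have [l El] : exists l, B' = vtx A B l.
  apply/(extremal_square _ AB); rewrite -E; apply/(extremal_square _ AB').
  by exists (ordS ord0); rewrite vtx1.
exists k; split => //.
have H m : square_on A B (vtx A' B' m).
  by rewrite -E; apply/(square_on_th _ AB'); exact: That_cz.
pose D := vtx A B (ordS k); rewrite -/D.
have kAB := vtx_neq (k := k) AB.
have {}H m : That (loc A' D (vtx A' B' m)).
  by have := H m; rewrite /D Ek => ?; apply/(square_onP _ kAB); rewrite square_on_vtx.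
have [w Ew] : exists w, B' = th A' D (cz w).
  exists (iter (4 - k)%N (@ordS 4) l); rewrite /D [in RHS]Ek th_vtx El.
  congr vtx; elim/I4_ind: k {Ek H kAB D}; elim/I4_ind: l {El}; exact: val_inj.
have AD : A' <> D by rewrite /D Ek.
have H2 := H (ordS (ordS ord0)); have H3 := H (ordS (ordS (ordS ord0))).
have Ew' : B' = A' + (th A' D (cz w) - A') by rewrite -Ew addrC subrK.
(* Composition of similarities with the origin [A'], as for products of complex numbers. *)
have T2 : th A' B' (1, 1) = th A' D (th (0, 0) (cz w) (1, 1)).
  by rewrite Ew !thE; apply: pairP => /=; ring.
have T3 : th A' B' (0, 1) = th A' D (th (0, 0) (cz w) (0, 1)).
  by rewrite Ew !thE; apply: pairP => /=; ring.
move: H2 H3; rewrite /vtx /cz /= T2 T3 !thK// !thE /= => /ThatP[/= a b] /ThatP[/= c d].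
move: Ew a b c d; elim/I4_ind: w {T2 T3 Ew'}; rewrite /cz/= => Ew a b c d.
- by case: AB'; rewrite Ew thE; apply: pairP => /=; ring.
- by rewrite Ew -[RHS](vtx1 A').
- by exfalso; clear -a b c d; lra.
- by exfalso; clear -a b c d; lra.
Qed.

End SquareGeometry.

(** * Bilinear bijections onto a square *)

Section BilinearMaps.
Context {R : realType}.
Implicit Types (A B p q z v : R * R).

Lemma half_itv : 0 <= (2^-1 : R) <= 1.
Proof. lra. Qed.

(* The corners of the square, being extremal, are the images of the corners
   of the reference square; were [psi] to send adjacent corners to opposite
   ones, two opposite edges would cross and [psi] would not be injective. *)
Lemma bilinear_square (T : set (R * R)) (psi : R * R -> R * R) :
  is_square T -> bilinear_transformation psi T ->
  exists A B, [/\ A <> B, T = square_on A B &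
    (forall z, That z -> psi z = th A B z) \/
    (forall z, That z -> psi z = th A B (z.2, z.1))].
Proof.
move=> [A0 [B0 [AB0 T0]]] [[a [b [c [d psiE]]]] [psiT psi_inj psi_surj]].
have bary z : That z -> psi z = ((1 - z.1) * (1 - z.2)) *: psi (0, 0) +
    (z.1 * (1 - z.2)) *: psi (1, 0) + (z.1 * z.2) *: psi (1, 1) +
    ((1 - z.1) * z.2) *: psi (0, 1).
  move=> Tz; rewrite !psiE //; try by apply/ThatP; rewrite /= ?lexx ?ler01.
  by apply: pairP => /=; rewrite !scaleRE; ring.
have corner k : exists l, psi (cz l) = vtx A0 B0 k.
  have [Tk ek] : extremal T (vtx A0 B0 k) by rewrite T0; apply/extremal_square => //; exists k.
  have [z Tz zk] := psi_surj _ Tk.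
  (* A bilinear map is affine along lines parallel to the axes, so there it takes symmetric points
     to symmetric points. *)
  have H (v : R * R) : That (z + v) -> That (z - v) -> v.1 * v.2 = 0 -> v = 0.
    move=> T1 T2 v0; have := ek (psi (z + v) - psi z); rewrite -zk.
    have -> : psi z + (psi (z + v) - psi z) = psi (z + v) by rewrite addrC subrK.
    have -> : psi z - (psi (z + v) - psi z) = psi (z - v).
      rewrite !psiE//; case: z v v0 {Tz zk T1 T2} => [z1 z2] [v1 v2] /= v0.
      have e : (z1 - v1) * (z2 - v2) = z1 * z2 *+ 2 - (z1 + v1) * (z2 + v2).
        by ring: v0.
      by rewrite e; apply: pairP => /=; rewrite !scaleRE; ring.
    move=> /(_ (psiT _ T1) (psiT _ T2)) /eqP; rewrite subr_eq0 => /eqP.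
    move=> /psi_inj; rewrite !inE => /(_ T1 Tz) /eqP.
    by rewrite -subr_eq0 addrC addKr => /eqP.
  move: Tz => /ThatP[z1 z2].
  have Z1 : z.1 = 0 \/ z.1 = 1.
    apply: contrapT => /not_orP[n0 n1].
    have E : (Num.min z.1 (1 - z.1), 0) = 0 :> R * R.
      apply: H; rewrite /= ?mulr0//; apply/ThatP => /=; rewrite ?addr0 ?subr0;
        by case: (leP z.1 (1 - z.1)) => ?; split=> //; lra.
    have := congr1 fst E => /=.
    case: (leP z.1 (1 - z.1)) => _ h; first by [].
    by apply: n1; clear -h; lra.
  have Z2 : z.2 = 0 \/ z.2 = 1.
    apply: contrapT => /not_orP[n0 n1].
    have E : (0, Num.min z.2 (1 - z.2)) = 0 :> R * R.
      apply: H; rewrite /= ?mul0r//; apply/ThatP => /=; rewrite ?addr0 ?subr0;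
        by case: (leP z.2 (1 - z.2)) => ?; split=> //; lra.
    have := congr1 snd E => /=.
    case: (leP z.2 (1 - z.2)) => _ h; first by [].
    by apply: n1; clear -h; lra.
  suff [l zl] : exists l, z = cz l by exists l; rewrite -zl.
  case: Z1 Z2 => h1 [] h2.
  - by exists ord0; exact: pairP.
  - by exists (ordS (ordS (ordS ord0))); exact: pairP.
  - by exists (ordS ord0); exact: pairP.
  - by exists (ordS (ordS ord0)); exact: pairP.
have [s sP] := choice corner.
have s_inj : injective s.
  by move=> k l skl; apply: (vtx_inj AB0); rewrite -!sP skl.
have s_bij : bijective s by exact: injF_bij.
have [s' ss' s's] := s_bij.
(* With the origin of the square placed at [psi (0, 0)], only the order of the three other corners
   is open. *)
pose A := psi (0, 0).
have A_E : A = vtx A0 B0 (s' ord0) by rewrite -sP s's.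
pose B := vtx A0 B0 (ordS (s' ord0)).
have AB : A <> B by rewrite A_E; exact: vtx_neq.
have T_E : T = square_on A B by rewrite T0 A_E square_on_vtx.
have corner' l : exists k, psi (cz l) = vtx A B k.
  apply/(extremal_square _ AB); rewrite -T_E T0; apply/(extremal_square _ AB0).
  by exists (s' l); rewrite -sP s's.
have [t tP] := choice corner'.
have t_inj : injective t.
  move=> k l tkl; apply: cz_inj; apply: psi_inj; rewrite ?inE; try exact: That_cz.
  by rewrite !tP tkl.
have t0 : t ord0 = ord0 by apply: (vtx_inj AB); rewrite -tP vtx0.
have e1 : psi (1, 0) = vtx A B (t (ordS ord0)) := tP (ordS ord0).
have e2 : psi (1, 1) = vtx A B (t (ordS (ordS ord0))) := tP (ordS (ordS ord0)).
have e3 : psi (0, 1) = vtx A B (t (ordS (ordS (ordS ord0)))) := tP (ordS (ordS (ordS ord0))).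
have n01 : t (ordS ord0) <> ord0 by move=> h; have := t_inj _ _ (etrans h (esym t0)) => /(congr1 val).
have n02 : t (ordS (ordS ord0)) <> ord0 by move=> h; have := t_inj _ _ (etrans h (esym t0)) => /(congr1 val).
have n03 : t (ordS (ordS (ordS ord0))) <> ord0 by move=> h; have := t_inj _ _ (etrans h (esym t0)) => /(congr1 val).
have n12 : t (ordS ord0) <> t (ordS (ordS ord0)) by move=> /t_inj /(congr1 val).
have n13 : t (ordS ord0) <> t (ordS (ordS (ordS ord0))) by move=> /t_inj /(congr1 val).
have n23 : t (ordS (ordS ord0)) <> t (ordS (ordS (ordS ord0))) by move=> /t_inj /(congr1 val).
exists A, B; split => //.
have half := half_itv.
(* Otherwise the midpoints of the lower and the upper side would have the same image. *)
have C1 : psi (1, 0) + psi (0, 0) <> psi (1, 1) + psi (0, 1).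
  move=> e.
  have : psi (2^-1, 0) = psi (2^-1, 1).
    rewrite bary 1?[in RHS]bary; try by apply/ThatP; rewrite /= ?lexx ?ler01.
    have e1' := congr1 fst e; have e2' := congr1 snd e; rewrite /= in e1' e2'.
    by apply: pairP => /=; rewrite !scaleRE; clear -e1' e2'; lra.
  move=> /psi_inj; rewrite !inE => h.
  have /h/(_ _)/(congr1 snd)/= : That (2^-1 : R, 0 : R) by apply/ThatP; rewrite /= ?lexx ?ler01.
  suff T1 : That (2^-1 : R, 1 : R) by move=> /(_ T1) /eqP; rewrite eq_sym oner_eq0.
  by apply/ThatP; rewrite /= ?lexx ?ler01.
have C2 : psi (0, 1) + psi (0, 0) <> psi (1, 1) + psi (1, 0).
  move=> e.
  have : psi (0, 2^-1) = psi (1, 2^-1).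
    rewrite bary 1?[in RHS]bary; try by apply/ThatP; rewrite /= ?lexx ?ler01.
    have e1' := congr1 fst e; have e2' := congr1 snd e; rewrite /= in e1' e2'.
    by apply: pairP => /=; rewrite !scaleRE; clear -e1' e2'; lra.
  move=> /psi_inj; rewrite !inE => h.
  have /h/(_ _)/(congr1 fst)/= : That (0 : R, 2^-1 : R) by apply/ThatP; rewrite /= ?lexx ?ler01.
  suff T1 : That (1 : R, 2^-1 : R) by move=> /(_ T1) /eqP; rewrite eq_sym oner_eq0.
  by apply/ThatP; rewrite /= ?lexx ?ler01.
have I4cases (k : 'I_4) : k <> ord0 ->
    [\/ k = ordS ord0, k = ordS (ordS ord0) | k = ordS (ordS (ordS ord0))].
  by elim/I4_ind: k => // _; [constructor 1|constructor 2|constructor 3].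
rewrite -/A in C1 C2.
have v1 : vtx A B (ordS ord0) = B := vtx1 A B.
have v2 : vtx A B (ordS (ordS ord0)) = (B.1 - (B.2 - A.2), B.2 + (B.1 - A.1)).
  by rewrite /vtx thE; apply: pairP => /=; ring.
have v3 : vtx A B (ordS (ordS (ordS ord0))) = (A.1 - (B.2 - A.2), A.2 + (B.1 - A.1)).
  by rewrite /vtx thE; apply: pairP => /=; ring.
(* Of the six orders, those putting an opposite corner next to [A] contradict [C1] or [C2]; the
   identity and the reflection remain. *)
case: (I4cases _ n01) => t1; case: (I4cases _ n02) => t2; case: (I4cases _ n03) => t3;
  try (by exfalso; congruence); rewrite t1 in e1; rewrite t2 in e2; rewrite t3 in e3;
  rewrite e1 e2 e3 v1 v2 v3 in bary C1 C2.
- left=> z Tz; rewrite bary// -/A thE; apply: pairP => /=; rewrite !scaleRE; ring.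
- by exfalso; apply: C2; apply: pairP => /=; ring.
- by exfalso; apply: C1; apply: pairP => /=; ring.
- by exfalso; apply: C1; apply: pairP => /=; ring.
- by exfalso; apply: C2; apply: pairP => /=; ring.
- right=> z Tz; rewrite bary// -/A thE; apply: pairP => /=; rewrite !scaleRE; ring.
Qed.
End BilinearMaps.

(** * Meshes of squares, common edges and boundary edges *)

Section Mesh.
Context {R : realType}.
Implicit Types (Omega : set (R * R)) (A B p q z : R * R).

(** A boundary point interior to the closure could be pushed strictly below the graph without
    leaving the closure, although no point near there belongs to [Omega]. *)
Lemma lipschitz_interior_closure Omega : open Omega -> lipschitz_boundary Omega ->
  interior (closure Omega) = Omega.
Proof.
move=> oO LO; apply/seteqP; split => x; last first.
  move=> Ox; apply: (@filterS _ (nbhs x) _ Omega); first exact: subset_closure.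
  exact: open_nbhs_nbhs.
move=> icx; apply: contrapT => nOx.
have clx : closure Omega x by exact: nbhs_singleton.
have bx : bdry Omega x.
  by split => //; rewrite (_ : interior Omega = Omega)//; exact/interior_id.
have [e [r [g [k [e1 r0 kg HO]]]]] := LO _ bx.
have cg : continuous g.
  move=> y; apply/cvgrPdist_lt => eps eps0; near=> z.
  have k1 : 0 < `|k| + 1 by rewrite ltr_wpDl.
  apply: (@le_lt_trans _ _ ((`|k| + 1) * `|y - z|)).
    apply: (le_trans (kg (y, z) (conj I I))) => /=; apply: ler_wpM2r => //.
    by apply: (le_trans (ler_norm k)); rewrite lerDl.
  rewrite -ltr_pdivlMl//; near: z.
  have : 0 < (`|k| + 1)^-1 * eps by rewrite mulr_gt0// invr_gt0.
  by move: (@cvg_id _ (nbhs y)) => /cvgrPdist_lt; apply.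
have cdot (w : R * R) : continuous (fun y : R * R => dot y w).
  move=> y; apply: cvgD; apply: cvgM; try exact: cvg_cst; [exact: cvg_fst|exact: cvg_snd].
have near_r y : enorm (y - x) < r -> \forall y' \near y, enorm (y' - x) < r.
  move=> yr; have : (fun y' : R * R => enorm (y' - x)) @ y --> enorm (y - x).
    apply: (@continuous_comp _ _ _ (fun y' : R * R => dot (y' - x) (y' - x)) Num.sqrt); last exact: sqrt_continuous.
    have cs : (fun y' : R * R => y' - x) @ y --> y - x by apply: cvgB; [exact: cvg_id|exact: cvg_cst].
    have c1 : (fun y' : R * R => (y' - x).1) @ y --> (y - x).1.
      exact: (cvg_comp _ _ cs cvg_fst).
    have c2 : (fun y' : R * R => (y' - x).2) @ y --> (y - x).2.
      exact: (cvg_comp _ _ cs cvg_snd).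
    by apply: cvgD; apply: cvgM.
  by move=> /cvgr_lt; apply.
(* Signed height above the graph; a step [- t *: perp e] lowers it by exactly [t]. *)
pose d (y : R * R) := dot y (perp e) - g (dot y e).
have cd : continuous d.
  move=> y; apply: cvgB; first exact: cdot.
  by apply: (@continuous_comp _ _ _ (fun y : R * R => dot y e) g); [exact: cdot|exact: cg].
have x0 : enorm (x - x) < r by rewrite subrr /enorm /dot !mul0r addr0 sqrtr0.
have dx : d x <= 0.
  by rewrite leNgt; apply/negP; rewrite subr_gt0 => h; apply: nOx; apply/HO.
have key (t : R) : d (x - t *: perp e) = d x - t.
  rewrite /d.
  have e2 : e.1 * e.1 + e.2 * e.2 = 1.
    have := congr1 (fun u => u ^+ 2) e1; rewrite /enorm sqr_sqrtr ?expr1n//.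
    by rewrite /dot addr_ge0// -expr2 sqr_ge0.
  have -> : dot (x - t *: perp e) e = dot x e.
    by rewrite /dot /perp /=!scaleRE; ring.
  have -> : dot (x - t *: perp e) (perp e) = dot x (perp e) - t.
    by rewrite /dot /perp /= !scaleRE -[X in _ = _ - X]mulr1 -e2; ring.
  by rewrite addrAC.
have lim_t : (fun t : R => x - t *: perp e) @ 0^'+ --> x.
  rewrite -[X in _ --> X]subr0 -(scale0r (perp e)); apply: cvg_at_right_filter.
  by apply: cvgB; [exact: cvg_cst|apply: cvgZr_tmp; exact: cvg_id].
have [t [t0 [tcl tr]]] : exists t : R, 0 < t /\ (closure Omega (x - t *: perp e) /\ enorm (x - t *: perp e - x) < r).
  suff : \forall t \near 0^'+, 0 < t /\ (closure Omega (x - t *: perp e) /\ enorm (x - t *: perp e - x) < r).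
    by move=> /filter_ex.
  have h1 := lim_t _ icx; have h2 := lim_t _ (near_r _ x0).
  near=> t; split; first by near: t; exact: nbhs_right_gt.
  by split; near: t; [exact: h1|exact: h2].
have dy : d (x - t *: perp e) < 0 by rewrite key; lra.
have : \forall y' \near (x - t *: perp e), d y' < 0.
  by have /cvgr_lt := cd (x - t *: perp e); apply.
move=> nd; have [y [Oy [y1 y2]]] := tcl _ (filterI nd (near_r _ tr)).
by have := (HO _ y2).1 Oy; rewrite -subr_gt0 -/(d y) => h; have := lt_trans y1 h; rewrite ltxx.
Unshelve. all: by end_near. Qed.

Definition meet_regularly (T1 T2 : set (R * R)) : Prop :=
  [\/ T1 `&` T2 = set0,
      exists A B, [/\ is_edge T1 A B, is_edge T2 A B & T1 `&` T2 = segment A B] |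
      exists A, [/\ is_vertex T1 A, is_vertex T2 A & T1 `&` T2 = [set A]]].

(** Numbered squares, each with a distinguished side; [mesh_interior] is the form in which the
    regularity of the boundary is used. *)
Record is_mesh Omega n (a b : 'I_n -> R * R) : Prop := IsMesh {
  mesh_neq : forall i, a i <> b i;
  mesh_inj : injective (fun i => square_on (a i) (b i));
  mesh_cover : closure Omega = \bigcup_i square_on (a i) (b i);
  mesh_meet : forall i j, i != j -> meet_regularly (square_on (a i) (b i)) (square_on (a j) (b j));
  mesh_interior : interior (closure Omega) = Omega }.
Arguments mesh_neq {Omega n a b} _ _ _.

Context (Omega : set (R * R)) (n : nat) (a b : 'I_n -> R * R).
Context (M : is_mesh Omega a b).

Local Notation sq i := (square_on (a i) (b i)).
Local Notation vt i := (vtx (a i) (b i)).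

(* The edges [k] of [i] and [l] of [j] are the two sides of the same segment. *)
Definition partner (e f : 'I_n * 'I_4) : Prop :=
  vt e.1 e.2 = vt f.1 (ordS f.2) /\ vt e.1 (ordS e.2) = vt f.1 f.2.

Lemma partner_sym e f : partner e f -> partner f e.
Proof. by case. Qed.

Lemma square_partner e f : partner e f ->
  sq f.1 = square_on (vt e.1 (ordS e.2)) (vt e.1 e.2).
Proof. by move=> [-> ->]; rewrite square_on_vtx//; exact: (mesh_neq M). Qed.

(** The reversed edge determines the square on its left, [mesh_inj] its index, and the starting
    corner the edge. *)
Lemma partner_fun e f f' : partner e f -> partner e f' -> f = f'.
Proof.
move=> ef ef'; have := square_partner ef; rewrite -(square_partner ef') => /(mesh_inj M).
move: ef ef'; case: f f' => [j l] [j' l'] /= [_ h1] [_ h2] jj'; rewrite -{}jj' in h2 *.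
by rewrite (vtx_inj (mesh_neq M j) (etrans (esym h1) h2 : vt j l = vt j l')).
Qed.

Lemma open_Omega : open Omega.
Proof. by rewrite -(mesh_interior M); exact: open_interior. Qed.

Lemma bdryE p : bdry Omega p <-> closure Omega p /\ ~ Omega p.
Proof.
by rewrite /bdry /setD /= ((interior_id Omega).1 open_Omega).
Qed.

Lemma is_edge_vtx A B A' B' : A <> B -> is_edge (square_on A B) A' B' ->
  exists k, (A' = vtx A B k /\ B' = vtx A B (ordS k)) \/
            (A' = vtx A B (ordS k) /\ B' = vtx A B k).
Proof.
move=> AB [AB' [E|E]].
  by have [k []] := square_on_eq AB AB' (esym E); exists k; left.
by have [k []] := square_on_eq AB (nesym AB') (esym E); exists k; right.
Qed.

Lemma vtx_is_edge A B k : A <> B ->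
  is_edge (square_on A B) (vtx A B k) (vtx A B (ordS k)).
Proof. by move=> AB; split; [exact: vtx_neq|left; rewrite square_on_vtx]. Qed.

Lemma is_vertex_vtx A B A' : A <> B -> is_vertex (square_on A B) A' ->
  exists k, A' = vtx A B k.
Proof.
move=> AB [B' /(is_edge_vtx AB)[k [[-> _]|[-> _]]]]; first by exists k.
by exists (ordS k).
Qed.

Lemma segmentC A B : segment A B = segment B A.
Proof.
suff H A1 B1 : segment A1 B1 `<=` segment B1 A1 by apply/seteqP; split; exact: H.
move=> p [t]; rewrite /= in_itv/= => t01 <-; exists (1 - t).
  by rewrite /= in_itv/=; lra.
by apply: pairP => /=; rewrite !scaleRE; ring.
Qed.

Lemma segment_th A B p : segment A B p <-> exists2 t : R, 0 <= t <= 1 & p = th A B (t, 0).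
Proof.
have E (t : R) : A + t *: (B - A) = th A B (t, 0).
  by rewrite thE; apply: pairP => /=; rewrite scaleRE; ring.
split=> [[t t01 <-]|[t t01 ->]]; exists t => //.
Qed.

(** Both squares are traversed counterclockwise; running through the common edge in the same
    direction, they would lie on the same side of it and coincide. *)
Lemma shared_edge i j A B : i != j -> is_edge (sq i) A B -> is_edge (sq j) A B ->
  exists k l, partner (i, k) (j, l) /\
    ((A = vt i k /\ B = vt i (ordS k)) \/ (A = vt i (ordS k) /\ B = vt i k)).
Proof.
move=> ij; have ai := mesh_neq M i; have aj := mesh_neq M j.
move=> /(is_edge_vtx ai)[k hk] /(is_edge_vtx aj)[l hl]; exists k, l.
have ij' : sq i <> sq j by move=> /(mesh_inj M)/eqP; apply/negP.
have : sq i = square_on (vt i k) (vt i (ordS k)) by rewrite square_on_vtx.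
have : sq j = square_on (vt j l) (vt j (ordS l)) by rewrite square_on_vtx.
case: hk hl => -[-> ->] [] [h1 h2]; rewrite h1 h2 => e1 e2.
- by case: ij'; rewrite e1 e2.
- by split; [|left]; split.
- by split; [|right]; split.
- by case: ij'; rewrite e1 e2.
Qed.

Lemma mesh_meetP i j : i != j -> (exists z, sq i z /\ sq j z) ->
  (exists k l, partner (i, k) (j, l) /\ sq i `&` sq j = segment (vt i k) (vt i (ordS k))) \/
  (exists k, sq i `&` sq j = [set vt i k]).
Proof.
move=> ij [z zij]; case: (mesh_meet M ij) => [h|[A [B [eA eB h]]]|[A [eA eB h]]].
- by have : (sq i `&` sq j) z by []; rewrite h.
- have [k [l [kl hk]]] := shared_edge ij eA eB; left; exists k, l; split => //.
  by rewrite h; case: hk => -[-> ->] //; rewrite segmentC.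
- by have [k Ek] := is_vertex_vtx (mesh_neq M i) eA; right; exists k; rewrite h Ek.
Qed.

Lemma sq_closure i : sq i `<=` closure Omega.
Proof. by rewrite (mesh_cover M) => p; exists i. Qed.

Lemma interior_sq_Omega i : interior (sq i) `<=` Omega.
Proof.
by rewrite -[X in _ `<=` X](mesh_interior M); apply: interiorS; exact: sq_closure.
Qed.

Lemma interior_sq_disjoint i j p : i != j -> interior (sq i) p -> sq j p -> False.
Proof.
move=> ij; have ai := mesh_neq M i.
move=> ip jp; have := (interior_square_on p ai).1 ip.
have sip : sq i p by exact: interior_subset.
have : (sq i `&` sq j) p by [].
have [[k [l [_ ->]]]|[k ->]] := mesh_meetP ij (ex_intro _ p (conj sip jp)).
  move=> /segment_th[t t01 ->]; rewrite th_rotz thK// => /ThoP.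
  by elim/I4_ind: k; rewrite /rotz /=; lra.
by move=> ->; rewrite /vtx thK// => /ThoP; elim/I4_ind: k; rewrite /cz /=; lra.
Qed.

(** The open rectangle formed by the two squares and their common edge lies in the closure of
    [Omega], hence in its interior, which is [Omega]. *)
Lemma partner_double e f (x y : R) : partner e f -> 0 < x < 1 -> -1 < y < 1 ->
  let p := th (vt e.1 e.2) (vt e.1 (ordS e.2)) (x, y) in
  [/\ Omega p, 0 <= y -> sq e.1 p & y <= 0 -> sq f.1 p].
Proof.
case: e => i k ef x01 y01; rewrite /=.
have ai := mesh_neq M i; have ak := vtx_neq (k := k) ai.
set A := vt i k in ak *; set B := vt i (ordS k) in ak *.
have sqi : sq i = square_on A B by rewrite square_on_vtx.
have sqf : sq f.1 = square_on B A by exact: square_partner ef.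
(* The frame of the partner is obtained by a half turn about the midpoint of the edge. *)
have thBA z : th A B z = th B A (1 - z.1, - z.2) by rewrite !thE; apply: pairP => /=; ring.
pose U := loc A B @^-1` (`]0, 1[ `*` `]-1, 1[).
have oU : open U.
  apply: open_comp; first by move=> p _; exact: continuous_loc.
  rewrite (_ : _ `*` _ = (fst @^-1` `]0, 1[) `&` (snd @^-1` `]-1, 1[))//.
  by apply: openI; apply: open_comp => [p _|]; rewrite ?itv_open//; [exact: cvg_fst|exact: cvg_snd].
have H z : 0 < z.1 < 1 -> -1 < z.2 < 1 ->
    (0 <= z.2 -> sq i (th A B z)) /\ (z.2 <= 0 -> sq f.1 (th A B z)).
  move=> z1 z2; split => z20; first by rewrite sqi; apply/square_on_th => //; apply/ThatP; lra.
  by rewrite sqf thBA; apply/square_on_th; [exact: nesym|apply/ThatP => /=; lra].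
have [h1 h2] := H (x, y) x01 y01; split => //.
rewrite -[X in X _](mesh_interior M); apply: (@filterS _ (nbhs _) _ U); last first.
  apply: open_nbhs_nbhs; split => //.
  suff : (`]0, 1[ `*` `]-1, 1[) (loc A B (th A B (x, y))) by [].
  by rewrite thK//; split; rewrite /= in_itv.
move=> p; rewrite /U /preimage /mkset; have := locK ak p; move: (loc A B p) => z zp [/=].
rewrite !in_itv/= => p1 p2; have [q1 q2] := H _ p1 p2; rewrite zp in q1 q2.
by have [/q1|/ltW/q2] := leP 0 z.2; exact: sq_closure.
Qed.

(** Off the edge this is disjointness of interiors; a third square reaching an inner point of the
    edge would share that edge and be the partner. *)
Lemma partner_interior e f (x y : R) : partner e f -> 0 < x < 1 -> -1 < y < 1 ->
  let p := th (vt e.1 e.2) (vt e.1 (ordS e.2)) (x, y) in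
  forall j, sq j p -> j = e.1 \/ j = f.1.
Proof.
move=> ef x01 y01 p j jp.
have ai := mesh_neq M e.1; have ak := vtx_neq (k := e.2) ai.
have [_ pe pf] := partner_double ef x01 y01; rewrite -/p in pe pf.
have [->|je] := eqVneq j e.1; first by left.
have [->|jf] := eqVneq j f.1; first by right.
exfalso; have [y0|y0|y0] := ltgtP y 0.
- apply: (interior_sq_disjoint (i := f.1) _ _ jp); first by rewrite eq_sym.
  have [h1 h2] := ef; rewrite -(square_on_vtx f.2 (mesh_neq M f.1)) /p h1 h2.
  rewrite (_ : th _ _ _ = th (vt f.1 f.2) (vt f.1 (ordS f.2)) (1 - x, - y)).
    apply/interior_square_on_th; first exact/vtx_neq/(mesh_neq M).
    by apply/ThoP => /=; lra.
  by rewrite !thE; apply: pairP => /=; ring.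
- apply: (interior_sq_disjoint (i := e.1) _ _ jp); first by rewrite eq_sym.
  rewrite -(square_on_vtx e.2 ai); apply/interior_square_on_th => //.
  by apply/ThoP => /=; lra.
- rewrite y0 in p jp pe pf *.
  have /pe eP : 0 <= (0 : R) by [].
  have : (sq e.1 `&` sq j) p by [].
  have ej : e.1 != j by rewrite eq_sym.
  have [[k [l [kl ->]]]|[k ->]] := mesh_meetP ej (ex_intro _ p (conj eP jp)).
  + move=> /segment_th[t t01]; rewrite /p !th_rotz => /(th_inj ai) h.
    suff ek : e.2 = k.
      move: ef kl; rewrite (surjective_pairing e) ek => ef kl.
      by move: (partner_fun ef kl) jf => ->; rewrite eqxx.
    move: h; move: (e.2) => l'; elim/I4_ind: k {kl}; elim/I4_ind: l' => //;
      rewrite /rotz/= => -[h1 h2]; exfalso; clear -h1 h2 x01 t01; lra.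
  + rewrite /p th_rotz /vtx => /(th_inj ai).
    move: (e.2) => l'; elim/I4_ind: k; elim/I4_ind: l';
      rewrite /rotz/= /cz/= => h; have h1 := congr1 fst h; have h2 := congr1 snd h;
      rewrite /= in h1 h2; exfalso; clear -h1 h2 x01; lra.
Qed.

Lemma partner_not_bdry e f : partner e f ->
  ~ (segment (vt e.1 e.2) (vt e.1 (ordS e.2)) `<=` bdry Omega).
Proof.
move=> ef H.
have h : 0 < (2^-1 : R) < 1 by lra.
have h' : -1 < (0 : R) < 1 by lra.
have [Op _ _] := partner_double ef h h'.
have : bdry Omega (th (vt e.1 e.2) (vt e.1 (ordS e.2)) (2^-1, 0)).
  by apply: H; apply/segment_th; exists 2^-1 => //; lra.
by move=> /bdryE[].
Qed.

(** An inner point of the edge lies in no other square. Were it in [Omega], points just outside the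
    square would be covered by nothing. *)
Lemma no_partner_bdry i k : (forall f, ~ partner (i, k) f) ->
  segment (vt i k) (vt i (ordS k)) `<=` bdry Omega.
Proof.
move=> np; have ai := mesh_neq M i; have ak := vtx_neq (k := k) ai.
set A := vt i k in ak *; set B := vt i (ordS k) in ak *.
have sqi : sq i = square_on A B by rewrite square_on_vtx.
have inner (t : R) : 0 < t < 1 -> ~ Omega (th A B (t, 0)).
  move=> t01 Op.
  have only (j : 'I_n) : j != i -> ~ sq j (th A B (t, 0)).
    move=> ji jp.
    have ip : sq i (th A B (t, 0)) by rewrite sqi; apply/square_on_th => //; apply/ThatP => /=; lra.
    have : (sq i `&` sq j) (th A B (t, 0)) by [].
    have ij : i != j by rewrite eq_sym.
    have [[k' [l [kl ->]]]|[k' ->]] := mesh_meetP ij (ex_intro _ _ (conj ip jp)).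
    + move=> /segment_th[s s01]; rewrite /A /B !th_rotz => /(th_inj ai) h.
      suff ek : k = k' by apply: (np (j, l)); rewrite ek.
      move: h {np kl}; clear -t01 s01; elim/I4_ind: k; elim/I4_ind: k' => //;
        rewrite /rotz/= => -[h1 h2]; exfalso; lra.
    + rewrite /A /B th_rotz /vtx => /(th_inj ai).
      clear -t01; elim/I4_ind: k; elim/I4_ind: k';
        rewrite /rotz/= /cz/= => h; have h1 := congr1 fst h; have h2 := congr1 snd h;
        rewrite /= in h1 h2; exfalso; clear -h1 h2 t01; lra.
  have : \forall p \near th A B (t, 0), Omega p /\ forall j : 'I_n, j != i -> ~ sq j p.
    apply: filterI; first by apply: open_nbhs_nbhs; split => //; exact: open_Omega.
    suff H (j : 'I_n) : \forall p \near th A B (t, 0), j != i -> ~ sq j p.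
      by move/filter_forall : H.
    have [->|ji] := eqVneq j i; first by apply: (@filterS _ (nbhs _) _ setT) => [p _ /eqP|]; [by []|exact: filterT].
    have : nbhs (th A B (t, 0)) (~` sq j).
      apply: open_nbhs_nbhs; split; last exact: only.
      by apply: closed_openC; apply: closed_square_on; exact: (mesh_neq M).
    by apply: filterS => p ? _.
  move=> /(@near_th_line _ A B (t, 0) (0, -1)) [e e0 [Oe ne]].
  have [j _ jp] : (\bigcup_i sq i) (th A B ((t, 0) + e *: (0, -1))).
    by rewrite -(mesh_cover M); exact: subset_closure.
  have [ji|/ne] := eqVneq j i; last by [].
  move: jp; rewrite ji sqi => /(square_on_th _ ak)/ThatP[_ /=].
  by rewrite scaleRE; lra.
move=> p /segment_th[t t01 ->]; apply/bdryE; split.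
  by apply: (@sq_closure i); rewrite sqi; apply/square_on_th => //; apply/ThatP => /=; lra.
move=> Op; have nO : nbhs (th A B (t, 0)) Omega.
  by apply: open_nbhs_nbhs; split => //; exact: open_Omega.
(* End points reduce to inner points by a small step towards the midpoint. *)
have [e e0 Oe] := @near_th_line _ A B (t, 0) (2^-1 - t, 0) _ nO.
apply: (inner (t + e * (2^-1 - t))); last first.
  by move: Oe; congr (Omega (th _ _ _)); apply: pairP => /=; rewrite ?scaleRE; ring.
by case/andP: e0 => e0 e1; case/andP: t01 => t0 t1; apply/andP; split; nra.
Qed.

End Mesh.

(** * Measurability, Fubini and Green's formulas on the reference square *)

Section ReferenceSquare.
Context {R : realType}.
Notation mu := (@lebesgue_measure R).
Notation P := (measurableTypeR R * measurableTypeR R)%type.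
Notation leb2 := (@leb2 R).

Lemma rat_box (x e : R) : 0 < e -> exists a b : rat,
  ratr a < x < ratr b /\ x - e < ratr a /\ ratr b < x + e.
Proof.
move=> e0; have h1 : x - e < x by rewrite ltrBlDr ltrDl.
have h2 : x < x + e by rewrite ltrDl.
have [a] := rat_in_itvoo h1; have [b] := rat_in_itvoo h2.
rewrite !in_itv/= => /andP[b1 b2] /andP[a1 a2].
by exists a, b; rewrite a2 b1.
Qed.

(** Links the product topology with the product sigma-algebra: an open set is the union of the
    countably many rational boxes inside it. *)
Lemma open_measurable2 (U : set P) : open (U : set (R * R)) -> measurable U.
Proof.
move=> oU.
pose box (q : (rat * rat) * (rat * rat)) : set P :=
  `]ratr q.1.1, ratr q.1.2[%classic `*` `]ratr q.2.1, ratr q.2.2[%classic.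
pose F (n : nat) : set P :=
  if unpickle n is Some q then if `[< box q `<=` U >] then box q else set0 else set0.
rewrite (_ : U = \bigcup_n F n).
  apply: bigcupT_measurable => n; rewrite /F; case: unpickle => [q|//].
  by case: ifP => // _; apply: measurableX.
apply/seteqP; split => [p Up|p [n _]]; last first.
  by rewrite /F; case: unpickle => // q; case: ifP => // /asboolP h /h.
have /nbhs_ballP[e /= e0 eU] : nbhs (p : R * R) (U : set (R * R)) by exact: open_nbhs_nbhs.
have [a1 [b1 [h1 [h2 h3]]]] := rat_box p.1 e0.
have [a2 [b2 [h4 [h5 h6]]]] := rat_box p.2 e0.
refine (ex_intro2 _ _ (pickle ((a1, b1), (a2, b2))) I _); rewrite /F pickleK.
case: asboolP => [_|[]]; first by split; rewrite /= in_itv.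
move=> q [/=]; rewrite !in_itv/= => q1 q2; apply: eU; split; rewrite /ball /= ltr_norml; lra.
Qed.

Lemma continuous_measurable2 (f : R * R -> R) : continuous f ->
  measurable_fun setT (f : P -> measurableTypeR R).
Proof.
move=> cf; apply: (measurability _ (RGenOInfty.measurableE R)) => _ [_ [a ->] <-].
rewrite setTI; apply: open_measurable2.
by apply: open_comp; [move=> x _; exact: cf|exact: interval_open].
Qed.

Lemma measurable_That : measurable (That : set P).
Proof. exact: measurableX. Qed.

Lemma measurable_Tho : measurable (Tho : set P).
Proof. exact: measurableX. Qed.

Lemma leb2_That : leb2 That = 1%:E.
Proof.
rewrite leb2X//= lebesgue_measure_itv/= lte_fin ltr01.
by rewrite oppr0 adde0 mule1.
Qed.

Lemma leb2_Tho : leb2 Tho = 1%:E.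
Proof.
rewrite leb2X//= lebesgue_measure_itv/= lte_fin ltr01.
by rewrite oppr0 adde0 mule1.
Qed.

Lemma negligible_That_Tho : leb2.-negligible (That `\` Tho).
Proof.
apply/negligibleP; first by apply: measurableD; [exact: measurable_That|exact: measurable_Tho].
rewrite measureD; [|exact: measurable_That|exact: measurable_Tho|]; last first.
  suff : (leb2 That < +oo)%E by [].
  by rewrite leb2_That ltry.
have E : That `&` Tho = Tho :> set (R * R).
  by apply/seteqP; split => [z []//|z h]; split => //; exact: Tho_That.
rewrite E; transitivity (1%:E - 1%:E : \bar R)%E; last by rewrite subee.
by congr (_ - _)%E; [exact: leb2_That|exact: leb2_Tho].
Qed.

Lemma bounded_That (f : R * R -> R) : continuous f ->
  exists M, forall z, That z -> `|f z| <= M.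
Proof.
move=> cf; have cT : {within That, continuous f} by exact: continuous_subspaceT.
have /compact_bounded[M [_ HM]] := continuous_compact cT compact_That.
by exists (M + 1) => z Tz; apply: HM; [rewrite ltrDl|exists z].
Qed.

Lemma continuous_integrable_That (f : R * R -> R) : continuous f ->
  leb2.-integrable (That : set P) (EFin \o f).
Proof.
move=> cf; apply: measurable_bounded_integrable.
- exact: measurable_That.
- by have -> := leb2_That; rewrite ltry.
- by apply: measurable_funTS; exact: continuous_measurable2.
- have [M HM] := bounded_That cf; exists M; split; rewrite ?num_real// => x Mx z Tz.
  by apply: (le_trans (HM _ Tz)); exact: ltW.
Qed.

Lemma continuous_slice1 (f : R * R -> R) (y : R) : continuous f ->
  continuous (fun x : R => f (x, y)).
Proof.
move=> cf; suff : continuous (f \o (fun x : R => (x, y))) by [].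
move=> x; apply: continuous_comp; last exact: cf.
rewrite (_ : (fun x : R => (x, y)) = (fun x => x *: ((1, 0) : R * R) + ((0, y) : R * R))).
  by apply: cvgD; [apply: cvgZr_tmp; exact: cvg_id|exact: cvg_cst].
by apply/funext => t; apply: pairP => /=; rewrite !scaleRE; ring.
Qed.

Lemma continuous_slice2 (f : R * R -> R) (x : R) : continuous f ->
  continuous (fun y : R => f (x, y)).
Proof.
move=> cf; suff : continuous (f \o (fun y : R => (x, y))) by [].
move=> y; apply: continuous_comp; last exact: cf.
rewrite (_ : (fun y : R => (x, y)) = (fun y => y *: ((0, 1) : R * R) + ((x, 0) : R * R))).
  by apply: cvgD; [apply: cvgZr_tmp; exact: cvg_id|exact: cvg_cst].
by apply/funext => t; apply: pairP => /=; rewrite !scaleRE; ring.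
Qed.

Lemma continuous_integrable01 (g : R -> R) : continuous g ->
  mu.-integrable `[0, 1] (EFin \o g).
Proof.
move=> cg; apply: continuous_compact_integrable; first exact: segment_compact.
exact: continuous_subspaceT.
Qed.

Lemma Rintegral_That_yx (f : R * R -> R) : continuous f ->
  \int[leb2]_(z in That) f z =
  \int[mu]_(x in `[0, 1]) (\int[mu]_(y in `[0, 1]) f (x, y)).
Proof.
move=> cf; rewrite /Rintegral.
have fi := continuous_integrable_That cf.
have fi' : leb2.-integrable setT ((EFin \o f) \_ (That : set P)).
  by case: (integrable_mkcond (mu := leb2) (EFin \o f) measurable_That) => + _; apply.
congr fine; rewrite [LHS]integral_mkcond -[LHS](integral12_prod_meas1 fi').
rewrite [RHS]integral_mkcond; apply: eq_integral => x _.
rewrite [in RHS]/patch; case: ifPn => [|]; rewrite ?inE/= => x01.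
  rewrite fineK; last first.
    apply: integrable_fin_num => //; apply: continuous_integrable01.
    exact: continuous_slice2.
  rewrite [RHS]integral_mkcond; apply: eq_integral => y _.
  rewrite /patch; congr (if _ then _ else _).
  by apply/idP/idP; rewrite !inE; [case|split].
apply: integral0_eq => y _; rewrite /patch; case: ifPn => //; rewrite inE => -[x01' _].
by move: x01; rewrite notin_setE.
Qed.

Lemma Rintegral_That_xy (f : R * R -> R) : continuous f ->
  \int[leb2]_(z in That) f z =
  \int[mu]_(y in `[0, 1]) (\int[mu]_(x in `[0, 1]) f (x, y)).
Proof.
move=> cf; rewrite /Rintegral.
have fi := continuous_integrable_That cf.
have fi' : leb2.-integrable setT ((EFin \o f) \_ (That : set P)).
  by case: (integrable_mkcond (mu := leb2) (EFin \o f) measurable_That) => + _; apply.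
congr fine; rewrite [LHS]integral_mkcond -[LHS](integral21_prod_meas1 fi').
rewrite [RHS]integral_mkcond; apply: eq_integral => y _.
rewrite [in RHS]/patch; case: ifPn => [|]; rewrite ?inE/= => y01.
  rewrite fineK; last first.
    apply: integrable_fin_num => //; apply: continuous_integrable01.
    exact: continuous_slice1.
  rewrite [RHS]integral_mkcond; apply: eq_integral => x _.
  rewrite /patch; congr (if _ then _ else _).
  by apply/idP/idP; rewrite !inE; [case|split].
apply: integral0_eq => x _; rewrite /patch; case: ifPn => //; rewrite inE => -[_ y01'].
by move: y01; rewrite notin_setE.
Qed.

Lemma is_derive_slice1 (f : R * R -> R) (x y : R) : differentiable f (x, y) ->
  is_derive x 1 (fun x : R => f (x, y)) ('D_(1, 0) f (x, y)).
Proof.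
move=> df; have [d1 d2] : derivable f (x, y) (1, 0) /\ True by split=> //; exact: diff_derivable.
have E : (fun h : R => h^-1 *: (f (h *: 1 + x, y) - f (x, y))) =
         (fun h : R => h^-1 *: ((f \o shift (x, y)) (h *: (1, 0)) - f (x, y))).
  apply/funext => h; congr (_ *: (f _ - _)).
  by apply: pairP => /=; rewrite !scaleRE ?mulr0 ?add0r.
by split; [rewrite /derivable|rewrite /derive]; rewrite /= E.
Qed.

Lemma is_derive_slice2 (f : R * R -> R) (x y : R) : differentiable f (x, y) ->
  is_derive y 1 (fun y : R => f (x, y)) ('D_(0, 1) f (x, y)).
Proof.
move=> df; have [d1 d2] : derivable f (x, y) (0, 1) /\ True by split=> //; exact: diff_derivable.
have E : (fun h : R => h^-1 *: (f (x, h *: 1 + y) - f (x, y))) =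
         (fun h : R => h^-1 *: ((f \o shift (x, y)) (h *: (0, 1)) - f (x, y))).
  apply/funext => h; congr (_ *: (f _ - _)).
  by apply: pairP => /=; rewrite !scaleRE ?mulr0 ?add0r.
by split; [rewrite /derivable|rewrite /derive]; rewrite /= E.
Qed.

Lemma Rintegral_FTC (F f : R -> R) : continuous f ->
  (forall x : R, is_derive x 1 F (f x)) -> \int[mu]_(x in `[0, 1]) f x = F 1 - F 0.
Proof.
move=> cf dF; have cF : continuous F.
  by move=> x; apply/differentiable_continuous/derivable1_diffP; case: (dF x).
rewrite /Rintegral (@continuous_FTC2 _ f F 0 1)//.
- exact: continuous_subspaceT.
- split; first by move=> x _; case: (dF x).
  + by apply: cvg_at_right_filter; exact: cF.
  + by apply: cvg_at_left_filter; exact: cF.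
- by move=> x _; rewrite derive1E; case: (dF x).
Qed.

Definition C1 (f : R * R -> R) : Prop :=
  (forall p, differentiable f p) /\ (forall v, continuous ('D_v f)).

Lemma C1_continuous f : C1 f -> continuous f.
Proof. by move=> [df _] p; exact: differentiable_continuous. Qed.

Lemma green_x (f : R * R -> R) : C1 f ->
  \int[leb2]_(z in That) 'D_(1, 0) f z =
  \int[mu]_(y in `[0, 1]) f (1, y) - \int[mu]_(y in `[0, 1]) f (0, y).
Proof.
move=> Cf; have cf := C1_continuous Cf; case: Cf => df cD.
rewrite Rintegral_That_xy//.
rewrite -RintegralB//; [|apply: continuous_integrable01; exact: continuous_slice2..].
apply: eq_Rintegral => y _.
apply: (@Rintegral_FTC (fun x => f (x, y)) (fun x => 'D_(1, 0) f (x, y))).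
  exact: (continuous_slice1 (cD (1, 0))).
by move=> x; exact: is_derive_slice1.
Qed.

Lemma green_y (f : R * R -> R) : C1 f ->
  \int[leb2]_(z in That) 'D_(0, 1) f z =
  \int[mu]_(x in `[0, 1]) f (x, 1) - \int[mu]_(x in `[0, 1]) f (x, 0).
Proof.
move=> Cf; have cf := C1_continuous Cf; case: Cf => df cD.
rewrite Rintegral_That_yx//.
rewrite -RintegralB//; [|apply: continuous_integrable01; exact: continuous_slice1..].
apply: eq_Rintegral => x _.
apply: (@Rintegral_FTC (fun y => f (x, y)) (fun y => 'D_(0, 1) f (x, y))).
  exact: (continuous_slice2 (cD (0, 1))).
by move=> y; exact: is_derive_slice2.
Qed.

Lemma Rintegral01_onem (g : R -> R) : continuous g ->
  \int[mu]_(t in `[0, 1]) g (1 - t) = \int[mu]_(t in `[0, 1]) g t.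
Proof.
move=> cg; rewrite [RHS]Rintegration_by_substitution_onem ?ler01 ?lexx//.
  by rewrite /unstable.onem subrr.
exact: continuous_subspaceT.
Qed.

End ReferenceSquare.

(** * Measures with a density *)

Section DensityMeasure.
Context {R : realType}.
Notation P := (measurableTypeR R * measurableTypeR R)%type.
Context (h : P -> \bar R).
Context (mh : measurable_fun setT h) (h0 : forall x, (0 <= h x)%E).

(** Registered as a measure so that uniqueness of measures can compare two densities. *)
Definition dens (A : set P) : \bar R := (\int[@leb2 R]_(z in A) h z)%E.

Let dens0 : dens set0 = 0%E.
Proof. by rewrite /dens integral_set0. Qed.

Let dens_ge0 A : (0 <= dens A)%E.
Proof. exact: integral_ge0. Qed.

Let dens_additive : semi_sigma_additive dens.
Proof. exact: semi_sigma_additive_nng_induced. Qed.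

HB.instance Definition _ := isMeasure.Build _ _ _ dens dens0 dens_ge0 dens_additive.
End DensityMeasure.

(** * The fundamental lemma of the calculus of variations *)

Section FundamentalLemma.
Context {R : realType}.
Notation mu := (@lebesgue_measure R).
Notation P := (measurableTypeR R * measurableTypeR R)%type.
Notation leb2 := (@leb2 R).

Definition rays (a c : R) : set P := `]a, +oo[%classic `*` `]c, +oo[%classic.

Lemma measure1_unique (m1 m2 : {measure set (measurableTypeR R) -> \bar R}) :
  (m1 setT < +oo)%E -> (forall a : R, m1 `]a, +oo[%classic = m2 `]a, +oo[%classic) ->
  forall A, measurable A -> m1 A = m2 A.
Proof.
move=> m1oo m12.
move=> A mA; have := @measure_unique _ R (measurableTypeR R) (@RGenOInfty.G R)
  (fun k : nat => `]- k%:R, +oo[%classic) (RGenOInfty.measurableE R) _ _ _ m1 m2 _ _ A mA.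
apply.
- move=> _ _ [x ->] [y ->]; exists (Num.max x y).
  apply/seteqP; split => z; rewrite /= !in_itv/= !andbT gt_max.
    by move=> [-> ->].
  by move=> /andP[].
- by move=> k; exists (- k%:R).
- apply/seteqP; split => // x _; exists (Num.truncn `|x|).+1 => //=.
  rewrite in_itv/= andbT ltrNl; apply: le_lt_trans (truncnS_gt _).
  by rewrite -normrN ler_norm.
- by move=> _ [x ->].
- by move=> k; apply: le_lt_trans m1oo; apply: le_measure; rewrite ?inE.
Qed.

(** One factor at a time: with the second factor a ray, both sides are measures in the first factor;
    with an arbitrary first factor, they are measures in the second one. *)
Lemma measure2_unique (m1 m2 : {measure set P -> \bar R}) :
  (m1 setT < +oo)%E -> (forall a c, m1 (rays a c) = m2 (rays a c)) ->
  forall A, measurable A -> m1 A = m2 A.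
Proof.
move=> m1oo m12.
have mf : measurable_fun setT (@fst (measurableTypeR R) (measurableTypeR R)) := measurable_fst.
have ms : measurable_fun setT (@snd (measurableTypeR R) (measurableTypeR R)) := measurable_snd.
have H1 (c : R) (A : set (measurableTypeR R)) : measurable A ->
    m1 (A `*` `]c, +oo[%classic) = m2 (A `*` `]c, +oo[%classic).
  have mB : measurable (setT `*` `]c, +oo[%classic : set P) by exact: measurableX.
  pose n1 : {measure set (measurableTypeR R) -> \bar R} :=
    pushforward (mrestr m1 mB) (@fst (measurableTypeR R) (measurableTypeR R)).
  pose n2 : {measure set (measurableTypeR R) -> \bar R} :=
    pushforward (mrestr m2 mB) (@fst (measurableTypeR R) (measurableTypeR R)).
  have E (X : set (measurableTypeR R)) : fst @^-1` X `&` (setT `*` `]c, +oo[%classic) = X `*` `]c, +oo[%classic.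
    by apply/seteqP; split => -[x y] /= [] // ? [].
  move=> mA; have : n1 mf A = n2 mf A.
    apply: measure1_unique => //.
      apply: le_lt_trans m1oo; apply: le_measure; rewrite ?inE//.
      by rewrite preimage_setT setTI.
    by move=> a; rewrite /n1 /n2 /= /pushforward /mrestr !E; exact: m12.
  by rewrite /n1 /n2 /= /pushforward /mrestr !E.
have H2 (A B : set (measurableTypeR R)) : measurable A -> measurable B ->
    m1 (A `*` B) = m2 (A `*` B).
  move=> mA.
  have mB : measurable (A `*` setT : set P) by exact: measurableX.
  pose n1 : {measure set (measurableTypeR R) -> \bar R} :=
    pushforward (mrestr m1 mB) (@snd (measurableTypeR R) (measurableTypeR R)).
  pose n2 : {measure set (measurableTypeR R) -> \bar R} :=
    pushforward (mrestr m2 mB) (@snd (measurableTypeR R) (measurableTypeR R)).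
  have E (X : set (measurableTypeR R)) : snd @^-1` X `&` (A `*` setT) = A `*` X.
    by apply/seteqP; split => -[x y] /= [] // ? [].
  move=> mX; have : n1 ms B = n2 ms B.
    apply: measure1_unique => //.
      apply: le_lt_trans m1oo; apply: le_measure; rewrite ?inE//.
      by rewrite preimage_setT setTI.
    by move=> a; rewrite /n1 /n2 /= /pushforward /mrestr !E; exact: H1.
  by rewrite /n1 /n2 /= /pushforward /mrestr !E.
move=> X mX; apply: (measure_unique [set A `*` B | A in measurable & B in measurable] (fun=> setT)).
- exact: measurable_prod_measurableType.
- move=> _ _ [X1 mX1 [X2 mX2 <-]] [Y1 mY1 [Y2 mY2 <-]].
  rewrite -setXI; exists (X1 `&` Y1); first exact: measurableI.
  by exists (X2 `&` Y2) => //; exact: measurableI.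
- by move=> _; exists setT => //; exists setT => //; rewrite setXTT.
- by rewrite bigcup_const//; exists 0%N.
- by move=> _ [X1 mX1 [X2 mX2 <-]]; exact: H2.
- by [].
- exact: mX.
Qed.

Lemma integrable_mul_bounded (g f : P -> R) :
  leb2.-integrable That (EFin \o g) -> measurable_fun That f ->
  (forall z, That z -> `|f z| <= 1) ->
  leb2.-integrable That (EFin \o (fun z => g z * f z)).
Proof.
move=> gi mf f1; have mT := @measurable_That R.
have mg : measurable_fun That g by move/integrableP : gi => [/measurable_EFinP].
apply: (le_integrable mT _ _ gi).
  by apply/measurable_EFinP; exact: measurable_funM.
move=> z Tz; rewrite /= lee_fin normrM.
by rewrite ler_piMr// f1.
Qed.

(** Dominated convergence with majorant [|g|]. *)
Lemma Rintegral_cvg0 (g : P -> R) (f_ : nat -> P -> R) (f : P -> R) :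
  leb2.-integrable That (EFin \o g) ->
  (forall n, measurable_fun That (f_ n)) ->
  (forall n z, That z -> `|f_ n z| <= 1) ->
  (forall z, That z -> f_ n z @[n --> \oo] --> f z) ->
  (forall n, \int[leb2]_(z in That) (g z * f_ n z) = 0) ->
  [/\ measurable_fun That f, leb2.-integrable That (EFin \o (fun z => g z * f z)) &
     \int[leb2]_(z in That) (g z * f z) = 0].
Proof.
move=> gi mf f1 ff I0; have mT := @measurable_That R.
have mg : measurable_fun That g by move/integrableP : gi => [/measurable_EFinP].
have mlim : measurable_fun That f by exact: (measurable_fun_cvg mf).
have [] := @dominated_convergence _ P R leb2 That mT
  (fun n z => (g z * f_ n z)%:E) (fun z => (g z * f z)%:E) (fun z => `|g z|%:E) _ _ _ _ _.
- by move=> n; apply/measurable_EFinP; apply: measurable_funM; [exact: mg|exact: mf].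
- by apply/measurable_EFinP; exact: measurable_funM.
- apply: aeW => z Tz; apply/cvg_EFin; first exact: nearW.
  by apply: cvgM; [exact: cvg_cst|exact: ff].
- exact: integrable_norm.
- by apply: aeW => z n Tz; rewrite lee_fin normrM ler_piMr// f1.
move=> fi _ cv; split => //.
rewrite /Rintegral; suff -> : (\int[leb2]_(z in That) (g z * f z)%:E = 0)%E by [].
apply/esym; apply: (cvg_unique _ _ cv) => //.
rewrite (_ : (fun n => _) = cst 0%E); first exact: cvg_cst.
apply/funext => n; rewrite -[LHS]fineK.
  by rewrite -/(Rintegral _ _ _) I0.
by apply: integrable_fin_num => //; exact: (integrable_mul_bounded gi (mf n) (f1 n)).
Qed.

(** A polynomial vanishing at [0] that tends on [0,1] to the indicator of [0 < t]: applied to a bump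
    it keeps the smoothness and does not enlarge the support. *)
Definition steep (n : nat) (t : R) : R := 1 - (1 - t) ^+ n.

Lemma steep_itv n (t : R) : 0 <= t <= 1 -> 0 <= steep n t <= 1.
Proof.
move=> /andP[t0 t1]; have h0 : 0 <= 1 - t by rewrite subr_ge0.
have h1 : 1 - t <= 1 by rewrite lerBlDr lerDl.
rewrite /steep subr_ge0 exprn_ile1//=.
by rewrite lerBlDr lerDl exprn_ge0.
Qed.

Lemma steep_cvg (t : R) : 0 <= t <= 1 -> steep n t @[n --> \oo] --> ((0 < t)%R%:R : R).
Proof.
move=> /andP[t0 t1]; case: ltgtP t0 => // [t0|<-] _.
  rewrite -[X in _ --> X]subr0; apply: cvgB; first exact: cvg_cst.
  by apply: cvg_expr; rewrite ger0_norm ?subr_ge0// ltrBlDr ltrDl.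
rewrite /steep subr0; rewrite (_ : (fun n => _) = cst (0 : R)); first exact: cvg_cst.
by apply/funext => n; rewrite expr1n subrr.
Qed.

Definition bump2 (a b c d : R) (z : R * R) : R := bump a b z.1 * bump c d z.2.

Lemma flat1_le1 (x : R) : flat 1 x <= 1.
Proof.
rewrite /flat; case: ifPn => // x0.
by rewrite hornerC mul1r expR_le1 oppr_le0 invr_ge0 ltW.
Qed.

Lemma bump_itv (a b x : R) : 0 <= bump a b x <= 1.
Proof. by rewrite bump_ge0 /bump mulr_ile1 ?flat1_ge0 ?flat1_le1. Qed.

Lemma bump2_itv (a b c d : R) z : 0 <= bump2 a b c d z <= 1.
Proof.
rewrite /bump2; have /andP[h1 h2] := bump_itv a b z.1; have /andP[h3 h4] := bump_itv c d z.2.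
by rewrite mulr_ge0//= mulr_ile1.
Qed.

Lemma bump_gt0E (a b x : R) : (0 < bump a b x) = (a < x < b).
Proof.
have [h|h] := boolP (a < x < b); first by rewrite bump_gt0.
by rewrite bump_eq0// ltxx.
Qed.

Lemma bump2_gt0 (a b c d : R) z : (0 < bump2 a b c d z) = (a < z.1 < b) && (c < z.2 < d).
Proof.
rewrite /bump2 -!bump_gt0E; have := bump_ge0 a b z.1; have := bump_ge0 c d z.2.
rewrite !le_eqVlt => /orP[/eqP <-|h2] /orP[/eqP <-|h1]; rewrite ?mul0r ?mulr0 ?ltxx ?andbF//.
by rewrite mulr_gt0// h1 h2.
Qed.

Lemma continuous_bump2 (a b c d : R) : continuous (bump2 a b c d).
Proof.
move=> z; apply: cvgM.
  by apply: (@continuous_comp _ _ _ fst (bump a b)); [exact: cvg_fst|exact: continuous_bump].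
by apply: (@continuous_comp _ _ _ snd (bump c d)); [exact: cvg_snd|exact: continuous_bump].
Qed.

Lemma continuous_steep_bump2 (a b c d : R) n :
  continuous (fun z => steep n (bump2 a b c d z)).
Proof.
move=> z; apply: cvgB; first exact: cvg_cst.
apply: (@continuous_comp _ _ _ (fun z => 1 - bump2 a b c d z) (fun x : R => x ^+ n)).
  by apply: cvgB; [exact: cvg_cst|exact: continuous_bump2].
exact: exprn_continuous.
Qed.

(* The functions [steep n (bump2 a b c d)] tend to the indicator of a box, so the
   measures with densities [g^+] and [g^-] agree on boxes. *)
Lemma fundamental_lemma (g : P -> R) : leb2.-integrable That (EFin \o g) ->
  (forall a b c d n, 0 < a -> b < 1 -> 0 < c -> d < 1 ->
    \int[leb2]_(z in That) (g z * steep n (bump2 a b c d z)) = 0) ->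
  {ae leb2, forall z, That z -> g z = 0}.
Proof.
move=> gi H; have mT := @measurable_That R; have mTo := @measurable_Tho R.
have H1 a b c d : 0 < a -> b < 1 -> 0 < c -> d < 1 ->
    let f z := ((a < z.1 < b) && (c < z.2 < d))%:R : R in
    measurable_fun (That : set P) (f : P -> R) /\ \int[leb2]_(z in That) (g z * f z) = 0.
  move=> a0 b1 c0 d1 f.
  have [||||mf _ I0] := @Rintegral_cvg0 g (fun n z => steep n (bump2 a b c d z)) f gi.
  - by move=> n; apply: measurable_funTS; apply: continuous_measurable2; exact: continuous_steep_bump2.
  - by move=> n z _; have /andP[h1 h2] := steep_itv n (bump2_itv a b c d z); rewrite ger0_norm.
  - by move=> z _; rewrite /f -bump2_gt0; apply: steep_cvg; exact: bump2_itv.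
  - by move=> n; exact: H.
  by [].
have H2 a c : let f z := (rays a c `&` Tho) z in
    \int[leb2]_(z in That) (g z * (z \in rays a c `&` Tho)%:R) = 0.
  (* The margin [e k] keeps the boxes off the boundary of the square, as [H1] requires, and tends to
     zero. *)
  move=> _; pose e (k : nat) : R := k.+2%:R^-1.
  have e0 k : 0 < e k by rewrite invr_gt0.
  have near_e (x : R) : 0 < x -> \forall k \near \oo, e k < x.
    move=> x0; near=> k; rewrite /e -[x]invrK ltf_pV2 ?posrE ?invr_gt0//.
    apply: (@lt_trans _ _ k%:R); last by rewrite ltr_nat; lia.
    by near: k; exact: nbhs_infty_gtr.
  pose f k (z : P) := ((Num.max a (e k) < z.1 < 1 - e k) && (Num.max c (e k) < z.2 < 1 - e k))%:R : R.
  have K k := H1 (Num.max a (e k)) (1 - e k) (Num.max c (e k)) (1 - e k).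
  have {}K k : measurable_fun (That : set P) (f k) /\ \int[leb2]_(z in That) (g z * f k z) = 0.
    by apply: K; rewrite ?lt_max ?e0 ?orbT// ltrBlDr ltrDl.
  have [||||_ _ I0] := @Rintegral_cvg0 g f (fun z => (z \in rays a c `&` Tho)%:R) gi.
  - by move=> k; case: (K k).
  - by move=> k z _; rewrite /f; case: (_ && _); rewrite ?normr1 ?normr0.
  - move=> z Tz; apply: cvg_near_cst.
    have [/set_mem[[/=]]|] := boolP (z \in _).
      rewrite !in_itv/= !andbT => az cz /ThoP[z1 z2].
      near=> k; rewrite /f; have -> // : (Num.max a (e k) < z.1 < 1 - e k) && (Num.max c (e k) < z.2 < 1 - e k).
      have h1 : e k < z.1 by near: k; apply: near_e; case/andP: z1.
      have h2 : e k < z.2 by near: k; apply: near_e; case/andP: z2.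
      have h3 : e k < 1 - z.1 by near: k; apply: near_e; rewrite subr_gt0; case/andP: z1.
      have h4 : e k < 1 - z.2 by near: k; apply: near_e; rewrite subr_gt0; case/andP: z2.
      by rewrite !gt_max az cz h1 h2 ltrBrDr addrC -ltrBrDr h3 ltrBrDr addrC -ltrBrDr h4.
    rewrite notin_setE => nz; apply: nearW => k; rewrite /f.
    case E : (_ && _) => //; move: E; rewrite !gt_max => /andP[/andP[/andP[h1 h2] h3] /andP[/andP[h4 h5] h6]].
    exfalso; apply: nz; have := e0 k => ?; split; first by split; rewrite /= in_itv/= andbT.
    by apply/ThoP; lra.
  - by move=> k; case: (K k).
  by [].
(* Extension by zero puts the positive and the negative part on the whole plane. *)
pose G := ((EFin \o g) \_ Tho : P -> \bar R).
have Gi : leb2.-integrable setT G.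
  case: (integrable_mkcond (mu := leb2) (EFin \o g) mTo) => + _; apply.
  by apply: (integrableS mT) => //; exact: Tho_That.
have mG : measurable_fun setT G by case/integrableP : Gi.
pose m1' : {measure set P -> \bar R} := dens (G^\+)%E.
pose m1 := m1' (measurable_funepos mG) (funepos_ge0 G).
pose m2' : {measure set P -> \bar R} := dens (G^\-)%E.
pose m2 := m2' (measurable_funeneg mG) (funeneg_ge0 G).
have m12 : forall A, measurable A -> m1 A = m2 A.
  apply: measure2_unique.
    by rewrite /m1 /= /dens; exact: integral_funepos_lt_pinfty.
  move=> a c; have mr : measurable (rays a c) by exact: measurableX.
  have Gir : leb2.-integrable (rays a c) G by exact: integrableS Gi.
  have := H2 a c; rewrite /Rintegral /=.
  have -> : (\int[leb2]_(z in That) (g z * (z \in rays a c `&` Tho)%:R)%:E =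
             \int[leb2]_(z in rays a c) G z)%E.
    rewrite [LHS]integral_mkcond [RHS]integral_mkcond; apply: eq_integral => z _.
    rewrite /G /patch [z \in rays a c `&` Tho]in_setI; case: ifPn => [Tz|nTz].
      by case: (z \in rays a c); case: (z \in Tho); rewrite ?mulr1 ?mulr0.
    case: ifPn => // _; case: ifPn => // /set_mem /Tho_That Tz.
    by move: nTz; rewrite notin_setE.
  rewrite integralE fineB; first last.
  - exact: integrable_neg_fin_num.
  - exact: integrable_pos_fin_num.
  move=> /eqP; rewrite subr_eq0 => /eqP h.
  rewrite /m1 /m2 /= /dens -[LHS]fineK ?h ?fineK//.
  + exact: integrable_neg_fin_num.
  + exact: integrable_pos_fin_num.
have G0 : ae_eq leb2 setT G (cst 0%E).
  apply: integral_ae_eq => // E _ mE; rewrite integral0 integralE.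
  rewrite -[X in (X - _)%E]/(m1 E) -[X in (_ - X)%E]/(m2 E) (m12 _ mE).
  rewrite subee//; rewrite /m2 /= /dens; apply: integrable_neg_fin_num => //.
  exact: integrableS Gi.
have N1 : leb2.-negligible (~` [set z | setT z -> G z = cst 0%E z]) by exact: G0.
have N2 := negligibleU N1 (negligible_That_Tho (R := R)).
apply: negligibleS N2 => z /= nz.
have [Toz|nToz] := pselect (Tho z); [left|right].
  move=> h; apply: nz => _; have := h I; rewrite /G /patch mem_set// => -[].
  exact.
by split=> //; apply: contrapT => nTz; apply: nz.
Unshelve. all: by end_near. Qed.

End FundamentalLemma.

(** * Functions with given partial derivatives *)

Section PartialDerivatives.
Context {R : realType}.
Notation mu := (@lebesgue_measure R).
Notation leb2 := (@leb2 R).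
Implicit Types (f g : R * R -> R).

(** All directional derivatives at once, so that affine substitutions need no Jacobian matrices. *)
Definition pd f f1 f2 : Prop := (forall p, differentiable f p) /\
  forall p v, 'D_v f p = v.1 * f1 p + v.2 * f2 p.

Lemma diff_pd f : (forall p, differentiable f p) -> pd f ('D_(1, 0) f) ('D_(0, 1) f).
Proof.
move=> df; split => // p v; rewrite !deriveE//.
have -> : v = v.1 *: (1, 0) + v.2 *: (0, 1) :> R * R.
  by apply: pairP => /=; rewrite !scaleRE; ring.
by rewrite linearD !linearZ /= !scaleRE mulr1 mulr0 addr0 mulr0 mulr1 add0r.
Qed.

Lemma pd_ext f f1 f2 g1 g2 : pd f f1 f2 -> (forall p, f1 p = g1 p) -> (forall p, f2 p = g2 p) ->
  pd f g1 g2.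
Proof. by move=> [df Df] h1 h2; split => // p v; rewrite Df h1 h2. Qed.

Lemma pd_cst (k : R) : pd (fun=> k) (fun=> 0) (fun=> 0).
Proof.
split=> [p|p v]; first exact: differentiable_cst.
by rewrite (derive_cst k) !mulr0 addr0.
Qed.

Lemma pd_linf (a b c : R) : pd (linf a b c) (fun=> a) (fun=> b).
Proof.
split=> [p|p v]; have dl := is_diff_linf a b c p; first by case: dl.
rewrite deriveE; last by case: dl.
have -> : 'd (linf a b c) p = (fun v => a * v.1 + b * v.2) :> (_ -> _) by case: dl.
by rewrite mulrC [_ * b]mulrC.
Qed.

Lemma pdD f f1 f2 g g1 g2 : pd f f1 f2 -> pd g g1 g2 ->
  pd (fun p => f p + g p) (fun p => f1 p + g1 p) (fun p => f2 p + g2 p).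
Proof.
move=> [df Df] [dg Dg]; split=> [p|p v]; first exact: differentiableD.
rewrite (@deriveD _ _ _ f g); [|exact: diff_derivable..].
by rewrite Df Dg; ring.
Qed.

Lemma pdM f f1 f2 g g1 g2 : pd f f1 f2 -> pd g g1 g2 ->
  pd (fun p => f p * g p) (fun p => f1 p * g p + f p * g1 p) (fun p => f2 p * g p + f p * g2 p).
Proof.
move=> [df Df] [dg Dg]; split=> [p|p v]; first exact: differentiableM.
rewrite (@deriveM _ _ f g); [|exact: diff_derivable..].
by rewrite Df Dg !scaleRE; ring.
Qed.

Lemma aff_linf (a b c z : R * R) :
  aff a b c z = (linf b.1 c.1 a.1 z, linf b.2 c.2 a.2 z).
Proof. by apply: pairP; rewrite /aff /linf /= !scaleRE; ring. Qed.

Lemma pd_aff f f1 f2 (a b c : R * R) : pd f f1 f2 ->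
  pd (fun z => f (aff a b c z))
     (fun z => b.1 * f1 (aff a b c z) + b.2 * f2 (aff a b c z))
     (fun z => c.1 * f1 (aff a b c z) + c.2 * f2 (aff a b c z)).
Proof.
move=> [df Df].
have da z : is_diff z (aff a b c) (fun v => (b.1 * v.1 + c.1 * v.2, b.2 * v.1 + c.2 * v.2)).
  have -> : aff a b c = (fun z => (linf b.1 c.1 a.1 z, linf b.2 c.2 a.2 z)).
    by apply/funext => w; exact: aff_linf.
  by apply: is_diff_pair; exact: is_diff_linf.
split=> [z|z v].
  by apply: (@differentiable_comp _ _ _ _ (aff a b c) f) => //; case: (da z).
rewrite deriveE; last first.
  by apply: (@differentiable_comp _ _ _ _ (aff a b c) f) => //; case: (da z).
rewrite (@diff_comp _ _ _ _ (aff a b c) f)//.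
have -> : 'd (aff a b c) z = (fun v => (b.1 * v.1 + c.1 * v.2, b.2 * v.1 + c.2 * v.2)) :> (_ -> _).
  by case: (da z).
by rewrite /= -deriveE// Df/=; ring.
Qed.

Lemma pd_C1 f f1 f2 : pd f f1 f2 -> continuous f1 -> continuous f2 -> C1 f.
Proof.
move=> [df Df] c1 c2; split => // v p.
have -> : 'D_v f = (fun p => v.1 * f1 p + v.2 * f2 p) by apply/funext => q; rewrite Df.
by apply: cvgD; apply: cvgM; [exact: cvg_cst|exact: c1|exact: cvg_cst|exact: c2].
Qed.

Lemma pd_continuous f f1 f2 : pd f f1 f2 -> continuous f.
Proof. by move=> [df _] p; exact: differentiable_continuous. Qed.

Lemma continuous_linf (a b c : R) : continuous (linf a b c).
Proof. exact: pd_continuous (pd_linf a b c). Qed.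

Lemma continuous_affcomp f (a b c : R * R) : continuous f -> continuous (fun z => f (aff a b c z)).
Proof.
by move=> cf z; apply: (@continuous_comp _ _ _ (aff a b c) f); [exact: continuous_aff|exact: cf].
Qed.

Lemma continuousMl (k : R) f : continuous f -> continuous (fun z => k * f z).
Proof. by move=> cf z; apply: cvgM; [exact: cvg_cst|exact: cf]. Qed.

Lemma continuousDf f g : continuous f -> continuous g -> continuous (fun z => f z + g z).
Proof. by move=> cf cg z; apply: cvgD; [exact: cf|exact: cg]. Qed.

Lemma continuousMf f g : continuous f -> continuous g -> continuous (fun z => f z * g z).
Proof. by move=> cf cg z; apply: cvgM; [exact: cf|exact: cg]. Qed.

Lemma RintegralThatD f g : continuous f -> continuous g ->
  \int[leb2]_(z in That) (f z + g z) = \int[leb2]_(z in That) f z + \int[leb2]_(z in That) g z.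
Proof.
by move=> cf cg; rewrite RintegralD//; [exact: measurable_That|exact: continuous_integrable_That..].
Qed.

Lemma RintegralThatZ (k : R) f : continuous f ->
  \int[leb2]_(z in That) (k * f z) = k * \int[leb2]_(z in That) f z.
Proof.
by move=> cf; rewrite RintegralZl//; [exact: measurable_That|exact: continuous_integrable_That].
Qed.

(** * The divergence theorem on a square *)

(** [edge_integral] without the length of the edge. *)
Definition edge_mean (A B : R * R) f : R :=
  \int[mu]_(t in `[0, 1]) f (A + t *: (B - A)).

Lemma edge_meanE A B f : edge_mean A B f = \int[mu]_(t in `[0, 1]) f (th A B (t, 0)).
Proof.
apply: eq_Rintegral => t _; congr f; rewrite thE; apply: pairP => /=; rewrite scaleRE; ring.
Qed.

Lemma edge_meanC A B f : continuous f -> edge_mean B A f = edge_mean A B f.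
Proof.
move=> cf; rewrite /edge_mean.
rewrite -[RHS](Rintegral01_onem (g := fun t => f (A + t *: (B - A)))).
  by apply: eq_Rintegral => t _; congr f; apply: pairP => /=; rewrite !scaleRE; ring.
suff : continuous (f \o (fun t : R => A + t *: (B - A))) by [].
move=> t; apply: continuous_comp; last exact: cf.
by apply: cvgD; [exact: cvg_cst|apply: cvgZr_tmp; exact: cvg_id].
Qed.

(** The weights are the components of the outward normal times the length of the edge. Green's
    formulas for the pulled back function form a linear system with determinant [sqn A B] for the
    two integrals. *)
Lemma green_square A B f f1 f2 : A <> B -> pd f f1 f2 -> continuous f1 -> continuous f2 ->
  sqn A B * (\int[leb2]_(z in That) f1 (th A B z)) =
    \sum_k (vtx A B (ordS k) - vtx A B k).2 * edge_mean (vtx A B k) (vtx A B (ordS k)) f /\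
  sqn A B * (\int[leb2]_(z in That) f2 (th A B z)) =
    \sum_k - (vtx A B (ordS k) - vtx A B k).1 * edge_mean (vtx A B k) (vtx A B (ordS k)) f.
Proof.
move=> AB pf c1 c2; have cf := pd_continuous pf.
set d := B - A.
have pg := pd_aff A d (perp d) pf.
set g1 := (X in pd _ X _) in pg; set g2 := (X in pd _ _ X) in pg.
have cth (h : R * R -> R) : continuous h -> continuous (fun z => h (th A B z)).
  by move=> ch; exact: continuous_affcomp.
have cg1 : continuous g1 by apply: continuousDf; apply: continuousMl; exact: cth.
have cg2 : continuous g2 by apply: continuousDf; apply: continuousMl; exact: cth.
have Cg := pd_C1 pg cg1 cg2.
have Gx := green_x Cg; have Gy := green_y Cg.
rewrite (@eq_Rintegral _ _ _ leb2 That g1) in Gx; last first.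
  by move=> z _; rewrite (pg.2 z (1, 0)) mul1r mul0r addr0.
rewrite (@eq_Rintegral _ _ _ leb2 That g2) in Gy; last first.
  by move=> z _; rewrite (pg.2 z (0, 1)) mul1r mul0r add0r.
pose I1 := \int[leb2]_(z in That) f1 (th A B z).
pose I2 := \int[leb2]_(z in That) f2 (th A B z).
have G1 : \int[leb2]_(z in That) g1 z = d.1 * I1 + d.2 * I2.
  by rewrite RintegralThatD ?RintegralThatZ//; do ?apply: continuousMl; exact: cth.
have G2 : \int[leb2]_(z in That) g2 z = - d.2 * I1 + d.1 * I2.
  by rewrite RintegralThatD ?RintegralThatZ//; do ?apply: continuousMl; exact: cth.
have E0 : edge_mean (vtx A B ord0) (vtx A B (ordS ord0)) f =
    \int[mu]_(x in `[0, 1]) f (th A B (x, 0)).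
  by rewrite edge_meanE; apply: eq_Rintegral => t _; rewrite th_rotz.
have E1 : edge_mean (vtx A B (ordS ord0)) (vtx A B (ordS (ordS ord0))) f =
    \int[mu]_(x in `[0, 1]) f (th A B (1, x)).
  by rewrite edge_meanE; apply: eq_Rintegral => t _; rewrite th_rotz /rotz /= subr0.
have E2 : edge_mean (vtx A B (ordS (ordS ord0))) (vtx A B (ordS (ordS (ordS ord0)))) f =
    \int[mu]_(x in `[0, 1]) f (th A B (x, 1)).
  rewrite (edge_meanC _ _ cf) edge_meanE; apply: eq_Rintegral => t _; congr (f _).
  by rewrite /vtx !thE /cz /=; apply: pairP => /=; ring.
have E3 : edge_mean (vtx A B (ordS (ordS (ordS ord0)))) (vtx A B ord0) f =
    \int[mu]_(x in `[0, 1]) f (th A B (0, x)).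
  rewrite (edge_meanC _ _ cf) edge_meanE; apply: eq_Rintegral => t _; congr (f _).
  by rewrite /vtx !thE /cz /=; apply: pairP => /=; ring.
rewrite !sum4 !ordS4 E0 E1 E2 E3.
have -> : (vtx A B (ordS ord0) - vtx A B ord0) = d.
  by rewrite vtx0 vtx1.
have -> : vtx A B (ordS (ordS ord0)) - vtx A B (ordS ord0) = perp d.
  by rewrite /vtx !thE /cz /d; apply: pairP => /=; ring.
have -> : vtx A B (ordS (ordS (ordS ord0))) - vtx A B (ordS (ordS ord0)) = - d.
  by rewrite /vtx !thE /cz /d; apply: pairP => /=; ring.
have -> : vtx A B ord0 - vtx A B (ordS (ordS (ordS ord0))) = - perp d.
  by rewrite /vtx !thE /cz /d; apply: pairP => /=; ring.
have Hx : d.1 * I1 + d.2 * I2 = \int[mu]_(y in `[0, 1]) f (th A B (1, y)) -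
   \int[mu]_(y in `[0, 1]) f (th A B (0, y)) by rewrite -G1 Gx.
have Hy : - d.2 * I1 + d.1 * I2 = \int[mu]_(y in `[0, 1]) f (th A B (y, 1)) -
   \int[mu]_(y in `[0, 1]) f (th A B (y, 0)) by rewrite -G2 Gy.
have S : sqn A B = d.1 ^+ 2 + d.2 ^+ 2 by [].
rewrite -/I1 -/I2 S; move: Hx Hy; clearbody I1 I2; clear -I1 I2.
move: (Rintegral _ _ _) (Rintegral _ _ _) (Rintegral _ _ _) (Rintegral _ _ _) => x1 x2 x3 x4.
rewrite /perp /=; move: (B.1 - A.1) (B.2 - A.2) I1 I2 => d1 d2 J1 J2 Hx Hy.
split.
- have -> : (d1 ^+ 2 + d2 ^+ 2) * J1 = d1 * (d1 * J1 + d2 * J2) - d2 * (- d2 * J1 + d1 * J2) by ring.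
  by rewrite Hx Hy; ring.
- have -> : (d1 ^+ 2 + d2 ^+ 2) * J2 = d2 * (d1 * J1 + d2 * J2) + d1 * (- d2 * J1 + d1 * J2) by ring.
  by rewrite Hx Hy; ring.
Qed.

End PartialDerivatives.

(** * Local spaces and their degrees of freedom *)

Section LocalSpaces.
Context {R : realType}.
Notation mu := (@lebesgue_measure R).
Notation leb2 := (@leb2 R).
Implicit Types (A B z : R * R) (c : R * R * R) (m u : 'I_4 -> R).

(* In the frame of a square, the local space consists of the fields
   [p + s (x - 1/2)] along the first side and [q - s (y - 1/2)] along the second
   one; the coefficients [c = (p, q, s)] are orthogonal in [L^2]. *)
Definition fld1 c z : R := c.1.1 + c.2 * (z.1 - 2^-1).
Definition fld2 c z : R := c.1.2 - c.2 * (z.2 - 2^-1).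
Definition fld A B c (i : 'I_2) z : R :=
  (coord2 i (B - A) * fld1 c z + coord2 i (perp (B - A)) * fld2 c z) / sqn A B.

(** The [L^2] product on the square: 1/6 is the integral of [(x - 1/2)^2 + (y - 1/2)^2], and the
    area cancels the scaling of [fld]. *)
Definition ip c c' : R := c.1.1 * c'.1.1 + c.1.2 * c'.1.2 + c.2 * c'.2 / 6.

(* Outward flux through the edge [k]. *)
Definition flux c (k : 'I_4) : R := nth 0
  [:: - (c.1.2 + c.2 / 2); c.1.1 + c.2 / 2; c.1.2 - c.2 / 2; - (c.1.1 - c.2 / 2)] k.

(** Coefficients of the gradient of [qrot m]. The factor 3 arises because the quadratic term of
    coefficient [s / 2] has mean [s / 12] on one pair of opposite edges and [- s / 12] on the
    other. *)
Definition gradc m : R * R * R :=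
  (m (ordS ord0) - m (ordS (ordS (ordS ord0))), m (ordS (ordS ord0)) - m ord0,
   3 * (m (ordS ord0) + m (ordS (ordS (ordS ord0))) - m ord0 - m (ordS (ordS ord0)))).

(* The element of [Qrot] with mean [m k] on the edge [k]. *)
Definition qrot m z : R :=
  (m ord0 + m (ordS ord0) + m (ordS (ordS ord0)) + m (ordS (ordS (ordS ord0)))) / 4
  + (gradc m).1.1 * (z.1 - 2^-1) + (gradc m).1.2 * (z.2 - 2^-1)
  + (gradc m).2 / 2 * ((z.1 - 2^-1) ^+ 2 - (z.2 - 2^-1) ^+ 2).

Definition qbil u z : R :=
  u ord0 * ((1 - z.1) * (1 - z.2)) + u (ordS ord0) * (z.1 * (1 - z.2)) +
  u (ordS (ordS ord0)) * (z.1 * z.2) + u (ordS (ordS (ordS ord0))) * ((1 - z.1) * z.2).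

(** The system [flux c k = f k] solved for [c]; it is solvable because the increments around a
    square add up to zero. *)
Definition curlc u : R * R * R :=
  let f k := u (ordS k) - u k in
  ((f (ordS ord0) - f (ordS (ordS (ordS ord0)))) / 2, (f (ordS (ordS ord0)) - f ord0) / 2,
   f (ordS ord0) + f (ordS (ordS (ordS ord0)))).

(** Green's formula in coefficients: the local fields are divergence free with constant normal
    component on each edge, so only edge means of the potential survive. *)
Lemma ip_gradc c m : ip c (gradc m) = \sum_k flux c k * m k.
Proof. by rewrite sum4 /ip /flux /gradc /=; field. Qed.

Lemma flux_sum0 c : \sum_k flux c k = 0.
Proof. by rewrite sum4 /flux /=; field. Qed.

Lemma flux_curlc u k : flux (curlc u) k = u (ordS k) - u k.
Proof.
by elim/I4_ind: k; rewrite /flux /curlc /= !ordS4; field.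
Qed.

Lemma curlc_flux c u : (forall k, u (ordS k) - u k = flux c k) -> curlc u = c.
Proof.
move=> h; rewrite /curlc !h /flux /=; case: c {h} => [[p q] s] /=.
by congr (_, _, _); field.
Qed.

Lemma continuous_fld A B c i : continuous (fld A B c i).
Proof.
have c1 : continuous (fld1 c).
  rewrite (_ : fld1 c = linf c.2 0 (c.1.1 - c.2 / 2)); first exact: continuous_linf.
  by apply/funext => z; rewrite /fld1 /linf; field.
have c2 : continuous (fld2 c).
  rewrite (_ : fld2 c = linf 0 (- c.2) (c.1.2 + c.2 / 2)); first exact: continuous_linf.
  by apply/funext => z; rewrite /fld2 /linf; field.
by move=> z; apply: cvgM; [apply: continuousDf; exact: continuousMl|exact: cvg_cst].
Qed.

Lemma loc_linf A B p : A <> B -> loc A B p =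
  (linf ((B.1 - A.1) / sqn A B) ((B.2 - A.2) / sqn A B)
     (- (A.1 * (B.1 - A.1) + A.2 * (B.2 - A.2)) / sqn A B) p,
   linf (- (B.2 - A.2) / sqn A B) ((B.1 - A.1) / sqn A B)
     (- (A.2 * (B.1 - A.1) - A.1 * (B.2 - A.2)) / sqn A B) p).
Proof.
move=> AB; have h := sqn_neq0 AB; rewrite locE; apply: pairP; rewrite /linf /=; by field.
Qed.

Lemma pd_loc A B g g1 g2 : A <> B -> pd g g1 g2 ->
  pd (fun p => g (loc A B p))
     (fun p => ((B.1 - A.1) * g1 (loc A B p) - (B.2 - A.2) * g2 (loc A B p)) / sqn A B)
     (fun p => ((B.2 - A.2) * g1 (loc A B p) + (B.1 - A.1) * g2 (loc A B p)) / sqn A B).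
Proof.
move=> AB pg; have h := sqn_neq0 AB.
pose a := (- (A.1 * (B.1 - A.1) + A.2 * (B.2 - A.2)) / sqn A B,
           - (A.2 * (B.1 - A.1) - A.1 * (B.2 - A.2)) / sqn A B).
pose b := ((B.1 - A.1) / sqn A B, - (B.2 - A.2) / sqn A B).
pose c := ((B.2 - A.2) / sqn A B, (B.1 - A.1) / sqn A B).
have E : loc A B = aff a b c by apply/funext => p; rewrite loc_linf// aff_linf.
rewrite E; apply: (pd_ext (pd_aff a b c pg)) => p /=; by field.
Qed.

Lemma pd_qrot m : pd (qrot m) (fld1 (gradc m)) (fld2 (gradc m)).
Proof.
pose x := @linf R 1 0 (- 2^-1); pose y := @linf R 0 1 (- 2^-1).
have px := pd_linf (1 : R) 0 (- 2^-1); have py := pd_linf (0 : R) 1 (- 2^-1).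
set k := (m ord0 + m (ordS ord0) + m (ordS (ordS ord0)) + m (ordS (ordS (ordS ord0)))) / 4.
have := pdD (pdD (pdD (pd_cst k) (pdM (pd_cst (gradc m).1.1) px)) (pdM (pd_cst (gradc m).1.2) py))
  (pdM (pd_cst ((gradc m).2 / 2)) (pdD (pdM px px) (pdM (pd_cst (-1)) (pdM py py)))).
have -> : qrot m = (fun p : R * R => k + (gradc m).1.1 * linf 1 0 (- 2^-1) p + (gradc m).1.2 * linf 0 1 (- 2^-1) p +
   (gradc m).2 / 2 *
   (linf 1 0 (- 2^-1) p * linf 1 0 (- 2^-1) p + -1 * (linf 0 1 (- 2^-1) p * linf 0 1 (- 2^-1) p))).
  by apply/funext => z; rewrite /qrot /linf -/k; ring.
by move=> h; apply: (pd_ext h) => p; rewrite /fld1 /fld2 /linf; field.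
Qed.

Lemma pd_qbil u : pd (qbil u)
  (fun z => (u (ordS ord0) - u ord0) * (1 - z.2) + (u (ordS (ordS ord0)) - u (ordS (ordS (ordS ord0)))) * z.2)
  (fun z => (u (ordS (ordS (ordS ord0))) - u ord0) * (1 - z.1) + (u (ordS (ordS ord0)) - u (ordS ord0)) * z.1).
Proof.
have px := pd_linf (1 : R) 0 0; have py := pd_linf (0 : R) 1 0.
have px' := pd_linf (- 1 : R) 0 1; have py' := pd_linf (0 : R) (- 1) 1.
have := pdD (pdD (pdD (pdM (pd_cst (u ord0)) (pdM px' py')) (pdM (pd_cst (u (ordS ord0))) (pdM px py')))
   (pdM (pd_cst (u (ordS (ordS ord0)))) (pdM px py)))
   (pdM (pd_cst (u (ordS (ordS (ordS ord0))))) (pdM px' py)).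
set f := (X in pd X _ _); have -> : f = qbil u.
  by apply/funext => z; rewrite /f /qbil /linf; ring.
by move=> h; apply: (pd_ext h) => p; rewrite /linf; ring.
Qed.

Lemma pd_qrot_loc A B m : A <> B -> pd (fun p => qrot m (loc A B p))
  (fun p => fld A B (gradc m) 0 (loc A B p)) (fun p => fld A B (gradc m) 1 (loc A B p)).
Proof.
move=> AB; apply: (pd_ext (pd_loc AB (pd_qrot m))) => p; rewrite /fld /coord2 /=; congr (_ / _).
  by rewrite mulNr.
Qed.

(** [curlc u] describes the curl, which is the gradient turned by a right angle; hence the exchanged
    components and the sign. *)
Lemma pd_qbil_loc A B u : A <> B -> pd (fun p => qbil u (loc A B p))
  (fun p => - fld A B (curlc u) 1 (loc A B p)) (fun p => fld A B (curlc u) 0 (loc A B p)).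
Proof.
move=> AB; have := pd_loc AB (pd_qbil u); rewrite /fld; have := sqn_neq0 AB.
move: (sqn A B) => h hn D; apply: (pd_ext D) => p; move: (loc A B p) => z.
  by rewrite /fld1 /fld2 /curlc /coord2 /= !ordS4; field.
by rewrite /fld1 /fld2 /curlc /coord2 /= !ordS4; field.
Qed.

Lemma continuous_qrot_loc A B m : A <> B -> continuous (fun p => qrot m (loc A B p)).
Proof. by move=> AB; exact: pd_continuous (pd_qrot_loc m AB). Qed.

Lemma continuous_qbil_loc A B u : A <> B -> continuous (fun p => qbil u (loc A B p)).
Proof. by move=> AB; exact: pd_continuous (pd_qbil_loc u AB). Qed.

Lemma Rintegral_quadratic (c0 c1 c2 : R) :
  \int[mu]_(t in `[0, 1]) (c0 + c1 * t + c2 * t ^+ 2) = c0 + c1 / 2 + c2 / 3.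
Proof.
pose P : {poly R} := c0 *: 'X + (c1 / 2) *: 'X^2 + (c2 / 3) *: 'X^3.
have dP (t : R) : is_derive t (1 : R) (horner P) (horner (c0%:P + c1 *: 'X + c2 *: 'X^2) t).
  have := is_derive_poly P t; congr (is_derive _ _ _ _).
  rewrite /P !derivD !derivZ derivX !derivXn !hornerE /=.
  by rewrite ?hornerMn ?hornerXn; field.
have -> : \int[mu]_(t in `[0, 1]) (c0 + c1 * t + c2 * t ^+ 2) =
    \int[mu]_(t in `[0, 1]) (c0%:P + c1 *: 'X + c2 *: 'X^2).[t].
  by apply: eq_Rintegral => t _; rewrite !(hornerD, hornerZ, hornerX, hornerXn, hornerC).
rewrite (Rintegral_FTC _ dP); last by move=> t; exact: continuous_horner.
by rewrite /P !(hornerD, hornerZ, hornerX, hornerXn); field.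
Qed.

Lemma fld_ip A B c c' : A <> B ->
  sqn A B * \int[leb2]_(z in That) (\sum_(i < 2) fld A B c i z * fld A B c' i z) = ip c c'.
Proof.
move=> AB; have h := sqn_neq0 AB.
rewrite -RintegralThatZ; last first.
  have H i : continuous (fun z => fld A B c i z * fld A B c' i z).
    by apply: continuousMf; exact: continuous_fld.
  rewrite (_ : (fun z => _) = (fun z => fld A B c 0 z * fld A B c' 0 z + fld A B c 1 z * fld A B c' 1 z)).
    exact: continuousDf.
  by apply/funext => z; rewrite big_ord_recl big_ord1; congr (_ + fld _ _ _ _ _ * fld _ _ _ _ _); exact/val_inj.
pose g z := fld1 c z * fld1 c' z + fld2 c z * fld2 c' z.
have -> : \int[leb2]_(z in That) (sqn A B * \sum_(i < 2) fld A B c i z * fld A B c' i z) =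
    \int[leb2]_(z in That) g z.
  apply: eq_Rintegral => z _; rewrite big_ord_recl big_ord1 /fld /coord2 /= /g.
  have -> : sqn A B = (B.1 - A.1) ^+ 2 + (B.2 - A.2) ^+ 2 by [].
  move: h; rewrite /sqn => h; by field.
have l1 d z : fld1 d z = linf d.2 0 (d.1.1 - d.2 / 2) z by rewrite /fld1 /linf; field.
have l2 d z : fld2 d z = linf 0 (- d.2) (d.1.2 + d.2 / 2) z by rewrite /fld2 /linf; field.
have cg : continuous g.
  rewrite (_ : g = (fun z => linf c.2 0 (c.1.1 - c.2 / 2) z * linf c'.2 0 (c'.1.1 - c'.2 / 2) z +
     linf 0 (- c.2) (c.1.2 + c.2 / 2) z * linf 0 (- c'.2) (c'.1.2 + c'.2 / 2) z)).
    by apply: continuousDf; apply: continuousMf; exact: continuous_linf.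
  by apply/funext => z; rewrite /g !l1 !l2.
rewrite Rintegral_That_xy//.
have Ex (y : R) : \int[mu]_(x in `[0, 1]) g (x, y) =
    (c.1.1 * c'.1.1 + c.2 * c'.2 / 12 + (c.1.2 + c.2 / 2) * (c'.1.2 + c'.2 / 2))
     + (- (c.2 * (c'.1.2 + c'.2 / 2) + c'.2 * (c.1.2 + c.2 / 2))) * y + c.2 * c'.2 * y ^+ 2.
  pose k0 := (c.1.1 - c.2 / 2) * (c'.1.1 - c'.2 / 2) + fld2 c (0, y) * fld2 c' (0, y).
  have -> : \int[mu]_(x in `[0, 1]) g (x, y) = \int[mu]_(x in `[0, 1]) (k0 +
     (c.2 * (c'.1.1 - c'.2 / 2) + c'.2 * (c.1.1 - c.2 / 2)) * x + c.2 * c'.2 * x ^+ 2).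
    by apply: eq_Rintegral => x _; rewrite /g /k0 /fld1 /fld2 /=; field.
  by rewrite Rintegral_quadratic /k0 /fld2 /=; field.
under eq_Rintegral => y _ do rewrite Ex.
by rewrite Rintegral_quadratic /ip; field.
Qed.

Lemma qrot_mean A B m k : A <> B ->
  edge_mean (vtx A B k) (vtx A B (ordS k)) (fun p => qrot m (loc A B p)) = m k.
Proof.
move=> AB; rewrite edge_meanE.
have -> : \int[mu]_(t in `[0, 1]) qrot m (loc A B (th (vtx A B k) (vtx A B (ordS k)) (t, 0))) =
  \int[mu]_(t in `[0, 1]) qrot m (rotz k (t, 0)).
  by apply: eq_Rintegral => t _; rewrite th_rotz thK.
pose q0 := qrot m (rotz k (0, 0)); pose qh := qrot m (rotz k (2^-1, 0)); pose q1 := qrot m (rotz k (1, 0)).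
(* Simpson's rule is exact on quadratic polynomials *)
pose c1 := - 3 * q0 + 4 * qh - q1; pose c2 := 2 * q0 - 4 * qh + 2 * q1.
have -> : \int[mu]_(t in `[0, 1]) qrot m (rotz k (t, 0)) =
    \int[mu]_(t in `[0, 1]) (q0 + c1 * t + c2 * t ^+ 2).
  apply: eq_Rintegral => t _; rewrite /c1 /c2 /q0 /qh /q1.
  by elim/I4_ind: k {q0 qh q1 c1 c2}; rewrite /rotz /qrot /=; field.
rewrite Rintegral_quadratic.
rewrite /c1 /c2 /q0 /qh /q1; clear.
by elim/I4_ind: k; rewrite /rotz /qrot /gradc /=; field.
Qed.

End LocalSpaces.

(** * Transport of almost everywhere statements *)

Section AlmostEverywhere.
Context {R : realType}.
Notation P := (measurableTypeR R * measurableTypeR R)%type.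
Notation leb2 := (@leb2 R).
Implicit Types (A B : R * R) (Q : R * R -> Prop).

Lemma aeS Q Q' : (forall p, Q p -> Q' p) ->
  {ae leb2, forall p, Q p} -> {ae leb2, forall p, Q' p}.
Proof. by move=> h; apply: negligibleS => p /= n q; apply: n; exact: h. Qed.

Lemma aeS2 Q1 Q2 Q : (forall p, Q1 p -> Q2 p -> Q p) ->
  {ae leb2, forall p, Q1 p} -> {ae leb2, forall p, Q2 p} -> {ae leb2, forall p, Q p}.
Proof.
move=> h h1 h2; have := negligibleU h1 h2; apply: negligibleS => p /= n.
apply: contrapT => /not_orP[/contrapT q1 /contrapT q2]; apply: n; exact: h q1 q2.
Qed.

Lemma ae_fin (I : finType) (Q : I -> R * R -> Prop) :
  (forall i, {ae leb2, forall p, Q i p}) -> {ae leb2, forall p, forall i, Q i p}.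
Proof.
move=> h; have H (s : seq I) : {ae leb2, forall p, forall i, i \in s -> Q i p}.
  elim: s => [|i s ih]; first by apply: (@aeS (fun=> True)) => //; exact: aeW.
  apply: (aeS2 _ (h i) ih) => p qi qs j; rewrite inE => /orP[/eqP ->//|]; exact: qs.
by apply: aeS (H (enum I)) => p q i; apply: q; rewrite mem_enum.
Qed.

Lemma ae_aff (a b c : R * R) Q : det2 b c != 0 ->
  {ae leb2, forall p, Q p} <-> {ae leb2, forall z, Q (aff a b c z)}.
Proof.
move=> bc; split; first exact: (@negligible_aff _ _ _ _ (~` [set p | Q p])).
exact: (@negligible_affE _ _ _ _ (~` [set p | Q p])).
Qed.

Lemma ae_iff Q Q' : (forall p, Q p <-> Q' p) ->
  {ae leb2, forall p, Q p} <-> {ae leb2, forall p, Q' p}.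
Proof. by move=> h; split; apply: aeS => p /h. Qed.

Lemma ae_That_Tho Q :
  {ae leb2, forall z, That z -> Q z} <-> {ae leb2, forall z, Tho z -> Q z}.
Proof.
split; first by apply: aeS => z h /Tho_That.
have h : {ae leb2, forall z, ~ (That `\` Tho) z}.
  by apply: negligibleS (@negligible_That_Tho R) => z /= /contrapT.
by move=> hQ; apply: (aeS2 _ h hQ) => z h1 h2 Tz; apply: h2; apply: contrapT => nz; apply: h1.
Qed.

Lemma ae_square A B Q : A <> B -> {ae leb2, forall p, square_on A B p -> Q p} <->
  {ae leb2, forall z, That z -> Q (th A B z)}.
Proof.
move=> AB; rewrite (ae_aff A _ (det2_perp_neq0 AB)); apply: ae_iff => z.
by rewrite -/(th A B z); split => h; [move=> Tz; apply: h; apply/square_on_th|move/square_on_th => Tz; exact: h (Tz AB)].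
Qed.

Lemma ae_int_square A B Q : A <> B -> {ae leb2, forall p, interior (square_on A B) p -> Q p} <->
  {ae leb2, forall z, That z -> Q (th A B z)}.
Proof.
move=> AB; have h1 := ae_aff A (fun p => interior (square_on A B) p -> Q p) (det2_perp_neq0 AB).
have h2 := ae_That_Tho (fun z => Q (th A B z)).
apply: (iff_trans h1); apply: (iff_trans _ (iff_sym h2)); apply: ae_iff => z.
by rewrite -/(th A B z); split => h; [move=> Tz; apply: h; apply/interior_square_on_th|move/interior_square_on_th => Tz; exact: h (Tz AB)].
Qed.

Lemma ae_swap Q : {ae leb2, forall z, That z -> Q (z.2, z.1)} <->
  {ae leb2, forall z, That z -> Q z}.
Proof.
have d1 : det2 (0, 1) (1, 0) != 0 :> R by rewrite /det2 /= mulr0 mulr1 sub0r oppr_eq0 oner_eq0.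
have E z : aff 0 (0, 1) (1, 0) z = (z.2, z.1) :> R * R.
  by apply: pairP; rewrite /aff /= !scaleRE; ring.
rewrite (ae_aff 0 _ d1); apply: ae_iff => z; rewrite E.
have S : That (z.2, z.1) <-> That z by split => /ThatP[h1 h2]; apply/ThatP.
by split => h; [move/S/h; case: z {E S h}|case: z E S h => z1 z2 E S h /S].
Qed.

Lemma near_line1 (v z : R * R) (X : set (R * R)) : nbhs z X ->
  exists2 e : R, 0 < e < 1 & X (z + e *: v).
Proof.
have E w : th (0, 0) (1, 0) w = w :> R * R.
  by rewrite thE /=; apply: pairP => /=; ring.
by rewrite -{1}(E z) => /near_th_line -/(_ v)[e e1]; rewrite E; exists e.
Qed.

(** An open set contains a box of positive measure, which no null set can cover. *)
Lemma ae_open_point Q (U : set (R * R)) : {ae leb2, forall z, Q z} -> open U ->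
  U !=set0 -> exists2 z, U z & Q z.
Proof.
move=> [N [mN N0 QN]] oU [z Uz]; apply: contrapT => nU.
have [e e0 eU] : exists2 e : R, 0 < e & ball z e `<=` U.
  have : nbhs z U by apply: open_nbhs_nbhs.
  by move/nbhs_ballP => [e e0 h]; exists e.
pose B : set P := `]z.1 - e, z.1 + e[ `*` `]z.2 - e, z.2 + e[.
have BU : (B : set (R * R)) `<=` U.
  move=> w [] /= w1 w2; apply: eU; split => /=.
    by rewrite /ball /= ltr_distlC; move: w1 w2; rewrite !in_itv.
  by rewrite /ball /= ltr_distlC; move: w1 w2; rewrite !in_itv.
have BN : B `<=` N by move=> w Bw; apply: QN => Qw; apply: nU; exists w => //; exact: BU.
have mB : measurable B by exact: measurableX.
have : leb2 B = 0%E by apply: (subset_measure0 mB mN BN N0).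
rewrite leb2X//= !lebesgue_measure_itv/= !lte_fin.
have lt (x : R) : x - e < x + e by lra.
rewrite !lt -!EFinB -EFinM => -[] /eqP.
rewrite mulf_eq0 => /orP[] /eqP; lra.
Qed.

Lemma within_ae0 (f : R * R -> R) z : {ae leb2, forall z, That z -> f z = 0} ->
  That z -> {within That, continuous f} -> f z = 0.
Proof.
move=> f0 Tz cf; apply: contrapT => fz.
pose X := [set w | That w -> f w != 0].
have nX : nbhs z X.
  have : nbhs (f z) [set x | x != 0].
    by apply: open_nbhs_nbhs; split; [exact: open_neq|apply/eqP].
  by have /subspace_continuousP/(_ z Tz) := cf; apply.
pose c : R * R := (2^-1, 2^-1).
(* A step towards the centre [c] leads from any point of the closed square into the open one. *)
have [e e1 eX] := near_line1 (c - z) (nbhs_interior nX).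
have [] := @ae_open_point _ (interior X `&` Tho) f0.
- by apply: openI; [exact: open_interior|exact: open_Tho].
- exists (z + e *: (c - z)); split => //; move/ThatP: Tz => [z1 z2].
  by apply/ThoP; rewrite /= !scaleRE; split; apply/andP; split; nra.
- by move=> w [/interior_subset Xw /Tho_That Tw] /(_ Tw) /eqP; apply/negP; exact: Xw.
Qed.

Lemma continuous_ae0 (f : R * R -> R) : continuous f ->
  {ae leb2, forall z, That z -> f z = 0} -> forall z, That z -> f z = 0.
Proof. by move=> cf f0 z Tz; apply: within_ae0 => //; exact: continuous_subspaceT. Qed.

End AlmostEverywhere.

(** * Integrals over open squares *)

Section SquareIntegrals.
Context {R : realType}.
Notation P := (measurableTypeR R * measurableTypeR R)%type.
Notation leb2 := (@leb2 R).
Implicit Types (A B : R * R) (F : P -> R).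

Lemma measurable_int_square A B : measurable (interior (square_on A B) : set P).
Proof. by apply: open_measurable2; exact: open_interior. Qed.

Lemma preimage_int_square A B : A <> B -> th A B @^-1` interior (square_on A B) = Tho.
Proof. by move=> AB; apply/seteqP; split => z; move/interior_square_on_th; apply. Qed.

Lemma integrable_int_square A B F : A <> B ->
  leb2.-integrable (Tho : set P) (EFin \o (F \o th A B)) ->
  leb2.-integrable (interior (square_on A B) : set P) (EFin \o F).
Proof.
move=> AB; have [a [b [c [bc E]]]] := invaffE A (det2_perp_neq0 AB).
move=> /(integrable_aff a bc (@measurable_Tho R)); rewrite -E -/(loc A B).
have -> : loc A B @^-1` Tho = interior (square_on A B).
  by apply/seteqP; split => z; move/interior_square_on; apply.
by congr (leb2.-integrable _ (EFin \o _)); apply/funext => p /=; rewrite locK.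
Qed.

Lemma Rintegral_int_square A B F : A <> B ->
  leb2.-integrable (Tho : set P) (EFin \o (F \o th A B)) ->
  \int[leb2]_(p in interior (square_on A B)) F p = sqn A B * \int[leb2]_(z in Tho) F (th A B z).
Proof.
move=> AB /(integrable_int_square AB) iF.
rewrite (Rintegral_aff A (det2_perp_neq0 AB) (measurable_int_square A B) iF).
rewrite -[aff _ _ _ @^-1` _]/(th A B @^-1` _) preimage_int_square// det2_perp ger0_norm//.
by rewrite ltW// sqn_gt0.
Qed.

Lemma integral_Tho (G : P -> \bar R) : measurable_fun That G ->
  (\int[leb2]_(z in Tho) G z = \int[leb2]_(z in That) G z)%E.
Proof.
move=> mG; rewrite integral_mkcond [RHS]integral_mkcond.
have mT := @measurable_That R; have mo := @measurable_Tho R.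
have sub : (Tho : set P) `<=` That by exact: Tho_That.
apply: ae_eq_integral => //.
- by apply/(measurable_restrictT _ mo); exact: measurable_funS mG.
- by apply/(measurable_restrictT _ mT).
- have h : {ae leb2, forall z, That z -> Tho z} by apply/ae_That_Tho; exact: aeW.
  apply: aeS h => z h _; rewrite !patchE.
  case: ifPn => [|zo]; first by rewrite inE => /sub /mem_set ->.
  by case: ifPn => // /set_mem/h/mem_set; rewrite (negbTE zo).
Qed.

Lemma Tho_ae (g G : P -> R) : measurable_fun (Tho : set P) g -> continuous (G : R * R -> R) ->
  g = G %[ae leb2 in That] ->
  leb2.-integrable (Tho : set P) (EFin \o g) /\
  \int[leb2]_(z in Tho) g z = \int[leb2]_(z in That) G z.
Proof.
move=> mg cG /ae_That_Tho gG; have mo := @measurable_Tho R.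
have mG : measurable_fun setT G by exact: continuous_measurable2.
have mGo D : measurable_fun D G by exact: measurable_funTS.
have iG := continuous_integrable_That cG.
have iGo : leb2.-integrable (Tho : set P) (EFin \o G).
  by apply: integrableS iG => //; [exact: measurable_That|exact: Tho_That].
have E : (\int[leb2]_(z in Tho) (g z)%:E = \int[leb2]_(z in Tho) (G z)%:E)%E.
  apply: ae_eq_integral => //; [exact/measurable_EFinP|exact/measurable_EFinP|].
  by apply: aeS gG => z h /h ->.
split; last first.
  rewrite /Rintegral E integral_Tho//.
  by apply/measurable_EFinP; exact: mGo.
apply/integrableP; split; first exact/measurable_EFinP.
move/integrableP : iGo => [_]; apply: le_lt_trans; rewrite le_eqVlt; apply/orP; left; apply/eqP.
apply: ae_eq_integral => //.
- by apply: measurableT_comp => //; exact/measurable_EFinP.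
- by apply: measurableT_comp => //; exact/measurable_EFinP.
- by apply: aeS gG => z h /h /= ->.
Qed.

End SquareIntegrals.

(** * Square integrable functions *)

Section SquareMeanSquare.
Context {R : realType}.
Notation P := (measurableTypeR R * measurableTypeR R)%type.
Notation leb2 := (@leb2 R).
Implicit Types (D : set P) (f g : P -> R).

Lemma L2P D f : measurable D -> L2 D f <->
  measurable_fun D f /\ leb2.-integrable D (EFin \o (fun p => f p ^+ 2)).
Proof.
move=> mD; have sq : (fun p => (f \_ D) p ^+ 2) = (fun p => f p ^+ 2) \_ D.
  by apply/funext => p; rewrite !patchE; case: ifP => // _; rewrite expr0n.
have sqE : EFin \o (fun p => (f \_ D) p ^+ 2) = (EFin \o (fun p => f p ^+ 2)) \_ D.
  by rewrite sq; apply/funext => p; rewrite /= !patchE; case: ifP.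
split.
  move=> l2; split.
    have /andP[mf _] : (f \_ D \in mfun) && (f \_ D \in finLfun leb2 2%:E) by [].
    by apply/(measurable_restrictT _ mD); move: mf; rewrite inE.
  apply/(integrable_mkcond _ mD); rewrite -sqE; exact: Lfun2_integrable_sqr.
move=> [mf i2]; apply/andP; split; first by rewrite inE; exact/(measurable_restrictT _ mD).
rewrite inE /= /finite_norm unlock /=.
move/(integrable_mkcond _ mD) : i2; rewrite -sqE => /integrableP[_ i2].
apply: poweR_lty; apply: le_lt_trans i2; rewrite le_eqVlt; apply/orP; left; apply/eqP.
apply: eq_integral => p _ /=; rewrite powR_mulrn// real_normK ?num_real//.
by rewrite ger0_norm// sqr_ge0.
Qed.

Lemma L2N D f : measurable D -> L2 D f -> L2 D (fun p => - f p).
Proof.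
move=> mD /(L2P _ mD)[mf i2]; apply/(L2P _ mD); split; first exact: measurable_funN.
by move: i2; congr (leb2.-integrable _ _); apply/funext => p /=; rewrite sqrrN.
Qed.

Lemma integrable_L2M D f g : measurable D -> L2 D f -> L2 D g ->
  leb2.-integrable D (EFin \o (fun p => f p * g p)).
Proof.
move=> mD /(L2P _ mD)[mf f2] /(L2P _ mD)[mg g2].
apply: (le_integrable mD _ _ (integrableD mD f2 g2)).
  by apply/measurable_EFinP; exact: measurable_funM.
move=> p _; rewrite -[X in (_ <= X)%E]/(`|f p ^+ 2 + g p ^+ 2|%:E) -[X in (X <= _)%E]/(`|f p * g p|%:E) lee_fin ler_norml.
have : 0 <= f p ^+ 2 + g p ^+ 2 by rewrite addr_ge0// sqr_ge0.
move=> h; rewrite [`|_|]ger0_norm//.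
have h1 : 0 <= (f p + g p) ^+ 2 by exact: sqr_ge0.
have h2 : 0 <= (f p - g p) ^+ 2 by exact: sqr_ge0.
apply/andP; split; nra.
Qed.

Lemma L2_cst D (k : R) : measurable D -> (leb2 D < +oo)%E -> L2 D (fun=> k).
Proof.
move=> mD Dfin; apply/(L2P _ mD); split; first exact: measurable_cst.
apply/integrableP; split; first by apply/measurable_EFinP; exact: measurable_cst.
rewrite (eq_integral (cst (`|k ^+ 2|%:E)))// integral_cst//.
by rewrite lte_mul_pinfty// lee_fin.
Qed.

Lemma L2_integrable D f : measurable D -> (leb2 D < +oo)%E -> L2 D f ->
  leb2.-integrable D (EFin \o f).
Proof.
move=> mD Dfin fL; have := integrable_L2M mD fL (L2_cst 1 mD Dfin).
by congr (leb2.-integrable _ _); apply/funext => p /=; rewrite mulr1.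
Qed.

End SquareMeanSquare.

(** * Integrals over the domain as sums over the squares *)

Section MeshIntegrals.
Context {R : realType}.
Notation P := (measurableTypeR R * measurableTypeR R)%type.
Notation leb2 := (@leb2 R).

Context (Omega : set (R * R)) (n : nat) (a b : 'I_n -> R * R).
Context (M : is_mesh Omega a b).

Local Notation sq i := (square_on (a i) (b i)).
Local Notation th_ i := (th (a i) (b i)).
Let ab i : a i <> b i. Proof. exact: (mesh_neq M). Qed.

Lemma measurable_Omega : measurable (Omega : set P).
Proof. by apply: open_measurable2; exact: (open_Omega M). Qed.

Lemma ae_mesh (Q : R * R -> Prop) : {ae leb2, forall p, Omega p -> Q p} <->
  forall i, {ae leb2, forall z, That z -> Q (th_ i z)}.
Proof.
split=> [h i|h].
  by apply: (proj1 (ae_int_square Q (@ab i))); apply: aeS h => p Qp /(interior_sq_Omega M).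
have H i : {ae leb2, forall p, sq i p -> Q p} by apply: (proj2 (ae_square Q (@ab i))).
apply: aeS (ae_fin H) => p q /subset_closure; rewrite (mesh_cover M) => -[i _]; exact: q.
Qed.

Let Si i : set P := interior (sq i).
(** The open squares are pairwise disjoint, so integrals over [D] add up; by [neg] the set [D] fills
    [Omega] up to a null set. *)
Let D : set P := \big[setU/set0]_(i <- enum 'I_n) Si i.

Let DP p : D p <-> exists i, Si i p.
Proof.
rewrite /D -bigcup_seq; split => [[i _ ip]|[i ip]]; first by exists i.
by exists i => //=; rewrite mem_enum.
Qed.

Let tD : trivIset [set` enum 'I_n] Si.
Proof.
move=> i j _ _ [p [ip jp]]; apply: contrapT => /eqP ij.
by apply: (interior_sq_disjoint M ij ip); exact: interior_subset jp.
Qed.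

Let mS i : measurable (Si i). Proof. exact: measurable_int_square. Qed.

Let mD : measurable D. Proof. by apply: bigsetU_measurable => i _. Qed.

Let DO : D `<=` Omega. Proof. by move=> p /DP[i]; exact: (interior_sq_Omega M). Qed.

Let neg : leb2 (Omega `\` D) = 0%E.
Proof.
apply: measure_negligible.
  by apply: measurableD => //; exact: measurable_Omega.
have : {ae leb2, forall p, Omega p -> D p}.
  apply/ae_mesh => i; apply: (proj1 (ae_int_square D (@ab i))); apply: aeW => p ip.
  by apply/DP; exists i.
by apply: negligibleS => p [Op nD] /(_ Op).
Qed.

Lemma integrable_mesh (F : P -> R) : measurable_fun Omega F ->
  (forall i, leb2.-integrable (Tho : set P) (EFin \o (F \o th_ i))) ->
  leb2.-integrable Omega (EFin \o F) /\
  \int[leb2]_(p in Omega) F p =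
    \sum_i sqn (a i) (b i) * \int[leb2]_(z in Tho) F (th_ i z).
Proof.
move=> mF iF; have mO := measurable_Omega.
have iS i : leb2.-integrable (Si i) (EFin \o F) by apply: integrable_int_square => //; exact: (mesh_neq M).
have mFD : measurable_fun D F by apply: measurable_funS mF.
have iD : leb2.-integrable D (EFin \o F).
  apply/integrableP; split; first exact/measurable_EFinP.
  rewrite (eq_integral (fun p => (`|F p|)%:E))//.
  rewrite (@integral_bigsetU_EFin _ _ _ leb2 _ Si (fun p => `|F p|) (enum 'I_n))//.
  - apply: lte_sum_pinfty => i _; have /integrableP[_] := iS i.
    by apply: le_lt_trans; rewrite le_eqVlt; apply/orP; left; apply/eqP/eq_integral.
  - exact: enum_uniq.
  - by apply/measurable_EFinP; exact: measurableT_comp.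
have mN : measurable (Omega `\` D : set P) by exact: measurableD.
have OD : Omega `\` (Omega `\` D) = D by rewrite setDD; apply/setIidr.
have iO : leb2.-integrable Omega (EFin \o F).
  by apply/(negligible_integrable mN mO _ neg); [exact/measurable_EFinP|rewrite OD].
split => //.
rewrite /Rintegral (negligible_integral mN mO iO neg) OD.
rewrite (@integral_bigsetU_EFin _ _ _ leb2 _ Si F (enum 'I_n))//; last 2 first.
- exact: enum_uniq.
- exact/measurable_EFinP.
rewrite big_enum /= -sum_fine; last by move=> i _; exact: integrable_fin_num.
by apply: eq_bigr => i _; rewrite -Rintegral_int_square//; exact: (mesh_neq M).
Qed.

Lemma measurable_th (F : P -> R) i : measurable_fun Omega F ->
  measurable_fun (Tho : set P) (F \o th_ i).
Proof.
move=> mF; apply: (@measurable_comp _ _ _ _ _ _ (Omega : set P)) => //.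
- exact: measurable_Omega.
- by move=> _ [z Tz <-]; apply: (interior_sq_Omega M (i := i)); apply/interior_square_on_th => //; exact: (mesh_neq M).
- by apply: measurable_funTS; exact: measurable_aff.
Qed.

Lemma Rintegral_mesh (F : P -> R) (G : 'I_n -> R * R -> R) : measurable_fun Omega F ->
  (forall i, continuous (G i)) ->
  (forall i, {ae leb2, forall z, That z -> F (th_ i z) = G i z}) ->
  leb2.-integrable Omega (EFin \o F) /\
  \int[leb2]_(p in Omega) F p = \sum_i sqn (a i) (b i) * \int[leb2]_(z in That) G i z.
Proof.
move=> mF cG FG.
have H i := Tho_ae (measurable_th i mF) (cG i) (FG i).
have [iF ->] := integrable_mesh mF (fun i => (H i).1); split => //.
by apply: eq_bigr => i _; rewrite -(H i).2.
Qed.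

Lemma leb2_Omega : (leb2 Omega < +oo)%E.
Proof.
have [/integrableP[_]] := @Rintegral_mesh (fun=> 1) (fun i z => 1) (measurable_cst _)
  (fun i => @cst_continuous _ _ _) (fun i => aeW _ (fun _ _ => erefl)).
rewrite (eq_integral (cst 1%E)) ?integral_cst ?mul1e//; first exact: measurable_Omega.
by move=> p _ /=; rewrite normr1.
Qed.

Lemma L2_mesh (F : P -> R) (G : 'I_n -> R * R -> R) : measurable_fun Omega F ->
  (forall i, continuous (G i)) ->
  (forall i, {ae leb2, forall z, That z -> F (th_ i z) = G i z}) -> L2 Omega F.
Proof.
move=> mF cG FG; apply/(L2P _ measurable_Omega); split => //.
have [] // := @Rintegral_mesh (fun p => F p ^+ 2) (fun i z => G i z * G i z).
- exact: measurable_funX.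
- by move=> i; apply: continuousMf; exact: cG.
- by move=> i; apply: aeS (FG i) => z h Tz; rewrite h// expr2.
Qed.

(** Indicators of the open squares give a measurable function; its value on the edges is the default
    [0]. *)
Definition glue (f : 'I_n -> R * R -> R) (p : R * R) : R := \sum_i f i p * \1_(Si i) p.

Lemma glueE f i p : interior (sq i) p -> glue f p = f i p.
Proof.
move=> ip; rewrite /glue (bigD1 i)//= indicE mem_set// mulr1 big1 ?addr0// => j ji.
rewrite indicE memNset ?mulr0// => jp.
by apply: (interior_sq_disjoint M ji jp); exact: interior_subset ip.
Qed.

Lemma glue_th f i : {ae leb2, forall z, That z -> glue f (th_ i z) = f i (th_ i z)}.
Proof.
by apply: (proj1 (ae_int_square (fun p => glue f p = f i p) (@ab i))); apply: aeW => p; exact: glueE.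
Qed.

Lemma measurable_glue f : (forall i, continuous (f i)) -> measurable_fun setT (glue f : P -> R).
Proof.
move=> cf; apply: measurable_sum => i; apply: measurable_funM.
  exact: continuous_measurable2.
exact: measurable_indic.
Qed.

End MeshIntegrals.

(** * Test functions concentrated in a box *)

Section SmoothTests.
Context {R : realType}.
Implicit Types (f g : R * R -> R).

(** A multiple of [flat 1] composed with the constant functional [1]. *)
Lemma smooth_cst (k : R) : smooth (fun=> k : R).
Proof.
have e0 : flat 1 (1 : R) != 0.
  by rewrite gt_eqF// flat1_gt0.
have := smoothZ (k / flat 1 1) (smooth_flat 1 0 0 (1 : R)).
congr smooth; apply/funext => p; rewrite /= /linf !mul0r !add0r.
by rewrite scaleRE divfK.
Qed.

Lemma smooth_ext f g : smooth f -> (forall p, f p = g p) -> smooth g.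
Proof. by move=> sf fg; rewrite (_ : g = f)//; apply/funext. Qed.

Lemma smooth_steep m f : smooth f -> smooth (fun p => steep m (f p)).
Proof.
move=> sf; have s1 : smooth (fun p => 1 - f p).
  apply: (smooth_ext (smoothD (smooth_cst 1) (smoothZ (-1) sf))) => p.
  by rewrite -[LHS]/(1 + -1 * f p) mulN1r.
have sm : smooth (fun p => (1 - f p) ^+ m).
  elim: m => [|m ih]; first by apply: (smooth_ext (smooth_cst 1)) => p; rewrite expr0.
  by apply: (smooth_ext (smoothM s1 ih)) => p; rewrite exprS.
apply: (smooth_ext (smoothD (smooth_cst 1) (smoothZ (-1) sm))) => p.
by rewrite -[LHS]/(1 + -1 * (1 - f p) ^+ m) mulN1r.
Qed.

Lemma smooth_bump2_loc A B (x0 x1 y0 y1 k : R) : A <> B ->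
  smooth (fun p => k * bump2 x0 x1 y0 y1 (loc A B p)).
Proof.
move=> AB; pose E p := loc_linf p AB.
set u := (X in linf X _ _) in (E); set v := (X in linf _ X _) in (E).
apply: (smooth_ext (smoothZ k (smoothM (smooth_bump x0 x1 _ _ _) (smooth_bump y0 y1 _ _ _)))) => p.
by rewrite /bump2 (loc_linf p AB).
Qed.

Lemma test_functionP (Omega : set (R * R)) f (K : set (R * R)) : smooth f ->
  compact K -> K `<=` Omega -> (forall p, f p != 0 -> K p) -> test_function Omega f.
Proof.
move=> sf cK KO fK; split => [ds p|/=]; first exact: smooth_iter_partial.
have cl : closure [set p | f p != 0] `<=` K.
  have : closed K by apply: compact_closed => //; exact: norm_hausdorff.
  by rewrite closureE => clK p; apply.
split; last exact: subset_trans KO.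
by apply: subclosed_compact cK cl; exact: closed_closure.
Qed.

(** A bump on a box in the frame of [A B]; the factor [k], placed inside [steep], serves to
    prescribe the trace on an edge. *)
Definition box_bump A B (x0 x1 y0 y1 k : R) m p : R :=
  steep m (k * bump2 x0 x1 y0 y1 (loc A B p)).

Lemma box_bump_neq0 A B (x0 x1 y0 y1 k : R) m p : box_bump A B x0 x1 y0 y1 k m p != 0 ->
  (x0 < (loc A B p).1 < x1) /\ (y0 < (loc A B p).2 < y1).
Proof.
move=> phi0; apply/andP; rewrite -bump2_gt0 lt_neqAle eq_sym.
have /andP[-> _] := bump2_itv x0 x1 y0 y1 (loc A B p).
rewrite andbT; apply: contra phi0 => /eqP E.
by rewrite /box_bump E mulr0 /steep subr0 expr1n subrr.
Qed.

Lemma test_box_bump (Omega : set (R * R)) A B (x0 x1 y0 y1 k : R) m : A <> B ->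
  (forall z : R * R, x0 <= z.1 <= x1 -> y0 <= z.2 <= y1 -> Omega (th A B z)) ->
  test_function Omega (box_bump A B x0 x1 y0 y1 k m).
Proof.
move=> AB sub; apply: (@test_functionP _ _ (th A B @` (`[x0, x1] `*` `[y0, y1]))).
- by apply: smooth_steep; exact: smooth_bump2_loc.
- apply: continuous_compact; first by apply: continuous_subspaceT => z; exact: continuous_th.
  by apply: compact_setX; exact: segment_compact.
- by move=> _ [z [/= z1 z2] <-]; move: z1 z2; rewrite !in_itv; exact: sub.
- move=> p /box_bump_neq0[/andP[? ?] /andP[? ?]]; exists (loc A B p); last by rewrite locK.
  by split; rewrite /= in_itv /=; apply/andP; split; exact: ltW.
Qed.

Lemma test_pd (Omega : set (R * R)) f : test_function Omega f ->
  [/\ pd f ('D_(1, 0) f) ('D_(0, 1) f), continuous ('D_(1, 0) f) & continuous ('D_(0, 1) f)].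
Proof.
move=> [df _]; split.
- by apply: diff_pd => p; exact: (df [::]).
- by move=> p; apply: differentiable_continuous; exact: (df [:: 0]).
- by move=> p; apply: differentiable_continuous; exact: (df [:: 1]).
Qed.

Lemma test_out (Omega : set (R * R)) f p : test_function Omega f -> ~ Omega p -> f p = 0.
Proof.
move=> [_ [_ sO]] nO; apply: contrapT => /eqP fp; apply: nO; apply: sO.
exact: subset_closure.
Qed.

End SmoothTests.

Lemma Rintegral_eq0 d (T : measurableType d) (R : realType) (m : {measure set T -> \bar R})
    (D : set T) (f : T -> R) : (forall x, D x -> f x = 0) -> \int[m]_(x in D) f x = 0.
Proof. by move=> f0; rewrite /Rintegral integral0_eq// => x Dx; rewrite f0. Qed.

(** * Integration by parts on one square *)

Section EdgeSums.
Context {R : realType}.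
Notation mu := (@lebesgue_measure R).
Notation leb2 := (@leb2 R).
Implicit Types (A B : R * R) (u : 'I_4 -> R) (f phi : R * R -> R).

(** The partial derivative in direction [j] of the bilinear function with corner values [u],
    expressed in reference coordinates. *)
Definition part A B u (j : 'I_2) z : R :=
  if j == 0 then - fld A B (curlc u) 1 z else fld A B (curlc u) 0 z.

(** Component [j] of the outward normal to edge [k], times the length of the edge. *)
Definition normal A B (j : 'I_2) (k : 'I_4) : R :=
  if j == 0 then (vtx A B (ordS k) - vtx A B k).2 else - (vtx A B (ordS k) - vtx A B k).1.

Lemma continuous_part A B u j : continuous (part A B u j).
Proof.
case: (boolP (j == 0)) => j0; last by rewrite /part (negbTE j0); exact: continuous_fld.
rewrite (_ : part A B u j = (fun z => -1 * fld A B (curlc u) 1 z)).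
  by apply: continuousMl; exact: continuous_fld.
by apply/funext => z; rewrite /part j0 mulN1r.
Qed.

Lemma continuous_qbil u : continuous (qbil u : R * R -> R).
Proof. exact: pd_continuous (pd_qbil u). Qed.

Lemma edge_th A B (t : R) : A + t *: (B - A) = th A B (t, 0).
Proof. by rewrite thE; apply: pairP => /=; rewrite scaleRE; ring. Qed.

Lemma qbil_edge A B u k (t : R) : A <> B ->
  qbil u (loc A B (vtx A B k + t *: (vtx A B (ordS k) - vtx A B k))) =
  (1 - t) * u k + t * u (ordS k).
Proof.
move=> AB; rewrite edge_th th_rotz thK//.
by elim/I4_ind: k; rewrite /rotz /qbil /= ?ordS4; ring.
Qed.

Lemma square_ibp A B u phi phi1 phi2 j : A <> B -> pd phi phi1 phi2 ->
  continuous phi1 -> continuous phi2 ->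
  sqn A B * \int[leb2]_(z in That) (qbil u z * (if j == 0 :> 'I_2 then phi1 else phi2) (th A B z)) =
  \sum_k normal A B j k *
    edge_mean (vtx A B k) (vtx A B (ordS k)) (fun p => qbil u (loc A B p) * phi p)
  - sqn A B * \int[leb2]_(z in That) (part A B u j z * phi (th A B z)).
Proof.
move=> AB pphi c1 c2.
have pv := pd_qbil_loc u AB.
have cth (h : R * R -> R) : continuous h -> continuous (fun z => h (th A B z)).
  by move=> ch; exact: continuous_affcomp.
have cloc (h : R * R -> R) : continuous h -> continuous (fun p => h (loc A B p)).
  by move=> ch p; apply: (@continuous_comp _ _ _ (loc A B) h); [exact: continuous_loc|exact: ch].
have cphi := pd_continuous pphi.
have cv := continuous_qbil_loc (u := u) AB.
have cN : continuous (fun p => - fld A B (curlc u) 1 (loc A B p)).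
  by apply: (cloc (part A B u 0)); exact: continuous_part.
have cP : continuous (fun p => fld A B (curlc u) 0 (loc A B p)).
  by apply: cloc; exact: continuous_fld.
have cpart i : continuous (part A B u i) by exact: continuous_part.
have cq : continuous (qbil u : R * R -> R) by exact: continuous_qbil.
have := green_square AB (pdM pv pphi).
move=> /(_ (continuousDf (continuousMf cN cphi) (continuousMf cv c1))
   (continuousDf (continuousMf cP cphi) (continuousMf cv c2)))[Gx Gy].
rewrite /normal; case: (boolP (j == 0)) => j0.
- rewrite -Gx -mulrBr; congr (_ * _); rewrite -[LHS]addr0; apply/eqP; rewrite addr0 eq_sym subr_eq; apply/eqP.
  rewrite -RintegralThatD; [|by apply: continuousMf => //; exact: cth..].
  by apply: eq_Rintegral => z _; rewrite thK// /part j0; ring.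
- rewrite -Gy -mulrBr; congr (_ * _); apply/eqP; rewrite eq_sym subr_eq; apply/eqP.
  rewrite -RintegralThatD; [|by apply: continuousMf => //; exact: cth..].
  by apply: eq_Rintegral => z _; rewrite thK// /part (negbTE j0); ring.
Qed.

Lemma half_itvS (y : R) : -2^-1 < y < 2^-1 -> -1 < y < 1 /\ -2^-1 < - y < 2^-1.
Proof. by move=> h; split; lra. Qed.

Lemma onem_itv (x : R) : 0 < x < 1 -> 0 < 1 - x < 1.
Proof. by move=> h; lra. Qed.

Lemma sum_two (I : finType) (X : I -> R) (e f : I) : e != f ->
  (forall k, k != e -> k != f -> X k = 0) -> \sum_k X k = X e + X f.
Proof.
move=> ef X0; rewrite (bigD1 e)//= (bigD1 f)/=; last by rewrite eq_sym.
by rewrite big1 ?addr0// => k /andP[ke kf]; exact: X0.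
Qed.

Lemma continuous_line f A B : continuous f -> continuous (fun t : R => f (A + t *: (B - A))).
Proof.
move=> cf; suff : continuous (f \o (fun t : R => A + t *: (B - A))) by [].
move=> t; apply: continuous_comp; last exact: cf.
by apply: cvgD; [exact: cvg_cst|apply: cvgZr_tmp; exact: cvg_id].
Qed.

Lemma not_Tho_rotz (l : 'I_4) (t : R) : ~ Tho (rotz l (t, 0)).
Proof. by move=> /ThoP; elim/I4_ind: l; rewrite /rotz /= => -[]; lra. Qed.

(** The open band of half width 1/2 about an edge, cut off at its end points, meets no other edge of
    the square. *)
Lemma rotz_edge (k l : 'I_4) (x y t : R) : rotz k (x, y) = rotz l (t, 0) ->
  0 < x < 1 -> -2^-1 < y < 2^-1 -> l = k.
Proof.
by elim/I4_ind: k; elim/I4_ind: l => //; rewrite /rotz /= => -[] e1 e2 h1 h2; exfalso; lra.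
Qed.

End EdgeSums.

(** * Weak derivatives of piecewise bilinear functions *)

Section WeakDerivatives.
Context {R : realType}.
Notation P := (measurableTypeR R * measurableTypeR R)%type.
Notation mu := (@lebesgue_measure R).
Notation leb2 := (@leb2 R).

Context (Omega : set (R * R)) (n : nat) (a b : 'I_n -> R * R).
Context (M : is_mesh Omega a b).

Local Notation sq i := (square_on (a i) (b i)).
Local Notation vt i := (vtx (a i) (b i)).
Local Notation th_ i := (th (a i) (b i)).
Local Notation loc_ i := (loc (a i) (b i)).
Local Notation sqn_ i := (sqn (a i) (b i)).
Local Notation partner := (partner a b).
Let ab i : a i <> b i. Proof. exact: (mesh_neq M). Qed.

(** Passing to the partner, with boundary edges left fixed, is an involution that changes the sign
    of every term; the sum equals its own negative. *)
Lemma partner_cancel (X : 'I_n * 'I_4 -> R) : (forall e f, partner e f -> X e = - X f) ->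
  (forall e, (forall f, ~ partner e f) -> X e = 0) -> \sum_e X e = 0.
Proof.
move=> anti bd.
have [h hP] : exists h : 'I_n * 'I_4 -> 'I_n * 'I_4, forall e,
    partner e (h e) \/ ((forall f, ~ partner e f) /\ h e = e).
  suff /choice[h hP] : forall e, exists f, partner e f \/ ((forall g, ~ partner e g) /\ f = e) by exists h.
  move=> e; have [[f ef]|nf] := pselect (exists f, partner e f); first by exists f; left.
  by exists e; right; split => // f ef; apply: nf; exists f.
have hK : involutive h.
  move=> e; case: (hP e) => [ef|[_ E]]; last by rewrite !E.
  case: (hP (h e)) => [fe|[nf _]]; last by case: (nf e); exact: partner_sym.
  by apply: (partner_fun M fe); exact: partner_sym.
have E : \sum_e X e = - \sum_e X e.
  rewrite {1}(reindex_inj (inv_inj hK)) /= -sumrN; apply: eq_bigr => e _.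
  case: (hP e) => [ef|[nf ->]]; first by rewrite (anti _ _ ef) opprK.
  by rewrite (bd _ nf) oppr0.
lra.
Qed.

Context (u : 'I_n -> 'I_4 -> R).

Definition edge_term (j : 'I_2) (phi : R * R -> R) (e : 'I_n * 'I_4) : R :=
  normal (a e.1) (b e.1) j e.2 *
  edge_mean (vt e.1 e.2) (vt e.1 (ordS e.2)) (fun p => qbil (u e.1) (loc_ e.1 p) * phi p).

Lemma edge_term_eq0 j phi e : (forall t : R, 0 <= t <= 1 ->
    phi (vt e.1 e.2 + t *: (vt e.1 (ordS e.2) - vt e.1 e.2)) = 0) -> edge_term j phi e = 0.
Proof.
move=> h; rewrite /edge_term /edge_mean Rintegral_eq0 ?mulr0// => t.
by rewrite /= in_itv /= => t01; rewrite h// mulr0.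
Qed.

Lemma mesh_ibp j phi beta : test_function Omega phi -> measurable_fun Omega (beta : P -> R) ->
  (forall i, {ae leb2, forall z, That z -> beta (th_ i z) = qbil (u i) z}) ->
  \int[leb2]_(p in Omega) (beta p * 'D_(evec j) phi p) =
  \sum_e edge_term j phi e -
    \sum_i sqn_ i * \int[leb2]_(z in That) (part (a i) (b i) (u i) j z * phi (th_ i z)).
Proof.
move=> tphi mbeta hbeta; have [pphi c1 c2] := test_pd tphi.
have DE : 'D_(evec j) phi = (if j == 0 :> 'I_2 then 'D_(1, 0) phi else 'D_(0, 1) phi).
  by rewrite /evec; case: ifP.
have cD : continuous ('D_(evec j) phi).
  by rewrite /evec; case: (j == 0); [exact: c1|exact: c2].
pose F p := beta p * 'D_(evec j) phi p.
pose G i z := qbil (u i) z * 'D_(evec j) phi (th_ i z).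
have mF : measurable_fun Omega (F : P -> R).
  apply: measurable_funM => //; apply: measurable_funTS; exact: continuous_measurable2.
have cG i : continuous (G i).
  by apply: continuousMf; [exact: continuous_qbil|exact: (@continuous_affcomp _ ('D_(evec j) phi))].
have FG i : {ae leb2, forall z, That z -> F (th_ i z) = G i z}.
  by apply: aeS (hbeta i) => z h Tz; rewrite /F h.
have [_ ->] := Rintegral_mesh M mF cG FG.
rewrite -(pair_bigA _ (fun i k => edge_term j phi (i, k))) /= -sumrB.
apply: eq_bigr => i _.
have -> : \int[leb2]_(z in That) G i z = \int[leb2]_(z in That)
    (qbil (u i) z * (if j == 0 :> 'I_2 then 'D_(1, 0) phi else 'D_(0, 1) phi) (th_ i z)).
  by apply: eq_Rintegral => z _; rewrite -DE.
exact: (square_ibp (u i) j (@ab i) pphi c1 c2).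
Qed.

Lemma part_integral j phi g : test_function Omega phi -> measurable_fun Omega (g : P -> R) ->
  (forall i, {ae leb2, forall z, That z -> g (th_ i z) = part (a i) (b i) (u i) j z}) ->
  \int[leb2]_(p in Omega) (g p * phi p) =
  \sum_i sqn_ i * \int[leb2]_(z in That) (part (a i) (b i) (u i) j z * phi (th_ i z)).
Proof.
move=> tphi mg hg; have [pphi c1 c2] := test_pd tphi; have cphi := pd_continuous pphi.
pose F p := g p * phi p.
pose G i z := part (a i) (b i) (u i) j z * phi (th_ i z).
have mF : measurable_fun Omega (F : P -> R).
  apply: measurable_funM => //; apply: measurable_funTS; exact: continuous_measurable2.
have cG i : continuous (G i).
  by apply: continuousMf; [exact: continuous_part|exact: continuous_affcomp].
have FG i : {ae leb2, forall z, That z -> F (th_ i z) = G i z}.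
  by apply: aeS (hg i) => z h Tz; rewrite /F h.
by have [_ ->] := Rintegral_mesh M mF cG FG.
Qed.

(** Continuity across common edges: a bilinear function is affine on an edge, so its two end values
    decide. *)
Definition edge_match : Prop := forall e f, partner e f ->
  u e.1 e.2 = u f.1 (ordS f.2) /\ u e.1 (ordS e.2) = u f.1 f.2.

Lemma normal_partner j e f : partner e f ->
  normal (a e.1) (b e.1) j e.2 = - normal (a f.1) (b f.1) j f.2.
Proof.
move=> [h1 h2]; rewrite /normal h1 h2; case: ifP => _ /=; ring.
Qed.

Lemma weak_partial_match j beta g : edge_match ->
  measurable_fun Omega (beta : P -> R) -> measurable_fun Omega (g : P -> R) ->
  (forall i, {ae leb2, forall z, That z -> beta (th_ i z) = qbil (u i) z}) ->
  (forall i, {ae leb2, forall z, That z -> g (th_ i z) = part (a i) (b i) (u i) j z}) ->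
  weak_partial Omega j beta g.
Proof.
move=> um mb mg hb hg phi tphi; have [pphi _ _] := test_pd tphi.
have cphi := pd_continuous pphi.
rewrite (mesh_ibp j tphi mb hb) (part_integral tphi mg hg).
rewrite (_ : \sum_e _ = 0) ?sub0r//; apply: partner_cancel => [e f ef|e ne].
(* The normals are opposite and the traces agree after reversing the parameter; on boundary edges
   the test function vanishes. *)
- rewrite /edge_term (normal_partner j ef) mulNr; congr (- (_ * _)).
  rewrite edge_meanC; last by apply: continuousMf => //; apply: continuous_qbil_loc; exact: ab.
  have [h1 h2] := ef; have [u1 u2] := um _ _ ef.
  have E1 (s : R) := qbil_edge (u e.1) e.2 s (@ab e.1).
  have E2 (s : R) := qbil_edge (u f.1) f.2 s (@ab f.1).
  move: E1 E2; rewrite u1 u2 h1 h2; move: (vt f.1 f.2) (vt f.1 (ordS f.2)) => Q' P' E1 E2.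
  apply: eq_Rintegral => t _; congr (_ * _); rewrite E2.
  have -> : Q' + t *: (P' - Q') = P' + (1 - t) *: (Q' - P').
    by apply: pairP; rewrite /= !scaleRE; ring.
  by rewrite E1; ring.
- apply: edge_term_eq0 => t t01; apply: (test_out tphi).
  have : bdry Omega (vt e.1 e.2 + t *: (vt e.1 (ordS e.2) - vt e.1 e.2)).
    apply: (no_partner_bdry M (i := e.1) (k := e.2)); first by case: e ne.
    by exists t.
  by move=> /(bdryE M)[].
Qed.

Lemma integrable_th (g : P -> R) i : leb2.-integrable Omega (EFin \o g) ->
  leb2.-integrable (Tho : set P) (EFin \o (g \o th_ i)).
Proof.
move=> ig; have mS := measurable_int_square (a i) (b i).
have iS : leb2.-integrable (interior (sq i) : set P) (EFin \o g).
  apply: integrableS ig => //; first exact: (measurable_Omega M).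
  exact: (interior_sq_Omega M).
have := integrable_aff (a i) (det2_perp_neq0 (@ab i)) mS iS.
by rewrite -[aff _ _ _ @^-1` _]/(th_ i @^-1` _) preimage_int_square//; exact: ab.
Qed.

Lemma weak_partial_part j beta g : L2 Omega beta -> L2 Omega g ->
  (forall i, {ae leb2, forall z, That z -> beta (th_ i z) = qbil (u i) z}) ->
  weak_partial Omega j beta g ->
  forall i, {ae leb2, forall z, That z -> g (th_ i z) = part (a i) (b i) (u i) j z}.
Proof.
move=> Lb Lg hb wp i; have mO := measurable_Omega M.
have /(L2P _ mO)[mb _] := Lb; have /(L2P _ mO)[mg _] := Lg.
have ig := L2_integrable mO (leb2_Omega M) Lg.
have mT := @measurable_That R; have mo := @measurable_Tho R.
have igS : leb2.-integrable (Tho : set P) (EFin \o (g \o th_ i)).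
  exact: integrable_th.
(* Integrability of [g] is known inside the open square only, so its boundary values are replaced by
   zero before [fundamental_lemma] is applied. *)
pose h z := ((g \o th_ i) \_ Tho) z - part (a i) (b i) (u i) j z.
have ipart : leb2.-integrable (That : set P) (EFin \o part (a i) (b i) (u i) j).
  by apply: continuous_integrable_That; exact: continuous_part.
have igT : leb2.-integrable (That : set P) (EFin \o ((g \o th_ i) \_ Tho)).
  apply: (@integrableS _ _ _ _ setT) => //.
  have := (proj1 (integrable_mkcond (mu := leb2) (EFin \o (g \o th_ i)) mo)) igS.
  by congr (leb2.-integrable _ _); apply/funext => z; rewrite /= !patchE; case: ifP.
have ih : leb2.-integrable (That : set P) (EFin \o h).
  exact: (integrableB mT igT ipart).
suff : {ae leb2, forall z, That z -> h z = 0}.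
  move=> h0; apply/ae_That_Tho; apply: aeS h0 => z hz Tz.
  have := hz (Tho_That Tz); rewrite /h patchE mem_set// => /eqP; rewrite subr_eq0 => /eqP.
  by [].
apply: fundamental_lemma ih _ => x0 x1 y0 y1 m x00 x11 y00 y11.
pose phi := box_bump (a i) (b i) x0 x1 y0 y1 1 m.
have phiE z : phi (th_ i z) = steep m (bump2 x0 x1 y0 y1 z).
  by rewrite /phi /box_bump mul1r thK//; exact: ab.
have phi_int p : phi p != 0 -> interior (sq i) p.
  move=> /box_bump_neq0[h1 h2]; apply/interior_square_on; [exact: ab|apply/ThoP; lra].
have tphi : test_function Omega phi.
  apply: test_box_bump; first exact: ab.
  move=> z z1 z2; apply: (interior_sq_Omega M (i := i)).
  by apply/interior_square_on_th; [exact: ab|apply/ThoP; lra].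
have cphi : continuous phi by have [/pd_continuous] := test_pd tphi.
have := wp phi tphi; rewrite (mesh_ibp j tphi mb hb).
have -> : \sum_e edge_term j phi e = 0.
  apply: big1 => -[k l] _; apply: edge_term_eq0 => t t01; set p := _ + _.
  have pE : p = th_ k (rotz l (t, 0)).
    by rewrite /p edge_th th_rotz.
  apply: contrapT => /eqP /phi_int ip.
  have ki : k = i.
    apply: contrapT => /eqP ki; rewrite eq_sym in ki.
    apply: (interior_sq_disjoint M ki ip); rewrite pE; apply/square_on_th; first exact: ab.
    by apply/That_rotz/ThatP => /=; rewrite lexx ler01.
  move: ip; rewrite pE ki => /interior_square_on_th => /(_ (@ab i)).
  exact: not_Tho_rotz.
rewrite sub0r => /oppr_inj.
have mphi : measurable_fun setT (phi : P -> R) by exact: continuous_measurable2.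
have phi1 p : `|phi p| <= 1.
  rewrite /phi /box_bump mul1r; have /(@steep_itv _ m)/andP[h0 h1] := bump2_itv x0 x1 y0 y1 (loc_ i p).
  by rewrite ger0_norm.
have mgphi : measurable_fun Omega ((fun p => g p * phi p) : P -> R).
  by apply: measurable_funM => //; exact: measurable_funTS.
have igphi : leb2.-integrable Omega (EFin \o (fun p => g p * phi p)).
  apply: (le_integrable mO _ _ ig); first exact/measurable_EFinP.
  by move=> p _; rewrite /= lee_fin normrM ler_piMr.
have [_ ->] := integrable_mesh M mgphi (fun k => integrable_th k igphi).
rewrite (bigD1 i)//= big1 ?addr0; last first.
  move=> k ki; rewrite (_ : Rintegral _ _ _ = 0) ?mulr0//.
  apply: Rintegral_eq0 => z Tz; suff -> : phi (th_ k z) = 0 by rewrite mulr0.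
  apply: contrapT => /eqP /phi_int ip; rewrite eq_sym in ki.
  by apply: (interior_sq_disjoint M ki ip); apply/square_on_th => //; exact: ab.
rewrite [in RHS](bigD1 i)//= [in RHS]big1 ?addr0; last first.
  move=> k ki; rewrite (_ : Rintegral _ _ _ = 0) ?mulr0//.
  apply: Rintegral_eq0 => z /Tho_That Tz; suff -> : phi (th_ k z) = 0 by rewrite mulr0.
  apply: contrapT => /eqP /phi_int ip; rewrite eq_sym in ki.
  by apply: (interior_sq_disjoint M ki ip); apply/square_on_th => //; exact: ab.
move=> /(mulfI (sqn_neq0 (@ab i))) E.
have cphith : continuous (fun z => phi (th_ i z)) by exact: continuous_affcomp.
have mphith : measurable_fun That ((fun z => phi (th_ i z)) : P -> R).
  by apply: measurable_funTS; exact: continuous_measurable2.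
have -> : \int[leb2]_(z in That) (h z * steep m (bump2 x0 x1 y0 y1 z)) =
   \int[leb2]_(z in That) (((g \o th_ i) \_ Tho) z * phi (th_ i z) -
     part (a i) (b i) (u i) j z * phi (th_ i z)).
  by apply: eq_Rintegral => z _; rewrite phiE /h mulrBl.
rewrite RintegralB//; last 2 first.
- by apply: integrable_mul_bounded => // z _; exact: phi1.
- by apply: integrable_mul_bounded => // z _; exact: phi1.
apply/eqP; rewrite subr_eq0 E; apply/eqP.
rewrite Rintegral_mkcond [RHS]Rintegral_mkcond; apply: eq_Rintegral => z _.
rewrite !patchE; case: ifPn => zT.
  by case: ifPn => zo; rewrite ?mul0r.
case: ifPn => // /set_mem /Tho_That /mem_set; by rewrite (negbTE zT).
Qed.


Lemma edge_term_sum0 j beta g phi : L2 Omega beta -> L2 Omega g ->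
  (forall i, {ae leb2, forall z, That z -> beta (th_ i z) = qbil (u i) z}) ->
  weak_partial Omega j beta g -> test_function Omega phi -> \sum_e edge_term j phi e = 0.
Proof.
move=> Lb Lg hb wp tphi; have hg := weak_partial_part Lb Lg hb wp.
have mO := measurable_Omega M.
have /(L2P _ mO)[mb _] := Lb; have /(L2P _ mO)[mg _] := Lg.
have := wp phi tphi; rewrite (mesh_ibp j tphi mb hb) (part_integral tphi mg hg).
by move/eqP; rewrite subr_eq addNr => /eqP.
Qed.

(* Testing with bumps concentrated at an edge shows that [beta] has no jump. *)
Lemma weak_gradient_match beta (g : 'I_2 -> R * R -> R) : L2 Omega beta ->
  (forall j, L2 Omega (g j)) ->
  (forall i, {ae leb2, forall z, That z -> beta (th_ i z) = qbil (u i) z}) ->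
  (forall j, weak_partial Omega j beta (g j)) -> edge_match.
Proof.
move=> Lb Lg hb wp e f ef; have [h1 h2] := ef.
set A := vt e.1 e.2; set B := vt e.1 (ordS e.2).
have AB : A <> B by apply: vtx_neq; exact: ab.
(* The jump across the edge, an affine function of the parameter. *)
pose eta (t : R) := qbil (u e.1) (loc_ e.1 (A + t *: (B - A))) -
   qbil (u f.1) (loc_ f.1 (A + t *: (B - A))).
have etaE t : eta t = ((1 - t) * u e.1 e.2 + t * u e.1 (ordS e.2)) -
    ((1 - t) * u f.1 (ordS f.2) + t * u f.1 f.2).
  rewrite /eta /A /B qbil_edge; last exact: ab.
  rewrite h1 h2; congr (_ - _).
  have -> : vt f.1 (ordS f.2) + t *: (vt f.1 f.2 - vt f.1 (ordS f.2)) =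
      vt f.1 f.2 + (1 - t) *: (vt f.1 (ordS f.2) - vt f.1 f.2).
    by apply: pairP; rewrite /= !scaleRE; ring.
  by rewrite qbil_edge; [ring|exact: ab].
suff H : forall t : R, 0 <= t <= 1 -> eta t = 0.
  have t0 : 0 <= (0 : R) <= 1 by rewrite lexx ler01.
  have t1 : 0 <= (1 : R) <= 1 by rewrite lexx ler01.
  move: (H 0 t0) (H 1 t1); rewrite !etaE; split; lra.
have ceta : continuous (fun z : R * R => eta z.1).
  have -> : (fun z : R * R => eta z.1) = linf (u e.1 (ordS e.2) - u f.1 f.2 - (u e.1 e.2 - u f.1 (ordS f.2))) 0
      (u e.1 e.2 - u f.1 (ordS f.2)).
    by apply/funext => z; rewrite etaE /linf; ring.
  exact: continuous_linf.
(* The fundamental lemma is two-dimensional, so the jump is extended as a constant in the second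
   variable. *)
suff H : {ae leb2, forall z, That z -> eta z.1 = 0}.
  move=> t t01; apply: (continuous_ae0 ceta H (z := (t, 0))).
  by apply/ThatP; rewrite /= lexx ler01.
apply: (fundamental_lemma (g := fun z => eta z.1)); first exact: continuous_integrable_That.
move=> x0 x1 y0 y1 m x00 x11 _ _.
rewrite Rintegral_That_xy; last by apply: continuousMf => //; exact: continuous_steep_bump2.
apply: Rintegral_eq0 => y _.
(* For each fixed [y] the factor [kap / k0] gives the bump across the edge the trace
   [steep m (bump2 x0 x1 y0 y1 (t, y))] on the edge itself. *)
set kap := bump y0 y1 y.
pose k0 : R := bump (-2^-1) 2^-1 0.
have k00 : k0 != 0 by rewrite gt_eqF// bump_gt0E; lra.
pose phi := box_bump A B x0 x1 (-2^-1) 2^-1 (kap / k0) m.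
have tphi : test_function Omega phi.
  apply: test_box_bump => // -[z1 z2] /= hz1 hz2.
  have hz1' : 0 < z1 < 1 by lra.
  have hz2' : -1 < z2 < 1 by lra.
  by have [] := partner_double M ef hz1' hz2'.
have cphi : continuous phi by have [/pd_continuous] := test_pd tphi.
have ef_neq : e != f.
  apply/eqP => E; move: h1; rewrite -E => /(vtx_inj (@ab _)).
  by move: (e.2); elim/I4_ind.
have Z j kl : kl != e -> kl != f -> edge_term j phi kl = 0.
  case: kl => k l ne nf; apply: edge_term_eq0 => t t01; set p := _ + _.
  have pE : p = th_ k (rotz l (t, 0)) by rewrite /p edge_th th_rotz.
  have kp : sq k p.
    rewrite pE; apply/square_on_th; first exact: ab.
    by apply/That_rotz/ThatP => /=; rewrite lexx ler01.
  apply: contrapT => /eqP /box_bump_neq0; case E : (loc A B p) => [x' y'] /= [hx hy].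
  have hx1 : 0 < x' < 1 by case/andP: hx => hx1 hx2; rewrite (lt_trans x00 hx1) (lt_trans hx2 x11).
  have hy1 : -1 < y' < 1 by exact: (half_itvS hy).1.
  have pE' : p = th A B (x', y') by rewrite -E locK.
  have [] := partner_interior M ef hx1 hy1 (j := k); first by rewrite -/A -/B -pE'.
  - move=> ke; move: pE; rewrite pE' /A /B th_rotz -ke => /(th_inj (@ab k)) Er.
    by move/eqP: ne; apply; rewrite [RHS]surjective_pairing -ke (rotz_edge Er hx1 hy).
  - move=> kf; move: pE; rewrite pE' /A /B h1 h2.
    have -> : th (vt f.1 (ordS f.2)) (vt f.1 f.2) (x', y') = th (vt f.1 f.2) (vt f.1 (ordS f.2)) (1 - x', - y').
      by move: (vt f.1 _) (vt f.1 _) => Q1 Q2; rewrite !thE; apply: pairP => /=; ring.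
    rewrite th_rotz -kf => /(th_inj (@ab k)) Er.
    move/eqP: nf; apply; rewrite [RHS]surjective_pairing -kf (rotz_edge Er)//.
    + exact: onem_itv.
    + exact: (half_itvS hy).2.
have S j : edge_term j phi e + edge_term j phi f = 0.
  by rewrite -(sum_two ef_neq (Z j)); exact: edge_term_sum0 Lb (Lg j) hb (wp j) tphi.
have S' j : normal (a e.1) (b e.1) j e.2 *
    \int[mu]_(t in `[0, 1]) (eta t * steep m (bump2 x0 x1 y0 y1 (t, y))) = 0.
  have ce : continuous (fun p => qbil (u e.1) (loc_ e.1 p) * phi p).
    by apply: continuousMf => //; apply: continuous_qbil_loc; exact: ab.
  have cf : continuous (fun p => qbil (u f.1) (loc_ f.1 p) * phi p).
    by apply: continuousMf => //; apply: continuous_qbil_loc; exact: ab.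
  have <- : edge_mean A B (fun p => qbil (u e.1) (loc_ e.1 p) * phi p) -
      edge_mean A B (fun p => qbil (u f.1) (loc_ f.1 p) * phi p) =
      \int[mu]_(t in `[0, 1]) (eta t * steep m (bump2 x0 x1 y0 y1 (t, y))).
    rewrite /edge_mean -RintegralB//; last 2 first.
    - exact: (continuous_integrable01 (@continuous_line _ _ A B ce)).
    - exact: (continuous_integrable01 (@continuous_line _ _ A B cf)).
    apply: eq_Rintegral => t _; rewrite -mulrBl; congr (_ * _).
    rewrite edge_th /phi /box_bump thK// /bump2 /=; congr (steep _ _); rewrite -/k0 -/kap.
    by field.
  have := S j; rewrite /edge_term (normal_partner j (partner_sym ef)) -h1 -h2 -/A -/B.
  by rewrite (edge_meanC A B cf) mulNr -mulrBr.
(* The two components of the normal cannot both vanish, as [A] and [B] differ. *)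
have := S' 0; have := S' 1; rewrite /normal /= -/A -/B.
move: (Rintegral _ _ _) => I hI1 hI2; apply: contrapT => /eqP I0.
apply: AB; apply: pairP; apply/eqP; rewrite eq_sym -subr_eq0.
- by move/eqP: hI1; rewrite mulf_eq0 (negbTE I0) orbF oppr_eq0.
- by move/eqP: hI2; rewrite mulf_eq0 (negbTE I0) orbF.
Qed.

End WeakDerivatives.

(** * Shape functions and the transformation of fields *)

Section ShapeFunctions.
Context {R : realType}.
Implicit Types (q : R * R -> R).

Definition swap (z : R * R) : R * R := (z.2, z.1).

Lemma Qrot_qrot q : Qrot q -> exists m, forall z, q z = qrot m z.
Proof.
move=> [a [b [c [d qE]]]].
(* Coefficients of [q] expanded about the centre; [S] and [D] are the sums of the means over the two
   pairs of opposite edges. *)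
pose p := b + d; pose r := c - d; pose s := 2 * d; pose k := a + b / 2 + c / 2.
pose S := 2 * k + s / 6; pose D := 2 * k - s / 6.
exists (fun i : 'I_4 => nth 0 [:: (D - r) / 2; (S + p) / 2; (D + r) / 2; (S - p) / 2] i) => z.
by rewrite qE /qrot /gradc /= /S /D /p /r /s /k; field.
Qed.

Lemma qrot_Qrot m : Qrot (qrot m : R * R -> R).
Proof.
set g := (gradc m).
exists ((m ord0 + m (ordS ord0) + m (ordS (ordS ord0)) + m (ordS (ordS (ordS ord0)))) / 4
   - g.1.1 / 2 - g.1.2 / 2), (g.1.1 - g.2 / 2), (g.1.2 + g.2 / 2), (g.2 / 2) => z.
by rewrite /qrot -/g; field.
Qed.

Lemma Qrot_swap q : Qrot q -> Qrot (q \o swap).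
Proof.
by move=> [a [b [c [d qE]]]]; exists a, c, b, (- d) => z; rewrite /= qE /=; ring.
Qed.

Lemma Q1_qbil q : Q1 q -> exists u, forall z, q z = qbil u z.
Proof.
move=> [a [b [c [d qE]]]].
exists (fun i : 'I_4 => nth 0 [:: a; a + b; a + b + c + d; a + c] i) => z.
by rewrite qE /qbil /=; ring.
Qed.

Lemma qbil_Q1 u : Q1 (qbil u : R * R -> R).
Proof.
exists (u ord0), (u (ordS ord0) - u ord0), (u (ordS (ordS (ordS ord0))) - u ord0),
  (u ord0 - u (ordS ord0) + u (ordS (ordS ord0)) - u (ordS (ordS (ordS ord0)))) => z.
by rewrite /qbil; ring.
Qed.

Lemma Q1_swap q : Q1 q -> Q1 (q \o swap).
Proof.
by move=> [a [b [c [d qE]]]]; exists a, c, b, d => z; rewrite /= qE /=; ring.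
Qed.

Lemma qbil_shift u (k : R) z : qbil (fun i => u i - k) z = qbil u z - k.
Proof. by rewrite /qbil; ring. Qed.

Lemma curlc_shift u (k : R) : curlc (fun i => u i - k) = curlc u.
Proof. by rewrite /curlc; congr (_, _, _); ring. Qed.

Lemma ord2P (l : 'I_2) : l = 0 \/ l = 1.
Proof. by case: l => -[|[|//]] h; [left|right]; exact/val_inj. Qed.

Lemma sum_ord2 (F : 'I_2 -> R) : \sum_l F l = F 0 + F 1.
Proof. by rewrite big_ord_recl big_ord1; congr (_ + F _); exact/val_inj. Qed.

Lemma mul_mx2 (x11 x12 x21 x22 y11 y12 y21 y22 : R) :
  mx2 x11 x12 x21 x22 *m mx2 y11 y12 y21 y22 =
  mx2 (x11 * y11 + x12 * y21) (x11 * y12 + x12 * y22) (x21 * y11 + x22 * y21) (x21 * y12 + x22 * y22).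
Proof.
apply/matrixP => k l; rewrite !mxE sum_ord2 !mxE /=.
by have [->|->] := ord2P k; have [->|->] := ord2P l.
Qed.

Lemma tr_mx2 (x11 x12 x21 x22 : R) : (mx2 x11 x12 x21 x22)^T = mx2 x11 x21 x12 x22.
Proof.
apply/matrixP => k l; rewrite !mxE.
by have [->|->] := ord2P k; have [->|->] := ord2P l.
Qed.

Lemma mul_mx2_col (x11 x12 x21 x22 : R) (r : 'cV[R]_2) :
  mx2 x11 x12 x21 x22 *m r = col2 (x11 * r 0 0 + x12 * r 1 0) (x21 * r 0 0 + x22 * r 1 0).
Proof.
apply/colP => k; rewrite !mxE sum_ord2 !mxE /=.
by have [->|->] := ord2P k.
Qed.

(** Conjugation by the quarter turn makes the adjugate out of the transposed Jacobian: this is the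
    contravariant Piola transformation. *)
Lemma piola_mul (J11 J12 J21 J22 : R) (r : 'cV[R]_2) :
  mx2 0 1 (-1) 0 *m (mx2 J11 J12 J21 J22)^T *m mx2 0 (-1) 1 0 *m r =
  col2 (J22 * r 0 0 - J12 * r 1 0) (- J21 * r 0 0 + J11 * r 1 0).
Proof. by rewrite tr_mx2 !mul_mx2 mul_mx2_col; congr col2; ring. Qed.

End ShapeFunctions.

(** * The three spaces in terms of coefficients *)

Section MeshSpaces.
Context {R : realType}.
Notation P := (measurableTypeR R * measurableTypeR R)%type.
Notation mu := (@lebesgue_measure R).
Notation leb2 := (@leb2 R).

Context (Omega : set (R * R)) (n : nat) (a b : 'I_n -> R * R).
Context (M : is_mesh Omega a b).

Local Notation sq i := (square_on (a i) (b i)).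
Local Notation vt i := (vtx (a i) (b i)).
Local Notation th_ i := (th (a i) (b i)).
Local Notation loc_ i := (loc (a i) (b i)).
Local Notation sqn_ i := (sqn (a i) (b i)).
Local Notation fld_ i := (fld (a i) (b i)).
Local Notation partner := (partner a b).
Let ab i : a i <> b i. Proof. exact: (mesh_neq M). Qed.

Context (TT : set (set (R * R))) (psi : set (R * R) -> R * R -> R * R).
Context (TTE : forall T, TT T <-> exists i, T = sq i).
Context (psiE : forall i, (forall z, That z -> psi (sq i) z = th_ i z) \/
  (forall z, That z -> psi (sq i) z = th_ i (swap z))).

Implicit Types (s : R * R -> 'cV[R]_2) (c : 'I_n -> R * R * R) (m u : 'I_n -> 'I_4 -> R).

Let TTsq i : TT (sq i). Proof. by apply/TTE; exists i. Qed.

(** One boolean serves all [q], so membership in a space that is invariant under the swap passes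
    from [psi] to the similarity and back. *)
Lemma psi_ae V (f : R * R -> V) i : exists sw : bool, forall q,
  f \o psi (sq i) = q %[ae leb2 in That] <->
  {ae leb2, forall z, That z -> f (th_ i z) = q (if sw then swap z else z)}.
Proof.
have [h|h] := psiE i.
  by exists false => q; apply: ae_iff => z; split => H Tz; rewrite -?H//= h.
exists true => q; apply: iff_trans (ae_swap (fun z => f (th_ i z) = q (swap z))).
apply: ae_iff => -[x y]; split => H Tz.
  by rewrite /swap /= -H//= h.
by rewrite /= h// H.
Qed.

Definition has_coef s c : Prop :=
  forall i, {ae leb2, forall z, That z -> forall l, s (th_ i z) l 0 = fld_ i (c i) l z}.

Lemma has_coef1 s c : has_coef s c ->
  forall i l, {ae leb2, forall z, That z -> s (th_ i z) l 0 = fld_ i (c i) l z}.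
Proof. by move=> sc i l; apply: aeS (sc i) => z h /h. Qed.

Lemma L2_measurable (f : R * R -> R) : L2 Omega f -> measurable_fun Omega (f : P -> R).
Proof. by move/(L2P _ (measurable_Omega M)) => []. Qed.

Definition coef_field c (p : R * R) : 'cV[R]_2 :=
  \col_l glue a b (fun i p => fld_ i (c i) l (loc_ i p)) p.

Lemma has_coef_field c : L2field Omega (coef_field c) /\ has_coef (coef_field c) c.
Proof.
have H l i : {ae leb2, forall z, That z ->
    coef_field c (th_ i z) l 0 = fld_ i (c i) l z}.
  apply: aeS (glue_th M (fun i p => fld_ i (c i) l (loc_ i p)) i) => z h Tz.
  by rewrite mxE h// thK//; exact: ab.
split; last by move=> i; apply: aeS (ae_fin (H^~ i)) => z h Tz l; exact: h.
move=> l; apply: (L2_mesh M (G := fun i => fld_ i (c i) l)) (H l); last first.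
  by move=> i; exact: continuous_fld.
apply: measurable_funTS; have := @measurable_glue R n a b
  (fun i p => fld_ i (c i) l (loc_ i p)).
rewrite (_ : (fun p => coef_field c p l 0) = glue a b (fun i p => fld_ i (c i) l (loc_ i p))).
  apply => i p; apply: (@continuous_comp _ _ _ (loc_ i) (fld_ i (c i) l)).
    by apply: continuous_loc; exact: ab.
  exact: continuous_fld.
by apply/funext => p; rewrite mxE.
Qed.

Lemma Rintegral_ip s1 s2 c1 c2 : L2field Omega s1 -> L2field Omega s2 ->
  has_coef s1 c1 -> has_coef s2 c2 ->
  \int[leb2]_(p in Omega) (\sum_(l < 2) s1 p l 0 * s2 p l 0) = \sum_i ip (c1 i) (c2 i).
Proof.
move=> L1 L2' h1 h2.
have mF : measurable_fun Omega ((fun p => \sum_(l < 2) s1 p l 0 * s2 p l 0) : P -> R).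
  by apply: measurable_sum => l; apply: measurable_funM; exact: L2_measurable.
have cG i : continuous (fun z => \sum_(l < 2) fld_ i (c1 i) l z * fld_ i (c2 i) l z).
  rewrite (_ : (fun z => _) = (fun z => fld_ i (c1 i) ord0 z * fld_ i (c2 i) ord0 z +
     fld_ i (c1 i) (lift ord0 ord0) z * fld_ i (c2 i) (lift ord0 ord0) z)).
    by apply: continuousDf; apply: continuousMf; exact: continuous_fld.
  by apply/funext => z; rewrite big_ord_recl big_ord1.
have FG i : {ae leb2, forall z, That z -> \sum_(l < 2) s1 (th_ i z) l 0 * s2 (th_ i z) l 0 =
    \sum_(l < 2) fld_ i (c1 i) l z * fld_ i (c2 i) l z}.
  apply: (aeS2 _ (h1 i) (h2 i)) => z e1 e2 Tz.
  by apply: eq_bigr => l _; rewrite e1// e2.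
have [_ ->] := Rintegral_mesh M mF cG FG.
by apply: eq_bigr => i _; rewrite fld_ip//; exact: ab.
Qed.

Lemma has_coef_ae s s' c : has_coef s c -> has_coef s' c -> s = s' %[ae leb2 in Omega].
Proof.
move=> h h'; apply/(ae_mesh M (fun p => s p = s' p)) => i.
apply: (aeS2 _ (h i) (h' i)) => z e e' Tz.
by apply/colP => l; rewrite e// e'.
Qed.

Lemma has_coef_aeE s s' c : s = s' %[ae leb2 in Omega] -> has_coef s' c -> has_coef s c.
Proof.
move=> /(ae_mesh M (fun p => s p = s' p)) h h' i.
by apply: (aeS2 _ (h i) (h' i)) => z e e' Tz l; rewrite e// e'.
Qed.

Definition addc (c c' : R * R * R) : R * R * R :=
  (c.1.1 + c'.1.1, c.1.2 + c'.1.2, c.2 + c'.2).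

Lemma has_coefD s s' c c' : has_coef s c -> has_coef s' c' ->
  has_coef (fun p => s p + s' p) (fun i => addc (c i) (c' i)).
Proof.
move=> h h' i; apply: (aeS2 _ (h i) (h' i)) => z e e' Tz l.
rewrite mxE e// e'// /fld -mulrDl; congr (_ / _).
by rewrite /fld1 /fld2 /=; ring.
Qed.

(** * Curls of the bilinear space *)

Lemma Curl_coef s : Curl_VQ1 Omega TT psi s ->
  exists2 u, edge_match a b u & has_coef s (fun i => curlc (u i)).
Proof.
move=> [beta [[[Lb _] _] bq] [Ls w1 w0]].
have /choice[u hu] : forall i, exists u : 'I_4 -> R, {ae leb2, forall z, That z -> beta (th_ i z) = qbil u z}.
  move=> i; have [q Qq /= bqi] := bq _ (TTsq i).
  have [sw /(_ q)[h _]] := psi_ae beta i.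
  have [u uE] : exists u : 'I_4 -> R, forall z, q (if sw then swap z else z) = qbil u z.
    by case: sw h => h; [exact: (Q1_qbil (Q1_swap Qq))|exact: Q1_qbil].
  by exists u; apply: aeS (h bqi) => z e Tz; rewrite e.
pose g (j : 'I_2) p := if j == 0 then - s p 1 0 else s p 0 0.
have Lg j : L2 Omega (g j).
  rewrite /g; case: (j == 0); last exact: Ls.
  by apply: L2N; [exact: (measurable_Omega M)|exact: Ls].
have wg j : weak_partial Omega j beta (g j).
  rewrite /g; case: (boolP (j == 0)) => [/eqP ->//|j0].
  by rewrite (_ : j = 1)//; apply/val_inj; move: j0; case: j => -[|[|]].
have um := weak_gradient_match M Lb Lg hu wg.
exists u => // i.
have H j := weak_partial_part M Lb (Lg j) hu (wg j) i.
apply: (aeS2 _ (H 0) (H 1)) => z; rewrite /g /part /= => h0 h1 Tz l.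
case: (boolP (l == 0)) => [/eqP ->|l0]; first exact: h1.
rewrite (_ : l = 1); last by apply/val_inj; move: l0; case: l => -[|[|]].
by apply: oppr_inj; exact: h0.
Qed.

Lemma coef_Curl s u : L2field Omega s -> edge_match a b u ->
  has_coef s (fun i => curlc (u i)) -> Curl_VQ1 Omega TT psi s.
Proof.
move=> Ls um sc.
(* The mean value; subtracting it places the potential in [Yspace] without changing its curl. *)
pose k := (\sum_i sqn_ i * \int[leb2]_(z in That) qbil (u i) z) / \sum_i sqn_ i.
pose u' i e := u i e - k.
have um' : edge_match a b u'.
  by move=> e f ef; have [h1 h2] := um e f ef; rewrite /u' h1 h2.
pose beta := glue a b (fun i p => qbil (u' i) (loc_ i p)).
have cv i : continuous (fun p => qbil (u' i) (loc_ i p)) by apply: continuous_qbil_loc; exact: ab.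
have mb : measurable_fun Omega (beta : P -> R).
  apply: measurable_funTS; have := @measurable_glue R n a b (fun i p => qbil (u' i) (loc_ i p)).
  by apply.
have hb i : {ae leb2, forall z, That z -> beta (th_ i z) = qbil (u' i) z}.
  apply: aeS (glue_th M (fun i p => qbil (u' i) (loc_ i p)) i) => z h Tz.
  by rewrite /beta h// thK//; exact: ab.
have cq i : continuous (qbil (u' i)) by exact: continuous_qbil.
have Lb : L2 Omega beta := L2_mesh M mb cq hb.
have w1 : weak_partial Omega 1 beta (fun p => s p 0 0).
  apply: (weak_partial_match M um' mb (L2_measurable (Ls 0)) hb) => i.
  apply: aeS (has_coef1 sc i 0) => z h Tz.
  by rewrite h// /part /= curlc_shift.
have w0 : weak_partial Omega 0 beta (fun p => - s p 1 0).
  apply: (weak_partial_match M um' mb (measurable_funN (L2_measurable (Ls 1))) hb) => i.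
  apply: aeS (has_coef1 sc i 1) => z h Tz.
  by rewrite -[LHS]/(- s (th_ i z) 1 0) h// /part /= curlc_shift.
exists beta; last by split.
split.
  split; first split => //.
    move=> j; case: (boolP (j == 0)) => j0.
      rewrite (eqP j0); exists (fun p => - s p 1 0) => //.
      by apply: L2N; [exact: (measurable_Omega M)|exact: Ls].
    rewrite (_ : j = 1); last by apply/val_inj; move: j0; case: (j) => -[|[|]].
    by exists (fun p => s p 0 0).
  have [_ ->] := Rintegral_mesh M mb cq hb.
  have E i : \int[leb2]_(z in That) qbil (u' i) z = \int[leb2]_(z in That) qbil (u i) z - k.
    rewrite (_ : qbil (u' i) = (fun z => qbil (u i) z + (fun=> - k) z)); last first.
      by apply/funext => z; rewrite /u' qbil_shift.
    rewrite RintegralThatD; [|exact: continuous_qbil|exact: cst_continuous].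
    congr (_ + _); rewrite Rintegral_cst; last exact: measurable_That.
    by rewrite [X in fine X]leb2_That mulr1.
  under eq_bigr => i _ do rewrite E mulrBr.
  rewrite sumrB -mulr_suml /k.
  (* If the total area is zero, the quotient [k] takes a default value, but then every term
     vanishes. *)
  have [K0|K0] := eqVneq (\sum_i sqn_ i) 0; last by rewrite mulrC divfK ?subrr.
  have s0 i : sqn_ i = 0.
    by apply: (psumr_eq0P _ K0) => // l _; rewrite ltW// sqn_gt0//; exact: ab.
  by rewrite K0 mul0r subr0; apply: big1 => i _; rewrite s0 mul0r.
move=> T /TTE[i ->]; have [sw hsw] := psi_ae beta i.
case: sw hsw => hsw.
  exists (qbil (u' i) \o swap); first by apply: Q1_swap; exact: qbil_Q1.
  by apply/hsw; apply: aeS (hb i) => -[x y] h Tz; rewrite h.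
exists (qbil (u' i)); first exact: qbil_Q1.
by apply/hsw.
Qed.

(** * Piecewise gradients of the rotated bilinear space *)

Definition grad_match m : Prop :=
  (forall e f, partner e f -> m e.1 e.2 = m f.1 f.2) /\
  (forall e, (forall f, ~ partner e f) -> m e.1 e.2 = 0).

Lemma partner_neq e f : partner e f -> e.1 != f.1.
Proof.
move=> [h1 h2]; apply/eqP => ef; move: h1 h2; rewrite -ef.
move=> /(vtx_inj (@ab e.1)) -> /(vtx_inj (@ab e.1)).
by elim/I4_ind: (f.2).
Qed.

Lemma enorm_neq0 (A B : R * R) : A <> B -> enorm (B - A) != 0.
Proof.
move=> AB; rewrite /enorm gt_eqF// sqrtr_gt0 /dot /=.
by have := sqn_gt0 AB; rewrite /sqn !expr2.
Qed.

Lemma edge_in_square i k (t : R) : 0 <= t <= 1 ->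
  sq i (vt i k + t *: (vt i (ordS k) - vt i k)).
Proof.
move=> t01; rewrite edge_th th_rotz; apply/square_on_th; first exact: ab.
by apply/That_rotz/ThatP; rewrite /= lexx ler01.
Qed.

(** Continuity up to the boundary turns equality almost everywhere into equality on the closed
    square, so the edge integrals of [w] are those of the polynomial. *)
Lemma trace_qrot i (v w : R * R -> R) mi : trace_rep (sq i) v w ->
  {ae leb2, forall z, That z -> v (th_ i z) = qrot mi z} ->
  forall p, sq i p -> w p = qrot mi (loc_ i p).
Proof.
move=> [cw vw] vq p sp; have /square_onP := sp => /(_ (@ab i)) Tz.
have cq := @continuous_qrot_loc R (a i) (b i) mi (@ab i).
have cqz : continuous (qrot mi) by exact: pd_continuous (pd_qrot mi).
apply/eqP; rewrite -subr_eq0; apply/eqP.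
rewrite -{1}(locK (@ab i) p).
apply: (@within_ae0 _ (fun z => w (th_ i z) - qrot mi z)) => //.
  have /(ae_square _ (@ab i)) := vw => h.
  by apply: (aeS2 _ h vq) => z e1 e2 Tz'; rewrite -e1// e2// subrr.
apply/subspace_continuousP => z Tz'.
apply: cvgB; last by apply: cvg_within_filter; exact: cqz.
move=> X wX; have /subspace_continuousP := cw.
move=> /(_ (th_ i z) ((square_on_th z (@ab i)).2 Tz')) /(_ X wX) nX.
have nX2 := @continuous_th R (a i) (b i) z _ nX.
apply: (@filterS _ (nbhs z) _ (fun y => sq i (th_ i y) -> X (w (th_ i y)))) nX2 => y h Ty.
by apply: h; exact/(square_on_th y (@ab i)).
Qed.

(** The interior analogue: equality on an open set determines the derivatives of the
    representative. *)
Lemma diff_qrot i (v w : R * R -> R) mi : v = w %[ae leb2 in sq i] ->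
  (forall p, interior (sq i) p -> differentiable w p) ->
  {ae leb2, forall z, That z -> v (th_ i z) = qrot mi z} ->
  forall p, interior (sq i) p -> w p = qrot mi (loc_ i p).
Proof.
move=> vw dw vq p ip; have /interior_square_on := ip => /(_ (@ab i)) Tz.
have cqz : continuous (qrot mi) by exact: pd_continuous (pd_qrot mi).
pose f z := w (th_ i z) - qrot mi z.
apply/eqP; rewrite -subr_eq0; apply/eqP.
rewrite -{1}(locK (@ab i) p) -/(f (loc_ i p)); apply: contrapT => fz.
have cf : {for loc_ i p, continuous f}.
  apply: cvgB; last exact: cqz.
  apply: (@continuous_comp _ _ _ (th_ i) w); first exact: continuous_th.
  by rewrite locK; [apply: differentiable_continuous; exact: dw|exact: ab].
have f0 : {ae leb2, forall z, That z -> f z = 0}.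
  have /(ae_square _ (@ab i)) := vw => h.
  by apply: (aeS2 _ h vq) => z e1 e2 Tz'; rewrite /f -e1// e2// subrr.
have nX : nbhs (loc_ i p) (f @^-1` [set x | x != 0]).
  by apply: cf; apply: open_nbhs_nbhs; split; [exact: open_neq|apply/eqP].
have [] := @ae_open_point _ _ (interior (f @^-1` [set x | x != 0]) `&` Tho) f0.
- by apply: openI; [exact: open_interior|exact: open_Tho].
- by exists (loc_ i p).
- by move=> z [/interior_subset /= Xz /Tho_That Tz'] /(_ Tz') /eqP; apply/negP.
Qed.

Lemma pd_evec f f1 f2 (l : 'I_2) (p : R * R) : pd f f1 f2 ->
  'D_(evec l) f p = if l == 0 then f1 p else f2 p.
Proof.
move=> [_ Df]; rewrite /evec; case: ifP => _; rewrite (Df p) /=.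
  by rewrite mul1r mul0r addr0.
by rewrite mul1r mul0r add0r.
Qed.

Lemma derive_qrot_loc i mi l p :
  'D_(evec l) (fun p => qrot mi (loc_ i p)) p = fld_ i (gradc mi) l (loc_ i p).
Proof.
rewrite (pd_evec l p (pd_qrot_loc mi (@ab i))).
case: (boolP (l == 0)) => [/eqP -> //|l0].
by rewrite (_ : l = 1)//; apply/val_inj; move: l0; case: (l) => -[|[|]].
Qed.

Lemma grad_coef s : gradNC_VrotNC Omega TT psi s ->
  exists2 m, grad_match m & has_coef s (fun i => gradc (m i)).
Proof.
move=> [v [Lv vq [w [wtr wedge wbdry]]] [Ls grad]].
have /choice[m hm] : forall i, exists m : 'I_4 -> R, {ae leb2, forall z, That z -> v (th_ i z) = qrot m z}.
  move=> i; have [q Qq /= vqi] := vq _ (TTsq i).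
  have [sw /(_ q)[h _]] := psi_ae v i.
  have [m mE] : exists m : 'I_4 -> R, forall z, q (if sw then swap z else z) = qrot m z.
    by case: sw h => h; [exact: (Qrot_qrot (Qrot_swap Qq))|exact: Qrot_qrot].
  by exists m; apply: aeS (h vqi) => z e Tz; rewrite e.
have wE i p (sp : sq i p) := trace_qrot (wtr _ (TTsq i)) (hm i) sp.
have wI i k : edge_integral (vt i k) (vt i (ordS k)) (w (sq i)) =
    enorm (vt i (ordS k) - vt i k) * m i k.
  rewrite -(qrot_mean (m i) k (@ab i)); congr (_ * _).
  apply: eq_Rintegral => t; rewrite inE /= in_itv /= => t01.
  by rewrite wE//; exact: edge_in_square.
(* [is_edge] admits both orders of the end points, and the partner sees the edge reversed. *)
have wI' i k : edge_integral (vt i (ordS k)) (vt i k) (w (sq i)) =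
    enorm (vt i k - vt i (ordS k)) * m i k.
  rewrite -(qrot_mean (m i) k (@ab i)); congr (_ * _).
  rewrite -edge_meanC; last by apply: continuous_qrot_loc; exact: ab.
  apply: eq_Rintegral => t; rewrite inE /= in_itv /= => t01.
  rewrite wE//.
  have -> : vt i (ordS k) + t *: (vt i k - vt i (ordS k)) =
     vt i k + (1 - t) *: (vt i (ordS k) - vt i k).
    by move: (vt i k) (vt i (ordS k)) => Q1 Q2; apply: pairP; rewrite /= !scaleRE; ring.
  by apply: edge_in_square; lra.
exists m.
  split=> [e f ef|e ne].
    have [h1 h2] := ef.
    have ev : is_edge (sq e.1) (vt e.1 e.2) (vt e.1 (ordS e.2)) by apply: vtx_is_edge; exact: ab.
    have fv : is_edge (sq f.1) (vt e.1 e.2) (vt e.1 (ordS e.2)).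
      rewrite h1 h2; have [h3 h4] : is_edge (sq f.1) (vt f.1 f.2) (vt f.1 (ordS f.2)).
        by apply: vtx_is_edge; exact: ab.
      by split; [exact: nesym|case: h4; [right|left]].
    have sne : sq e.1 <> sq f.1.
      by move/(mesh_inj M) => E; move: (partner_neq ef); rewrite E eqxx.
    have E : edge_integral (vt e.1 e.2) (vt e.1 (ordS e.2)) (w (sq f.1)) =
        enorm (vt e.1 (ordS e.2) - vt e.1 e.2) * m f.1 f.2 by rewrite h1 h2 wI'.
    have := wedge _ _ _ _ (TTsq e.1) (TTsq f.1) sne ev fv.
    rewrite wI E; apply: mulfI; apply: enorm_neq0.
    by apply: vtx_neq; exact: ab.
  have := wbdry _ _ _ (TTsq e.1) (vtx_is_edge e.2 (@ab e.1)) (no_partner_bdry M (i := e.1) (k := e.2) _).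
  rewrite wI => /(_ _)/eqP; rewrite mulf_eq0 => h.
  have {}h := h (fun f => ne f).
  have en : enorm (vt e.1 (ordS e.2) - vt e.1 e.2) != 0.
    by apply: enorm_neq0; apply: vtx_neq; exact: ab.
  by move: h; rewrite (negbTE en) => /eqP.
move=> i; have [w' [vw' dw' sw']] := grad _ (TTsq i).
have w'E := diff_qrot vw' dw' (hm i).
have h1 := proj1 (ae_int_square (fun p => s p = \col_l 'D_(evec l) w' p) (@ab i)) sw'.
apply/ae_That_Tho; have /ae_That_Tho := h1; apply: aeS => z e Tz l.
rewrite e// mxE.
have iz : interior (sq i) (th_ i z) by apply/interior_square_on_th => //; exact: ab.
have near_eq : \forall p \near th_ i z, w' p = qrot (m i) (loc_ i p).
  have : nbhs (th_ i z) (interior (sq i)).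
    by apply: open_nbhs_nbhs; split => //; exact: open_interior.
  by apply: filterS => p; exact: w'E.
rewrite (near_eq_derive _ near_eq) derive_qrot_loc thK//; exact: ab.
Qed.

Lemma coef_grad s m : L2field Omega s -> grad_match m ->
  has_coef s (fun i => gradc (m i)) -> gradNC_VrotNC Omega TT psi s.
Proof.
move=> Ls [mm m0] sc.
pose f i p := qrot (m i) (loc_ i p).
have cf i : continuous (f i) by apply: continuous_qrot_loc; exact: ab.
have cq i : continuous (qrot (m i)) by exact: pd_continuous (pd_qrot (m i)).
pose v := glue a b f.
have hv i : {ae leb2, forall z, That z -> v (th_ i z) = qrot (m i) z}.
  apply: aeS (glue_th M f i) => z h Tz.
  by rewrite /v h// /f thK//; exact: ab.
have mv : measurable_fun Omega (v : P -> R).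
  by apply: measurable_funTS; have := @measurable_glue R n a b f; apply.
have hvf i : v = f i %[ae leb2 in sq i].
  apply: (proj2 (ae_square (fun p => v p = f i p) (@ab i))).
  exact: (glue_th M f i).
exists v; last first.
  split; first exact: Ls.
  move=> T /TTE[i ->]; exists (f i); split; first exact: hvf.
    by move=> p _; case: (pd_qrot_loc (m i) (@ab i)).
  apply: (proj2 (ae_int_square (fun p => s p = \col_l 'D_(evec l) (f i) p) (@ab i))).
  apply: aeS (sc i) => z h Tz; apply/colP => l.
  by rewrite mxE h// derive_qrot_loc thK//; exact: ab.
split.
- exact: (L2_mesh M mv cq hv).
- move=> T /TTE[i ->]; have [sw hsw] := psi_ae v i.
  case: sw hsw => hsw.
    exists (qrot (m i) \o swap); first by apply: Qrot_swap; exact: qrot_Qrot.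
    by apply/hsw; apply: aeS (hv i) => -[x y] h Tz; rewrite h.
  exists (qrot (m i)); first exact: qrot_Qrot.
  by apply/hsw.
have /choice[w wE] : forall T, exists w : R * R -> R, forall i, T = sq i -> w = f i.
  move=> T; have [[i ->]|nT] := pselect (exists i, T = sq i).
    by exists (f i) => j /(mesh_inj M) ->.
  by exists (fun=> 0) => i Ti; case: nT; exists i.
have wS i : w (sq i) = f i by exact: wE.
have fk i k : edge_mean (vt i k) (vt i (ordS k)) (f i) = m i k by apply: qrot_mean; exact: ab.
have fk' i k : edge_mean (vt i (ordS k)) (vt i k) (f i) = m i k by rewrite edge_meanC.
exists w; split.
- move=> T /TTE[i ->]; rewrite wS; split; last exact: hvf.
  by apply: continuous_subspaceT; exact: cf.
- move=> T1 T2 A B /TTE[i ->] /TTE[j ->] ij e1 e2; rewrite !wS.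
  have ij' : i != j by apply/eqP => E; apply: ij; rewrite E.
  rewrite /edge_integral -!/(edge_mean _ _ _); congr (_ * _).
  have [k [l [kl]]] := shared_edge M ij' e1 e2.
  have E := mm _ _ kl; case: (kl) => /= h1 h2.
  case=> -[-> ->]; rewrite ?fk ?fk' h1 h2 ?fk ?fk'; exact: E.
- move=> T A B /TTE[i ->] e1 sb; rewrite wS /edge_integral -/(edge_mean _ _ _).
  have [k kE] := is_edge_vtx (@ab i) e1.
  have nk : forall g, ~ partner (i, k) g.
    move=> g /(partner_not_bdry M); apply => /=.
    by case: kE sb => -[-> ->]; rewrite // segmentC.
  by case: kE => -[-> ->]; rewrite ?fk ?fk' (m0 (i, k) nk) mulr0.
Qed.

(** * The Raviart-Thomas type space *)

Lemma Jac_local (phi g : R * R -> R * R) (l11 l12 l13 l21 l22 l23 : R) p :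
  (\forall q \near p, phi q = g q) ->
  (forall q, g q = (linf l11 l12 l13 q, linf l21 l22 l23 q)) ->
  Jac phi p = mx2 l11 l12 l21 l22.
Proof.
move=> near_eq gE; apply/matrixP => k l; rewrite !mxE.
have E : \forall q \near p, (coord2 k \o phi) q = (coord2 k \o g) q.
  by apply: filterS near_eq => q /= ->.
rewrite (near_eq_derive _ E).
have [->|->] := ord2P k.
  have -> : coord2 0 \o g = linf l11 l12 l13 by apply/funext => q; rewrite /= gE.
  by rewrite (pd_evec l p (pd_linf l11 l12 l13)).
have -> : coord2 1 \o g = linf l21 l22 l23 by apply/funext => q; rewrite /= gE.
by rewrite (pd_evec l p (pd_linf l21 l22 l23)).
Qed.

Definition rt_hat (x : R) (d : 'cV[R]_2) (z : R * R) : 'cV[R]_2 := x *: col2 (- z.1) z.2 + d.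

Lemma psi_inj i : {in That &, injective (psi (sq i))}.
Proof.
move=> x y; rewrite !inE => Tx Ty; have [h|h] := psiE i; rewrite !h// => /(th_inj (@ab i)).
  by [].
by case: x y {Tx Ty} => [x1 x2] [y1 y2] [-> ->].
Qed.

Lemma near_square i z : Tho z -> \forall p \near th_ i z, interior (sq i) p.
Proof.
move=> Tz; apply: open_nbhs_nbhs; split; first exact: open_interior.
by apply/interior_square_on_th => //; exact: ab.
Qed.

Definition piola i (rho : R * R -> 'cV[R]_2) z : 'cV[R]_2 :=
  mx2 0 1 (-1) 0 *m (Jac (pinv That (psi (sq i))) (psi (sq i) z))^T *m mx2 0 (-1) 1 0 *m rho z.

(** Only the open square is compared, because the Jacobian of [pinv] is meaningful there; its
    boundary is a null set. *)
Lemma piola_ae s i sw (c0 : R * R * R) rho :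
  (forall z, That z -> psi (sq i) z = th_ i (if sw then swap z else z)) ->
  (forall z, Tho z -> piola i rho z = \col_l fld_ i c0 l (if sw then swap z else z)) ->
  s \o psi (sq i) = piola i rho %[ae leb2 in That] <->
  {ae leb2, forall z, That z -> forall l, s (th_ i z) l 0 = fld_ i c0 l z}.
Proof.
move=> h E.
have H : {ae leb2, forall z, That z -> forall l,
      s (th_ i (if sw then swap z else z)) l 0 = fld_ i c0 l (if sw then swap z else z)} <->
    {ae leb2, forall z, That z -> forall l, s (th_ i z) l 0 = fld_ i c0 l z}.
  case: (sw); last by [].
  exact: (ae_swap (fun z => forall l, s (th_ i z) l 0 = fld_ i c0 l z)).
apply: (iff_trans _ H).
have h1 := ae_That_Tho (fun z => (s \o psi (sq i)) z = piola i rho z).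
have h2 := ae_That_Tho (fun z => forall l,
  s (th_ i (if sw then swap z else z)) l 0 = fld_ i c0 l (if sw then swap z else z)).
apply: (iff_trans h1); apply: (iff_trans _ (iff_sym h2)); apply: ae_iff => z.
split => HH Tz.
  move=> l; have := HH Tz; rewrite E// [(s \o _) z]/= h; last exact: Tho_That.
  by move=> ->; rewrite mxE.
rewrite E// [LHS]/= h; last exact: Tho_That.
by apply/colP => l; rewrite HH// mxE.
Qed.

Lemma X1_piece s i : exists g : R -> 'cV[R]_2 -> R * R * R,
  (forall x d, s \o psi (sq i) = piola i (rt_hat x d) %[ae leb2 in That] <->
   {ae leb2, forall z, That z -> forall l, s (th_ i z) l 0 = fld_ i (g x d) l z}) /\
  forall c0 : R * R * R, exists x d, g x d = c0.
Proof.
have S0 := sqn_neq0 (@ab i).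
have pK z : That z -> pinv That (psi (sq i)) (psi (sq i) z) = z.
  by move=> Tz; apply: pinvKV; [exact: psi_inj|rewrite inE].
have locT p : interior (sq i) p -> That (loc_ i p).
  by move=> /interior_subset/square_onP => /(_ (@ab i)).
have [h|h] := psiE i.
  (* The field [rt_hat x d] expanded about the centre of the reference square. *)
  exists (fun x d => (d 0 0 - x / 2, d 1 0 + x / 2, - x)); split => [x d|c0]; last first.
    exists (- c0.2), (col2 (c0.1.1 - c0.2 / 2) (c0.1.2 + c0.2 / 2)); rewrite !mxE /=.
    by case: c0 => [[p q] s0] /=; congr (_, _, _); field.
  apply: (@piola_ae s i false) => // z Tz.
  have near_eq : \forall p \near th_ i z, pinv That (psi (sq i)) p = loc_ i p.
    apply: filterS (near_square i Tz) => p /locT Tp.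
    by rewrite -{1}(locK (@ab i) p) -h// pK.
  rewrite /piola h; last exact: Tho_That.
  rewrite (Jac_local near_eq (fun q => loc_linf q (@ab i))) piola_mul.
  move: S0; set S := sqn_ i => S0.
  by apply/colP => l; have [->|->] := ord2P l; rewrite !mxE /fld -/S /fld1 /fld2 /coord2 /=; field.
(* The swap reverses the orientation: the components are exchanged and the transformed field changes
   sign. *)
exists (fun x d => (- d 1 0 - x / 2, - d 0 0 + x / 2, - x)); split => [x d|c0]; last first.
  exists (- c0.2), (col2 (- c0.1.2 - c0.2 / 2) (- c0.1.1 + c0.2 / 2)); rewrite !mxE /=.
  by case: c0 => [[p q] s0] /=; congr (_, _, _); field.
apply: (@piola_ae s i true) => // z Tz.
have swT w : That w -> That (swap w) by move=> /ThatP[w1 w2]; apply/ThatP.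
have To : Tho (swap z) by move/ThoP: Tz => [z1 z2]; apply/ThoP.
have near_eq : \forall p \near th_ i (swap z), pinv That (psi (sq i)) p = swap (loc_ i p).
  apply: filterS (near_square i To) => p /locT Tp.
  have -> : p = psi (sq i) (swap (loc_ i p)).
    rewrite h; last exact: swT.
    by rewrite -[LHS](locK (@ab i)); congr th; case: (loc_ i p).
  rewrite pK; last exact: swT.
  rewrite h; last exact: swT.
  by rewrite thK; [case: (loc_ i p)|exact: ab].
rewrite /piola h; last exact: Tho_That.
have locE2 q : swap (loc_ i q) = _ := congr1 swap (loc_linf q (@ab i)).
rewrite (Jac_local near_eq locE2) piola_mul.
move: S0; set S := sqn_ i => S0.
by apply/colP => l; have [->|->] := ord2P l; rewrite !mxE /fld -/S /fld1 /fld2 /coord2 /=; field.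
Qed.

Lemma X1rect_coef s : X1rect Omega TT psi s <-> L2field Omega s /\ exists c, has_coef s c.
Proof.
split=> [[Ls H]|[Ls [c sc]]]; split=> //.
  suff /choice[c hc] : forall i, exists c0 : R * R * R,
      {ae leb2, forall z, That z -> forall l, s (th_ i z) l 0 = fld_ i c0 l z} by exists c.
  move=> i; have [rho [x [d rE]] hr] := H _ (TTsq i); have [g [gP _]] := X1_piece s i.
  exists (g x d); apply/gP; have -> : rt_hat x d = rho by apply/funext => z; rewrite rE.
  exact: hr.
move=> T /TTE[i ->]; have [g [gP /(_ (c i))[x [d gE]]]] := X1_piece s i.
exists (rt_hat x d); first by exists x, d.
by apply/gP; rewrite gE; exact: sc.
Qed.

End MeshSpaces.

(** * Orthogonal projection onto a finitely generated subspace *)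

Section OrthogonalProjection.
Context {R : realType} (V : lmodType R) (B : V -> V -> R).
Context (Bsym : forall x y, B x y = B y x).
Context (Blin : forall (k : R) x y z, B (k *: x + y) z = k * B x z + B y z).
Context (Bdef : forall x, B x x = 0 -> x = 0).

Definition linear_set (W : V -> Prop) := W 0 /\ forall (k : R) x y, W x -> W y -> W (k *: x + y).

(** Gram-Schmidt by induction on the generators. The span appears as the membership in every linear
    set containing them, which later yields [grad_match] by choosing the set. *)
Lemma orthogonal_projection (gs : seq V) (c : V) : exists w,
  (forall W, linear_set W -> (forall g, g \in gs -> W g) -> W w) /\
  forall g, g \in gs -> B (c - w) g = 0.
Proof.
have B0 y : B y 0 = 0.
  have := Blin 1 0 0 y; rewrite scale1r addr0 mul1r => /eqP.
  by rewrite -subr_eq0 opprD addrA subrr sub0r oppr_eq0 Bsym => /eqP.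
have BlinR k x y z : B z (k *: x + y) = k * B z x + B z y by rewrite Bsym Blin !(Bsym z).
elim: gs c => [|g gs ih] c; first by exists 0; split => // W [].
have [w [Ww ow]] := ih c; have [v [Wv ov]] := ih g.
have oK x y : (forall h, h \in gs -> B x h = 0) ->
    (forall W, linear_set W -> (forall g, g \in gs -> W g) -> W y) -> B x y = 0.
  move=> ox Wy; apply: (Wy (fun y => B x y = 0)) => //; split => // k y1 y2 h1 h2.
  by rewrite BlinR h1 h2 mulr0 addr0.
pose g' := g - v.
have gE : g = 1 *: g' + v by rewrite scale1r subrK.
(* In this case [g] already lies in the span of the previous generators. *)
have [g0|g0] := eqVneq (B g' g') 0.
  exists w; split=> [W lW Wg|h].
    by apply: Ww => // h hg; apply: Wg; rewrite inE hg orbT.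
  rewrite inE => /orP[/eqP ->|]; last exact: ow.
  by rewrite gE BlinR (Bdef g0) B0 mulr0 add0r; exact: oK.
exists ((B (c - w) g' / B g' g') *: g' + w); split=> [W lW Wg|h].
  have Ww' : W w by apply: Ww => // h hg; apply: Wg; rewrite inE hg orbT.
  have Wv' : W v by apply: Wv => // h hg; apply: Wg; rewrite inE hg orbT.
  have Wgg : W g by apply: Wg; rewrite inE eqxx.
  apply: lW.2 => //; rewrite /g' addrC -scaleN1r; exact: lW.2.
set k := _ / _.
have E : c - (k *: g' + w) = (- k) *: g' + (c - w) by rewrite opprD scaleNr addrCA.
rewrite inE E Blin => /orP[/eqP ->|hg]; last by rewrite ow// [B g' h]ov// mulr0 addr0.
rewrite gE !BlinR (oK g' v)// (oK (c - w) v)// /k !mul1r !addr0 mulNr divfK//.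
by rewrite addrC subrr.
Qed.

End OrthogonalProjection.

(** * Decomposition of the coefficients *)

Section Coefficients.
Context {R : realType}.

Context (Omega : set (R * R)) (n : nat) (a b : 'I_n -> R * R).
Context (M : is_mesh Omega a b).

Local Notation sq i := (square_on (a i) (b i)).
Local Notation vt i := (vtx (a i) (b i)).
Local Notation th_ i := (th (a i) (b i)).
Local Notation loc_ i := (loc (a i) (b i)).
Local Notation partner := (partner a b).
Local Notation grad_match := (grad_match a b).
Let ab i : a i <> b i. Proof. exact: (mesh_neq M). Qed.

Implicit Types (c r : 'I_n -> R * R * R) (m u : 'I_n -> 'I_4 -> R).

Lemma ipC (c c' : R * R * R) : ip c c' = ip c' c.
Proof. by rewrite /ip; field. Qed.

Lemma ip_eq0 (c : R * R * R) : ip c c = 0 -> c = 0.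
Proof.
case: c => [[p q] s]; rewrite /ip /= => h.
have p2 := sqr_ge0 p; have q2 := sqr_ge0 q; have s2 := sqr_ge0 s.
have hp : p ^+ 2 = 0 by rewrite !expr2 in p2 q2 s2 *; lra.
have hq : q ^+ 2 = 0 by rewrite !expr2 in p2 q2 s2 *; lra.
have hs : s ^+ 2 = 0 by rewrite !expr2 in p2 q2 s2 *; lra.
by move/eqP: hp; move/eqP: hq; move/eqP: hs; rewrite !sqrf_eq0 => /eqP -> /eqP -> /eqP ->.
Qed.

Lemma ip_ge0 (c : R * R * R) : 0 <= ip c c.
Proof.
have p2 := sqr_ge0 c.1.1; have q2 := sqr_ge0 c.1.2; have s2 := sqr_ge0 c.2.
by rewrite /ip; rewrite !expr2 in p2 q2 s2 *; lra.
Qed.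

Lemma grad_curl_orthogonal m u : grad_match m -> edge_match a b u ->
  \sum_i ip (gradc (m i)) (curlc (u i)) = 0.
Proof.
move=> [mm m0] um.
under eq_bigr => i _ do rewrite ipC ip_gradc.
rewrite (pair_bigA _ (fun i k => flux (curlc (u i)) k * m i k)) /=.
apply: (partner_cancel M) => [e f ef|e ne]; last by rewrite m0 ?mulr0.
rewrite (mm _ _ ef) !flux_curlc; have [-> ->] := um _ _ ef.
ring.
Qed.

Lemma projection_flux c : exists2 m, grad_match m & forall e f, partner e f ->
  let r i := c i - gradc (m i) in flux (r e.1) e.2 = - flux (r f.1) f.2.
Proof.
pose B (c c' : 'I_n -> R * R * R) := \sum_i ip (c i) (c' i).
(* The basis function of an interior edge: mean [1] on its two sides and [0] on all other edges.
   Orthogonality to its gradient says that the two fluxes cancel. *)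
pose me (e : 'I_n * 'I_4) i k : R :=
  if `[< exists f, partner e f >] then (`[< (i, k) = e \/ partner e (i, k) >])%:R else 0.
have [] := @orthogonal_projection R ('I_n -> R * R * R) B _ _ _
   [seq (fun i => gradc (me e i)) | e <- enum {: 'I_n * 'I_4}] c.
- by move=> x y; apply: eq_bigr => i _; rewrite ipC.
- move=> k x y z; rewrite /B mulr_sumr -big_split /=; apply: eq_bigr => i _.
  rewrite -[(k *: x + y) i]/(k *: x i + y i) /ip /= !scaleRE; by field.
- move=> x h; apply/funext => i; apply: ip_eq0.
  by apply: (psumr_eq0P _ h) => // j _; exact: ip_ge0.
move=> w [Ww ow].
have [m mm wE] : exists2 m, grad_match m & forall i, w i = gradc (m i).
  apply: (Ww (fun w => exists2 m, grad_match m & forall i, w i = gradc (m i))).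
    split.
      exists (fun _ _ => 0); first by split.
      by move=> i; rewrite /gradc; congr (_, _, _); ring.
    move=> k x y [m1 [mm1 m10] E1] [m2 [mm2 m20] E2].
    exists (fun i l => k * m1 i l + m2 i l).
      split=> [e f ef|e ne]; first by rewrite (mm1 _ _ ef) (mm2 _ _ ef).
      by rewrite m10// m20// mulr0 addr0.
    move=> i; rewrite -[(k *: x + y) i]/(k *: x i + y i) E1 E2.
    by rewrite /gradc; congr (_, _, _); rewrite /= ?scaleRE; ring.
  move=> g /mapP[e _ ->]; exists (me e) => //; split=> [e1 f1 ef|e1 ne].
    rewrite /me; case: asboolP => // _; congr (_%:R).
    rewrite -!surjective_pairing; congr nat_of_bool; apply: asbool_equiv_eq; split.
      move=> [E|ee1]; first by right; rewrite -E.
      by left; apply: (partner_fun M ef); exact: partner_sym.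
    move=> [E|ee1]; first by right; apply: partner_sym; rewrite -E.
    by left; apply: (partner_fun M (partner_sym ef)); exact: partner_sym.
  rewrite /me; case: asboolP => // -[f ef]; rewrite -surjective_pairing.
  case: asboolP => // -[E|ee1]; first by case: (ne f); rewrite E.
  by case: (ne e); exact: partner_sym.
exists m => // e f ef /=.
have := ow (fun i => gradc (me e i)); rewrite /B => /(_ _)/eqP h.
have {}h := h (map_f _ (mem_enum _ e)).
move: h.
have -> : \sum_i ip ((c - w) i) (gradc (me e i)) =
    \sum_i \sum_k flux (c i - gradc (m i)) k * me e i k.
  by apply: eq_bigr => i _; rewrite ip_gradc -[(c - w) i]/(c i - w i) wE.
rewrite (pair_bigA _ (fun i k => flux (c i - gradc (m i)) k * me e i k)) /=.
have ee : `[< exists f, partner e f >] by apply/asboolP; exists f.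
rewrite (@sum_two _ _ _ e f).
- rewrite /me ee -!surjective_pairing.
  have -> : `[< e = e \/ partner e e >] by apply/asboolP; left.
  have -> : `[< f = e \/ partner e f >] by apply/asboolP; right.
  by rewrite !mulr1 addr_eq0 => /eqP.
- by apply/eqP => E; move: (partner_neq M ef); rewrite E eqxx.
- move=> k ke kf; rewrite /me ee -surjective_pairing; case: asboolP; last by rewrite mulr0.
  move=> [E|ek]; first by rewrite E eqxx in ke.
  by rewrite (partner_fun M ek ef) eqxx in kf.
Qed.

(* Fluxes that cancel across the edges are increments of a function of the
   vertices, since the domain is simply connected. *)
Lemma flux_potential r : simply_connected Omega ->
  (forall e f, partner e f -> flux (r e.1) e.2 = - flux (r f.1) f.2) ->
  exists2 u, edge_match a b u & forall i, curlc (u i) = r i.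
Proof.
move=> sO rf.
(* Partial sums of the fluxes from corner [0] onwards; they close up by [flux_sum0]. *)
pose u0 i (k : 'I_4) : R := let f := flux (r i) in
  nth 0 [:: 0; f ord0; f ord0 + f (ordS ord0); f ord0 + f (ordS ord0) + f (ordS (ordS ord0))] k.
have u0E i k : u0 i (ordS k) - u0 i k = flux (r i) k.
  have := flux_sum0 (r i); rewrite sum4 => h.
  by elim/I4_ind: k; rewrite /u0 ?ordS4 /=; lra.
pose v i p := qbil (u0 i) (loc_ i p).
pose ctr i := th_ i (2^-1, 2^-1).
pose link i j := exists k l, partner (i, k) (j, l).
have vE i k t : v i (vt i k + t *: (vt i (ordS k) - vt i k)) = (1 - t) * u0 i k + t * u0 i (ordS k).
  by apply: qbil_edge; exact: ab.
have rev (p q : R * R) (t : R) : p + t *: (q - p) = q + (1 - t) *: (p - q).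
  by apply: pairP; rewrite /= !scaleRE; ring.
have [] := @exists_potential R n (fun i => sq i) v Omega ctr link.
- by move=> i; apply: closed_square_on; exact: ab.
- by move=> p /subset_closure; rewrite (mesh_cover M).
- by [].
- move=> i j z z' iz jz iz' jz'; have [->//|ij] := eqVneq i j.
  have [|[k [l [kl E]]]|[k E]] := mesh_meetP M ij; first by exists z.
    have [t t01 zE] : segment (vt i k) (vt i (ordS k)) z by rewrite -E.
    have [t' t01' zE'] : segment (vt i k) (vt i (ordS k)) z' by rewrite -E.
    have := rf _ _ kl; rewrite /= -!u0E => fl.
    rewrite -zE -zE' !vE; case: (kl) => /= -> ->.
    rewrite (rev _ _ t) (rev _ _ t') !vE.
    move: fl; move: (u0 i k) (u0 i (ordS k)) (u0 j l) (u0 j (ordS l)) => x1 x2 y1 y2 fl.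
    have -> : x2 = x1 - (y2 - y1) by rewrite -fl; ring.
    ring.
  have zE : z = vt i k by have : (sq i `&` sq j) z by []; rewrite E.
  have zE' : z' = vt i k by have : (sq i `&` sq j) z' by []; rewrite E.
  by rewrite zE zE' !subrr.
- move=> i; have h2 : interior (sq i) (ctr i).
    by apply/interior_square_on_th; [exact: ab|apply/ThoP; rewrite /=; lra].
  by split; [exact: interior_subset|exact: (interior_sq_Omega M) h2].
- move=> i j [k [l kl]] t t01.
  (* In the frame of the common edge the two centres are [(1/2, 1/2)] and [(1/2, -1/2)]: the segment
     crosses the edge at its midpoint. *)
  have E : ctr i + t *: (ctr j - ctr i) = th (vt i k) (vt i (ordS k)) (2^-1, 2^-1 - t).
    have -> : ctr i = th (vt i k) (vt i (ordS k)) (2^-1, 2^-1).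
      rewrite th_rotz /ctr; congr th.
      by elim/I4_ind: k {kl}; rewrite /rotz /=; congr (_, _); field.
    have -> : ctr j = th (vt i k) (vt i (ordS k)) (2^-1, - 2^-1).
      case: (kl) => /= -> ->.
      have -> : ctr j = th (vt j l) (vt j (ordS l)) (2^-1, 2^-1).
        rewrite th_rotz /ctr; congr th.
        by elim/I4_ind: l {kl}; rewrite /rotz /=; congr (_, _); field.
      by move: (vt j l) (vt j (ordS l)) => Q1 Q2; rewrite !thE; apply: pairP => /=; field.
    by move: (vt i k) (vt i (ordS k)) => Q1 Q2; rewrite !thE; apply: pairP; rewrite /= !scaleRE; field.
  have h1 : 0 < (2^-1 : R) < 1 by lra.
  have h2 : -1 < 2^-1 - t < 1 by lra.
  have /= [hO hi hj] := partner_double M kl h1 h2.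
  rewrite E; split => //.
  by have [y0|y0] := leP 0 (2^-1 - t); [left; exact: hi|right; apply: hj; exact: ltW].
move=> k kE; exists (fun i l => u0 i l + k i).
  move=> e f ef; have lef : link e.1 f.1.
    by exists e.2, f.2; rewrite -!surjective_pairing.
  have := kE _ _ lef; have [h1 h2] := ef => K.
  have e0 (i : 'I_n) l : sq i (vt i l).
    by apply/square_on_th; [exact: ab|exact: That_cz].
  have vv i l : v i (vt i l) = u0 i l.
    by have := vE i l 0; rewrite scale0r addr0 subr0 mul1r mul0r addr0.
  split.
    by have := K (vt e.1 e.2) (e0 _ _); rewrite {1 3}h1 !vv; apply; exact: e0.
  by have := K (vt e.1 (ordS e.2)) (e0 _ _); rewrite {1 3}h2 !vv; apply; exact: e0.
move=> i; apply: curlc_flux => l; rewrite -u0E; ring.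
Qed.

End Coefficients.

(** * From the partition to a mesh, and the decomposition *)

Section Decomposition.
Context {R : realType}.
Notation leb2 := (@leb2 R).
Implicit Types (Omega : set (R * R)) (TT : set (set (R * R)))
  (psi : set (R * R) -> R * R -> R * R).

Lemma mesh_of_partition Omega TT psi : admissible_domain Omega ->
  regular_square_partition Omega TT -> (forall T, TT T -> bilinear_transformation (psi T) T) ->
  exists n (a b : 'I_n -> R * R), [/\ is_mesh Omega a b,
    forall T, TT T <-> exists i, T = square_on (a i) (b i) &
    forall i, (forall z, That z -> psi (square_on (a i) (b i)) z = th (a i) (b i) z) \/
      (forall z, That z -> psi (square_on (a i) (b i)) z = th (a i) (b i) (swap z))].
Proof.
move=> [[oO _ _ _] [_ lO]] [/finite_seqP[s0 TT0] sqT cov meet] bil.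
(* Without repetitions, so that distinct indices give distinct squares. *)
pose s := undup s0.
have TTs T : TT T <-> T \in s by rewrite TT0 mem_undup.
pose T (i : 'I_(size s)) := nth set0 s i.
have TTi i : TT (T i) by apply/TTs; exact: mem_nth.
have T_inj : injective T.
  by move=> i j /eqP; rewrite nth_uniq ?undup_uniq// => /eqP/val_inj.
have T_surj X : TT X -> exists i, X = T i.
  move=> /TTs Xs; have lt : (index X s < size s)%N by rewrite index_mem.
  by exists (Ordinal lt); rewrite /T /= nth_index.
have /choice[ab abP] : forall i, exists AB : (R * R) * (R * R), [/\ AB.1 <> AB.2,
    T i = square_on AB.1 AB.2 &
    (forall z, That z -> psi (T i) z = th AB.1 AB.2 z) \/
    (forall z, That z -> psi (T i) z = th AB.1 AB.2 (z.2, z.1))].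
  move=> i; have [A [B [h1 h2 h3]]] := bilinear_square (sqT _ (TTi i)) (bil _ (TTi i)).
  by exists (A, B).
have TE i : square_on (ab i).1 (ab i).2 = T i by case: (abP i).
exists (size s), (fun i => (ab i).1), (fun i => (ab i).2); split.
- split.
  + by move=> i; case: (abP i).
  + by move=> i j; rewrite /= !TE; exact: T_inj.
  + rewrite cov; apply/seteqP; split=> p [X].
      by move=> /T_surj[i ->] pX; exists i => //; rewrite TE.
    by move=> _; rewrite TE => pX; exists (T X).
  + move=> i j ij; rewrite !TE; apply: meet => //.
    by move/T_inj => E; rewrite E eqxx in ij.
  + exact: lipschitz_interior_closure.
- move=> X; split; first by move=> /T_surj[i ->]; exists i; rewrite TE.
  by move=> [i ->]; rewrite TE.
- by move=> i; rewrite TE; case: (abP i).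
Qed.

End Decomposition.

Theorem theorem4p3 (R : realType) (Omega : set (R * R))
    (TT : set (set (R * R))) (psi : set (R * R) -> R * R -> R * R)
    (hOmega : admissible_domain Omega)
    (hTT : regular_square_partition Omega TT)
    (hpsi : forall T, TT T -> bilinear_transformation (psi T) T) :
  L2_direct_sum Omega (X1rect Omega TT psi)
    (gradNC_VrotNC Omega TT psi) (Curl_VQ1 Omega TT psi) /\
  L2_orthogonal Omega (gradNC_VrotNC Omega TT psi) (Curl_VQ1 Omega TT psi).
Proof.
have [n [a [b [M TTE psiE]]]] := mesh_of_partition hOmega hTT hpsi.
have sO : simply_connected Omega by case: hOmega => [[]].
have Lg s : gradNC_VrotNC Omega TT psi s -> L2field Omega s by move=> [v _ []].
have Lc s : Curl_VQ1 Omega TT psi s -> L2field Omega s by move=> [v _ []].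
have orth : L2_orthogonal Omega (gradNC_VrotNC Omega TT psi) (Curl_VQ1 Omega TT psi).
  move=> s1 s2 V1 W2.
  have [m mm h1] := grad_coef M TTE psiE V1; have [u um h2] := Curl_coef M TTE psiE W2.
  rewrite (Rintegral_ip M (Lg _ V1) (Lc _ W2) h1 h2).
  exact: (grad_curl_orthogonal M mm um).
split=> //; split; last first.
  (* A field in both spaces is orthogonal to itself. *)
  move=> s Vs Ws; have Ls := Lg _ Vs.
  have [m mm h1] := grad_coef M TTE psiE Vs.
  have Z : (\sum_i ip (gradc (m i)) (gradc (m i)) = 0)%R.
    by rewrite -(Rintegral_ip M Ls Ls h1 h1); exact: orth.
  have c0 i : gradc (m i) = (0, 0, 0)%R.
    by apply: ip_eq0; apply: (psumr_eq0P _ Z) => // j _; exact: ip_ge0.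
  apply: (has_coef_ae M h1) => i; apply: aeW => z _ l.
  by rewrite c0 mxE /fld /fld1 /fld2 /= !mul0r subrr addr0 !mulr0 addr0 mul0r.
move=> tau Lt; split.
  move=> /(X1rect_coef M TTE psiE)[_ [c hc]].
  have [m mm rf] := projection_flux M c.
  have [u um ru] := flux_potential M sO rf.
  have [L1 h1] := has_coef_field M (fun i => gradc (m i)).
  have [L2 h2] := has_coef_field M (fun i => curlc (u i)).
  exists (coef_field a b (fun i => gradc (m i))), (coef_field a b (fun i => curlc (u i))); split.
  - exact: (coef_grad M TTE psiE L1 mm h1).
  - exact: (coef_Curl M TTE psiE L2 um h2).
  (* By [ru] the curl has exactly the coefficients that the projection left over. *)
  - apply: (has_coef_ae M hc); have := has_coefD h1 h2.
    congr has_coef; apply: boolp.funext => i; rewrite ru /addc /= !addrA.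
    by case: (c i) => [[p q] r] /=; congr (_, _, _); ring.
move=> [s1 [s2 [V1 W2 E]]]; apply/(X1rect_coef M TTE psiE); split=> //.
have [m mm h1] := grad_coef M TTE psiE V1; have [u um h2] := Curl_coef M TTE psiE W2.
eexists; apply: (has_coef_aeE M E); exact: has_coefD h1 h2.
Qed.
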